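(* Let $c>0$, and let $Z=(Z_t)_{t\ge0}$ and $C=(C_t)_{t\ge 0}$ be independent subordinators without drift and with finite Lévy measures $\nu_Z$ and $\nu_C$, such that $\mu_Z:=\mathbb{E}Z_1<\infty$ and $\mu_C:=\mathbb{E}C_1<\infty$. Put $Y_t:=-ct+Z_t$, $X_t:=-ct+Z_t+C_t$, $\overline{X}_t:=\sup_{0\le s\le t}X_s$, and $$\sigma:=\inf\{t>0:\ \Delta C_t>\overline{X}_{t-}-X_{t-}\}.$$ Assume that $\mu_Z<c<\mu_Z+\mu_C$. Then $\sup_{t\ge 0}Y_t$ and $\sup_{0\le t<\sigma}X_t$ have different distributions.
   Context: All processes have càdlàg paths and start at $0$. A subordinator is a Lévy process with non-decreasing paths; it is without drift if it equals the sum of its jumps. $\Delta C_t=C_t-C_{t-}$, left limits are denoted by $t-$, and $\inf\emptyset=\infty$.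
   Formalization: The formal theorem additionally assumes that ν_Z is not the zero measure (Z is not the zero process); if Z = 0, both suprema equal 0 almost surely and the claim fails. *)

(* Defs.v *)
From HB Require Export structures.
From mathcomp Require Export all_boot all_order all_algebra.
From mathcomp Require Export all_classical all_reals all_analysis.
From mathcomp Require Export measurable_realfun.

Set Implicit Arguments.
Unset Strict Implicit.
Unset Printing Implicit Defensive.

Export Order.TTheory GRing.Theory Num.Theory numFieldNormedType.Exports.

Global Open Scope classical_set_scope.
Global Open Scope ring_scope.

(** Paths are functions [R -> R]; only their values at times [t >= 0] matter. *)
Section paths.
Context {R : realType}.
Implicit Type f : R -> R.

Definition left_lim f (t : R) : R := lim (f u @[u --> t^'-]).

Definition jump f (t : R) : R := f t - left_lim f t.

Definition cadlag f : Prop :=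
  (forall t, 0 <= t -> f u @[u --> t^'+] --> f t) /\
  (forall t, 0 < t -> cvg (f u @[u --> t^'-])).

(** A càdlàg path is bounded on compact intervals, so this real-valued supremum
    is a genuine one. *)
Definition running_sup f (t : R) : R := sup (f @` `[0, t]).

End paths.

Section processes.
Context {d : measure_display} {T : measurableType d} {R : realType}.
Variable P : probability T R.
Implicit Types X Z C : R -> T -> R.

Definition path X (w : T) : R -> R := fun t => X t w.

Definition independent_systems (F G : set_system T) : Prop :=
  forall A B, F A -> G B -> P (A `&` B) = (P A * P B)%E.

(** The sigma-algebra generated by the variables [X t], [t \in D]. *)
Definition process_sigma (D : set R) X : set_system T :=
  <<s \bigcup_(t in D) preimage_set_system setT (X t) measurable >>.

Definition independent_processes X X' : Prop :=
  independent_systems (process_sigma `[0, +oo[ X) (process_sigma `[0, +oo[ X').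

Definition same_distribution d' (U : measurableType d') (S S' : T -> U) : Prop :=
  forall B, measurable B -> P (S @^-1` B) = P (S' @^-1` B).

(** The measurability clauses ensure that only probabilities of events are
    compared. *)
Definition different_distributions d' (U : measurableType d') (S S' : T -> U) :
    Prop :=
  [/\ measurable_fun setT S, measurable_fun setT S' & ~ same_distribution S S'].

Record levy_process X : Prop := LevyProcess {
  levy_measurable : forall t, 0 <= t -> measurable_fun setT (X t) ;
  levy_start : forall w, X 0 w = 0 ;
  levy_cadlag : forall w, cadlag (path X w) ;
  levy_independent_increments : forall s t, 0 <= s -> s <= t ->
    independent_systems (process_sigma `[0, s] X)
      (preimage_set_system setT (X t \- X s) measurable) ;
  levy_stationary_increments : forall s t, 0 <= s -> s <= t ->
    same_distribution (X t \- X s) (X (t - s))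
}.

Definition subordinator Z : Prop :=
  levy_process Z /\
  forall w s t, 0 <= s -> s <= t -> path Z w s <= path Z w t.

Definition without_drift Z : Prop :=
  forall w t, 0 <= t ->
    (path Z w t)%:E = \esum_(s in `]0, t]) (jump (path Z w) s)%:E.

(** [nu B] is the expected number, per unit of time, of nonzero jumps with size
    in [B]. *)
Definition is_levy_measure X (nu : {measure set R -> \bar R}) : Prop :=
  forall B : set R, measurable B ->
    nu B = (\int[P]_w counting
      [set t : R | [/\ 0 < t <= 1, jump (path X w) t != 0 &
                       B (jump (path X w) t)]]%R)%E.

(** The infimum is taken in [\bar R], so that it is [+oo] on the empty set. *)
Definition first_new_sup_jump X C (w : T) : \bar R :=
  ereal_inf [set t%:E | t in [set t : R | 0 < t /\
    left_lim (running_sup (path X w)) t - left_lim (path X w) t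
      < jump (path C w) t]].

End processes.

(* Main.v *)
(** Only the probabilities of the events [sup Y <= 0] and [sup X <= 0] are
    compared; the first is at most [1 - mu_Z / c], the second exceeds it.
    Everything is read off the random walks obtained by sampling the processes
    along dyadic grids.

    For [Y]: the maximum of [n] steps of a random walk has the law of the walk
    reflected at [0], and a step [- b] made without a jump from the reflected
    state [0] is lost. As the drift is negative, the mean of the reflected walk
    cannot grow linearly, which bounds the probability of the state [0].

    For [X]: [sup X > 0] forces the first passage of [X] above [0] to be due to a
    jump of [Z]. Reversing time, the passages at a given step turn into records
    of the minimum of [X], and since [X] goes down by steps of size at most [c h],
    summing over these records gives
      [c P(sup X > 0) <= lim_h (1 / h) E (min (Z_h, I))],
    where [I = - inf X] is independent of [Z_h]. The right-hand side falls
    strictly below [mu_Z] because [X] has positive drift: [I] is then arbitrarily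
    small with positive probability, hence smaller than the jumps of [Z]. *)

From mathcomp Require Import finmap lra ring zify.
Require Import Defs.

Set Implicit Arguments.
Unset Strict Implicit.
Unset Printing Implicit Defensive.

(** * Independent identically distributed samples *)

(** If the two laws agreed, the bounds [c P(sup Y <= 0) <= c - mu_Z] and
    [c P(sup X > 0) <= mu_Z - eta] would add up to [c <= c - eta]. The loss is
    [eta = x delta kappa]: increments of [Z] larger than [2 x] occur at a rate of at least
    [delta > 0], which requires [nuZ <> 0], and [X] stays above [- x] on fine grids with probability
    at least [kappa > 0], uniformly in horizon and mesh. The obstacle on the side of [X] is that a
    grid only sees sums of jumps: a passage within a cell can be assigned to [Z] or to [C] only if
    they do not both increase there. For a fixed horizon this holds on all fine enough dyadic grids,
    outside a null set, since a given cell is common with probability of order [h^2] and there are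
    of order [1 / h] cells. If [C] alone moves, the passage is traced to a jump of [C] creating a
    new supremum, which is excluded before [sigma]; picking the first such jump needs the jump times
    of [C] to be locally finite. The grid errors vanish with [h] at a fixed horizon but grow with
    the horizon, so the mesh goes to 0 first. *)

Lemma measurable_preimage d d' (T : measurableType d) (U : measurableType d')
    (f : T -> U) (B : set U) :
  measurable_fun setT f -> measurable B -> measurable (f @^-1` B).
Proof. by move=> mf mB; rewrite -[f @^-1` B]setTI; exact: mf. Qed.

Section tuple_law.
Context {d : measure_display} {E : measurableType d} {R : realType} (n : nat).

Definition rectangle (B : 'I_n -> set E) : set (n.-tuple E) :=
  [set t | forall i, B i (tnth t i)].

Lemma measurable_rectangle (B : 'I_n -> set E) :
  (forall i, measurable (B i)) -> measurable (rectangle B).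
Proof.
move=> mB.
have -> : rectangle B = \big[setI/setT]_(i < n) ((fun t : n.-tuple E => tnth t i) @^-1` B i).
  rewrite -bigcap_seq; apply/seteqP; split=> t /=.
    by move=> Bt i _; exact: Bt.
  by move=> Bt i; apply: Bt; rewrite /= mem_index_enum.
apply: bigsetI_measurable => i _.
by have := @measurable_tnth _ E n i measurableT (B i) (mB i); rewrite setTI.
Qed.

(** Rectangles are stable under intersection and generate the product sigma-algebra. *)
Lemma tuple_law_unique (m1 m2 : {measure set (n.-tuple E) -> \bar R}) :
  (m1 setT < +oo)%E ->
  (forall B, (forall i, measurable (B i)) ->
    m1 (rectangle B) = m2 (rectangle B)) ->
  forall S, measurable S -> m1 S = m2 S.
Proof.
move=> m1fin m12 S mS.
pose G : set (set (n.-tuple E)) :=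
  [set S | exists2 B, (forall i, measurable (B i)) & S = rectangle B].
apply: (measure_unique G (fun=> setT)) => //.
- apply/seteqP; split; last first.
    apply: smallest_sub; first exact: sigma_algebra_measurable.
    by move=> _ [B mB ->]; exact: measurable_rectangle.
  apply: smallest_sub; first exact: smallest_sigma_algebra.
  move=> A; rewrite -bigcup_seq => -[i _ [B mB <-]].
  apply: sub_gen_smallest; exists (fun j => if j == i then B else setT).
    by move=> j; case: ifP.
  apply/seteqP; split=> t /=.
    by move=> [_ Bt] j; case: eqP => // ->.
  by move=> /(_ i); rewrite eqxx.
- move=> _ _ [B mB ->] [B' mB' ->]; exists (fun i => B i `&` B' i).
    by move=> i; exact: measurableI.
  apply/seteqP; split=> t /=; first by move=> [? ?] i; split.
  by move=> H; split=> i; have [] := H i.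
- move=> _; exists (fun=> setT) => //.
  by apply/seteqP; split.
- by rewrite bigcup_const.
- by move=> _ [B mB ->]; exact: m12.
Qed.

End tuple_law.

Section independence.
Context {d : measure_display} {T : measurableType d} {R : realType}.
Variable P : probability T R.

Definition independent_maps d1 d2 (A : measurableType d1) (B : measurableType d2)
    (U : T -> A) (V : T -> B) :=
  forall S S', measurable S -> measurable S' ->
    P (U @^-1` S `&` V @^-1` S') = (P (U @^-1` S) * P (V @^-1` S'))%E.

Lemma independent_maps_comp d1 d2 d1' d2' (A : measurableType d1)
    (B : measurableType d2) (A' : measurableType d1') (B' : measurableType d2')
    (U : T -> A) (V : T -> B) (f : A -> A') (g : B -> B') :
  measurable_fun setT f -> measurable_fun setT g ->
  independent_maps U V -> independent_maps (f \o U) (g \o V).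
Proof.
move=> mf mg UV S S' mS mS'; exact: (UV (f @^-1` S) (g @^-1` S') (measurable_preimage mf mS)
  (measurable_preimage mg mS')).
Qed.

(** The joint law of an independent pair is the product of the two laws, so Tonelli's theorem allows
    [U] to be frozen while [V] is averaged. *)
Lemma independent_integral d1 d2 (A : measurableType d1) (B : measurableType d2)
    (U : T -> A) (V : T -> B) (g : A * B -> \bar R) :
  measurable_fun setT U -> measurable_fun setT V -> independent_maps U V ->
  measurable_fun setT g -> (forall x, 0 <= g x)%E ->
  (\int[P]_w g (U w, V w) = \int[P]_w \int[P]_w' g (U w, V w'))%E.
Proof.
move=> mU mV UV mg g0.
pose Up : {mfun T >-> A} := HB.pack U (isMeasurableFun.Build _ _ _ _ U mU).
pose Vp : {mfun T >-> B} := HB.pack V (isMeasurableFun.Build _ _ _ _ V mV).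
have mW : measurable_fun setT (fun w => (U w, V w)) by exact: measurable_fun_pair.
pose Wp : {mfun T >-> (A * B)%type} :=
  HB.pack (fun w => (U w, V w)) (isMeasurableFun.Build _ _ _ _ _ mW).
have -> : (\int[P]_w g (U w, V w) = \int[distribution P Wp]_y g y)%E.
  by rewrite ge0_integral_distribution.
have -> : (\int[distribution P Wp]_y g y =
    \int[distribution P Up \x distribution P Vp]_y g y)%E.
  apply: eq_measure_integral => S mS _.
  apply: esym; apply: (@product_measure_unique _ _ _ _ _ (distribution P Up)
    (distribution P Vp) (distribution P Wp)) => //.
rewrite fubini_tonelli1// ge0_integral_distribution//.
- apply: eq_integral => w _ /=; rewrite /fubini_F.
  rewrite ge0_integral_distribution//.
  exact: measurableT_comp.
- exact: measurable_fun_fubini_tonelli_F.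
- by move=> x; exact: integral_ge0.
Qed.

Lemma independent_mul (U V : T -> R) :
  measurable_fun setT U -> measurable_fun setT V -> independent_maps U V ->
  (forall w, 0 <= U w) -> (forall w, 0 <= V w) ->
  (\int[P]_w (U w * V w)%:E = (\int[P]_w (U w)%:E) * \int[P]_w (V w)%:E)%E.
Proof.
move=> mU mV UV U0 V0.
(* The absolute values make [g] nonnegative on the whole plane, as [independent_integral] demands,
   without changing it on the range of [(U, V)]. *)
pose g := fun x : R * R => (`|x.1| * `|x.2|)%:E.
transitivity (\int[P]_w g (U w, V w))%E.
  by apply: eq_integral => w _; rewrite /g /= !ger0_norm.
rewrite independent_integral//; last 2 first.
- apply/measurable_EFinP; apply: measurable_funM.
    exact: measurableT_comp.
  exact: measurableT_comp.
- by move=> x; rewrite lee_fin mulr_ge0.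
transitivity (\int[P]_w ((U w)%:E * \int[P]_w' (V w')%:E))%E.
  apply: eq_integral => w _; rewrite -ge0_integralZl//=.
  - by apply: eq_integral => w' _; rewrite /g /= !ger0_norm.
  - exact/measurable_EFinP.
  - by move=> w' _; rewrite lee_fin.
  - by rewrite lee_fin.
rewrite ge0_integralZr//.
- exact/measurable_EFinP.
- by move=> w' _; rewrite lee_fin.
- by apply: integral_ge0 => w' _; rewrite lee_fin.
Qed.

End independence.

Section iid.
Context {d : measure_display} {T : measurableType d} {R : realType}.
Context {dE : measure_display} {E : measurableType dE}.
Variable P : probability T R.

(** One product formula encodes both independence and equality of laws, because its factors all
    refer to [V 0]; [iid_law] recovers the second by taking all sets but one equal to [setT]. *)
Record iid (V : nat -> T -> E) : Prop := Iid {
  iid_measurable : forall k, measurable_fun setT (V k) ;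
  iid_product : forall n (B : nat -> set E), (forall k, measurable (B k)) ->
    P [set w | forall k, (k < n)%N -> B k (V k w)] =
    (\prod_(k < n) P (V 0%N @^-1` B k))%E }.

Variable V : nat -> T -> E.
Hypothesis Viid : iid V.

Definition sample n (w : T) : n.-tuple E := [tuple V i w | i < n].
Definition rev_sample n (w : T) : n.-tuple E := [tuple V (rev_ord i) w | i < n].

Lemma measurable_sample n : measurable_fun setT (@sample n).
Proof.
apply/measurable_fun_tnthP => i.
rewrite (_ : _ \o _ = V i); first exact: iid_measurable.
by apply/funext => w /=; rewrite tnth_mktuple.
Qed.

Lemma measurable_rev_sample n : measurable_fun setT (@rev_sample n).
Proof.
apply/measurable_fun_tnthP => i.
rewrite (_ : _ \o _ = V (rev_ord i)); first exact: iid_measurable.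
by apply/funext => w /=; rewrite tnth_mktuple.
Qed.

Let ext n (B : 'I_n -> set E) (k : nat) : set E :=
  if insub k is Some i then B i else setT.

Let extE n (B : 'I_n -> set E) (i : 'I_n) : ext B i = B i.
Proof. by rewrite /ext valK. Qed.

Let mext n (B : 'I_n -> set E) : (forall i, measurable (B i)) ->
  forall k, measurable (ext B k).
Proof. by move=> mB k; rewrite /ext; case: insub. Qed.

Lemma iid_rectangle n (B : 'I_n -> set E) : (forall i, measurable (B i)) ->
  P (@sample n @^-1` rectangle B) = (\prod_(k < n) P (V 0%N @^-1` B k))%E.
Proof.
move=> mB; transitivity (P [set w | forall k, (k < n)%N -> ext B k (V k w)]).
  congr (P _); apply/seteqP; split=> w /=.
    move=> H k kn; have := H (Ordinal kn).
    by rewrite tnth_mktuple /= -[X in ext B X]/(val (Ordinal kn)) extE.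
  by move=> H i; rewrite tnth_mktuple; have := H i (ltn_ord i); rewrite extE.
by rewrite iid_product//; [apply: eq_bigr => i _; rewrite extE|exact: mext].
Qed.

(** The law of the sample is a product of equal factors, hence invariant under permutations of the
    coordinates. All time reversals below rest on this. *)
Lemma rev_sample_law n (S : set (n.-tuple E)) : measurable S ->
  P (@sample n @^-1` S) = P (@rev_sample n @^-1` S).
Proof.
move=> mS.
pose U1 : {mfun T >-> _} :=
  HB.pack (@sample n) (isMeasurableFun.Build _ _ _ _ _ (@measurable_sample n)).
pose U2 : {mfun T >-> _} := HB.pack (@rev_sample n)
  (isMeasurableFun.Build _ _ _ _ _ (@measurable_rev_sample n)).
apply: (@tuple_law_unique _ _ _ _ (distribution P U1) (distribution P U2)) => //.
  by rewrite /= /distribution /pushforward preimage_setT probability_setT ltry.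
move=> B mB; rewrite [LHS](iid_rectangle mB).
rewrite (reindex_inj rev_ord_inj)/=.
rewrite -(@iid_rectangle n (fun i => B (rev_ord i)))//.
congr (P _); apply/seteqP; split=> w /= H i.
  by have := H (rev_ord i); rewrite rev_ordK !tnth_mktuple.
by have := H (rev_ord i); rewrite !tnth_mktuple rev_ordK.
Qed.

(** For fixed [D], both sides are finite measures in [S], and they agree on rectangles by the
    product formula for [n.+1] variables. *)
Lemma sample_next_independent n : independent_maps P (@sample n) (V n).
Proof.
move=> S D mS mD.
have mVD k : measurable (V k @^-1` D).
  exact: measurable_preimage (iid_measurable Viid k) mD.
have VnD : P (V n @^-1` D) = P (V 0%N @^-1` D).
  have := @iid_product _ Viid n.+1 (fun k => if k == n then D else setT).
  rewrite big_ord_recr/= eqxx big1 ?mul1e => [<-|i _].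
  - congr (P _); apply/seteqP; split=> w /=.
      by move=> Dw k _; case: eqP => // ->.
    by move/(_ n (ltnSn n)); rewrite eqxx.
  - by move=> k; case: ifP.
  - by rewrite (ltn_eqF (ltn_ord i)) preimage_setT probability_setT.
have pD : P (V n @^-1` D) \is a fin_num by exact: fin_num_measure.
pose q := NngNum (fine_ge0 (measure_ge0 P (V n @^-1` D))).
pose U1 : {mfun T >-> _} :=
  HB.pack (@sample n) (isMeasurableFun.Build _ _ _ _ _ (@measurable_sample n)).
pose m1 := pushforward (mrestr P (mVD n)) U1.
pose m2 := mscale q (distribution P U1).
have -> : P (@sample n @^-1` S `&` V n @^-1` D) = m1 S by [].
have -> : (P (@sample n @^-1` S) * P (V n @^-1` D) = m2 S)%E.
  by rewrite /m2 /mscale /= fineK// muleC.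
apply: (@tuple_law_unique _ _ _ _ m1 m2) => //.
  rewrite /m1 /pushforward /mrestr /= (le_lt_trans (probability_le1 _ _)) ?ltry//.
  by rewrite preimage_setT setTI.
move=> B mB.
have m2E : (m2 (rectangle B) =
    P (V n @^-1` D) * \prod_(k < n) P (V 0%N @^-1` B k))%E.
  rewrite -(iid_rectangle mB) -[in RHS](fineK pD).
  by [].
rewrite [RHS]m2E /m1 /pushforward /mrestr /= VnD.
have mB' k : measurable (if (k < n)%N then ext B k else D).
  by case: ifP => // _; exact: mext.
transitivity (P [set w | forall k, (k < n.+1)%N ->
    (if (k < n)%N then ext B k else D) (V k w)]).
  congr (P _); apply/seteqP; split=> w /=.
    move=> [H Dw] k; rewrite ltnS leq_eqVlt => /predU1P[->|kn].
      by rewrite ltnn.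
    rewrite kn; have := H (Ordinal kn).
    by rewrite tnth_mktuple /= -[X in ext B X]/(val (Ordinal kn)) extE.
  move=> H; split; last by have := H n (ltnSn n); rewrite ltnn.
  move=> i; rewrite tnth_mktuple; have := H i (ltnW (ltn_ord i)).
  by rewrite ltn_ord extE.
rewrite [LHS](@iid_product _ Viid n.+1 (fun k => if (k < n)%N then ext B k else D) mB').
rewrite big_ord_recr/= ltnn muleC; congr (_ * _)%E.
by apply: eq_bigr => i _; rewrite ltn_ord extE.
Qed.

Lemma iid_law k (B : set E) : measurable B -> P (V k @^-1` B) = P (V 0%N @^-1` B).
Proof.
move=> mB.
have := @iid_product _ Viid k.+1 (fun j => if j == k then B else setT).
rewrite big_ord_recr/= eqxx big1 ?mul1e => [<-|i _].
- congr (P _); apply/seteqP; split=> w /=.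
    by move=> Dw j _; case: eqP => // ->.
  by move/(_ k (ltnSn k)); rewrite eqxx.
- by move=> j; case: ifP.
- by rewrite (ltn_eqF (ltn_ord i)) preimage_setT probability_setT.
Qed.

End iid.

Lemma iid_comp d d' d'' (T : measurableType d) (E : measurableType d')
    (E' : measurableType d'') (R : realType) (P : probability T R)
    (V : nat -> T -> E) (f : E -> E') :
  measurable_fun setT f -> iid P V -> iid P (fun k => f \o V k).
Proof.
move=> mf [mV VP]; split=> [k|n B mB]; first exact: measurableT_comp.
have mfB k : measurable (f @^-1` B k).
  exact: measurable_preimage mf (mB k).
by have := VP n _ mfB.
Qed.

(** * Real-valued probabilities and expectations *)

Section real_expectation.
Context {d : measure_display} {T : measurableType d} {R : realType}.
Variable P : probability T R.
Implicit Types (f g : T -> R) (A B : set T).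

Definition prob A : R := fine (P A).
Definition mean f : R := \int[P]_w f w.
Definition L1 f : Prop := P.-integrable setT (EFin \o f).

Lemma probE A : measurable A -> P A = (prob A)%:E.
Proof. by move=> mA; rewrite fineK// fin_num_measure. Qed.

Lemma prob_ge0 A : 0 <= prob A.
Proof. by rewrite fine_ge0. Qed.

Lemma prob_le1 A : measurable A -> prob A <= 1.
Proof. by move=> mA; rewrite -lee_fin -probE// probability_le1. Qed.

Lemma le_prob A B : measurable A -> measurable B -> A `<=` B ->
  prob A <= prob B.
Proof.
by move=> mA mB AB; rewrite -lee_fin -!probE//; apply: le_measure => //; exact/mem_set.
Qed.

Lemma probC A : measurable A -> prob (~` A) = 1 - prob A.
Proof.
move=> mA; apply: EFin_inj; rewrite -probE ?probability_setC ?probE//.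
exact: measurableC.
Qed.

Lemma L1_measurable f : L1 f -> measurable_fun setT f.
Proof. by move/measurable_int/measurable_EFinP. Qed.

Lemma meanE f : L1 f -> ((mean f)%:E = \int[P]_w (f w)%:E)%E.
Proof. by move=> Lf; rewrite fineK//; exact: integrable_fin_num. Qed.

Lemma L1_cst r : L1 (fun=> r).
Proof. exact: finite_measure_integrable_cst. Qed.

Lemma mean_cst r : mean (fun=> r) = r.
Proof. by rewrite /mean Rintegral_cst//= probability_setT mulr1. Qed.

Lemma L1D f g : L1 f -> L1 g -> L1 (fun w => f w + g w).
Proof.
by move=> Lf Lg; apply: eq_integrable (integrableD _ Lf Lg) => //.
Qed.

Lemma meanD f g : L1 f -> L1 g -> mean (fun w => f w + g w) = mean f + mean g.
Proof. by move=> Lf Lg; rewrite /mean RintegralD. Qed.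

Lemma L1Z k f : L1 f -> L1 (fun w => k * f w).
Proof. by move=> Lf; apply: eq_integrable (integrableZl _ k Lf). Qed.

Lemma meanZ k f : L1 f -> mean (fun w => k * f w) = k * mean f.
Proof. by move=> Lf; rewrite /mean RintegralZl. Qed.

Lemma L1N f : L1 f -> L1 (fun w => - f w).
Proof.
move=> /(L1Z (-1)); apply: eq_integrable => // w _.
by rewrite /= mulN1r.
Qed.

Lemma L1B f g : L1 f -> L1 g -> L1 (fun w => f w - g w).
Proof. by move=> Lf /L1N Lg; exact: L1D. Qed.

Lemma meanB f g : L1 f -> L1 g -> mean (fun w => f w - g w) = mean f - mean g.
Proof. by move=> Lf Lg; rewrite /mean RintegralB. Qed.

Lemma le_mean f g : L1 f -> L1 g -> (forall w, f w <= g w) -> mean f <= mean g.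
Proof. by move=> Lf Lg fg; apply: le_Rintegral. Qed.

Lemma mean_ge0 f : (forall w, 0 <= f w) -> 0 <= mean f.
Proof. by move=> f0; apply: Rintegral_ge0. Qed.

Lemma L1_le f g : measurable_fun setT f -> L1 g ->
  (forall w, `|f w| <= g w) -> L1 f.
Proof.
move=> mf Lg fg; apply: le_integrable Lg => //; first exact/measurable_EFinP.
by move=> w _; rewrite /= lee_fin (le_trans (fg w))// ler_norm.
Qed.

Lemma L1_bounded M f : measurable_fun setT f -> (forall w, `|f w| <= M) -> L1 f.
Proof. by move=> mf; apply: L1_le (L1_cst M). Qed.

Lemma L1_indic A : measurable A -> L1 (\1_A : T -> R).
Proof.
move=> mA; apply: (@L1_bounded 1) => [|w].
  exact: measurable_indic.
by rewrite indicE normr_nat; case: (_ \in _); rewrite ?ler01.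
Qed.

Lemma mean_indic A : measurable A -> mean (\1_A : T -> R) = prob A.
Proof. by move=> mA; rewrite /mean /Rintegral integral_indic// setIT. Qed.

Lemma L1_sum n (F : nat -> T -> R) : (forall i, (i < n)%N -> L1 (F i)) ->
  L1 (fun w => \sum_(i < n) F i w).
Proof.
elim: n => [_|n IH LF].
  by under eq_fun do rewrite big_ord0; exact: L1_cst.
under eq_fun do rewrite big_ord_recr /=.
by apply: L1D; [apply: IH => i ilt; apply: LF; exact: ltnW|exact: LF].
Qed.

Lemma mean_sum n (F : nat -> T -> R) : (forall i, (i < n)%N -> L1 (F i)) ->
  mean (fun w => \sum_(i < n) F i w) = \sum_(i < n) mean (F i).
Proof.
elim: n => [_|n IH LF].
  by under eq_fun do rewrite big_ord0; rewrite mean_cst big_ord0.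
under eq_fun do rewrite big_ord_recr /=.
rewrite meanD; last exact: LF.
  by rewrite big_ord_recr /= IH// => i ilt; apply: LF; exact: ltnW.
by apply: L1_sum => i ilt; apply: LF; exact: ltnW.
Qed.

Lemma prob_exists n (A : nat -> set T) : (forall i, measurable (A i)) ->
  prob [set w | exists2 i, (i < n)%N & A i w] <= \sum_(i < n) prob (A i).
Proof.
move=> mA; rewrite -lee_fin -sumEFin.
under eq_bigr do rewrite -probE//.
have -> : [set w | exists2 i, (i < n)%N & A i w] = \big[setU/set0]_(i < n) A i.
  rewrite -bigcup_mkord; apply/seteqP; split=> w /=.
    by move=> [i ilt Aiw]; exists i.
  by move=> [i ilt Aiw]; exists i.
rewrite -probE; first exact: Boole_inequality.
exact: bigsetU_measurable.
Qed.

(** Dominated convergence along integer levels [M]. This is the price of truncating an integrable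
    step. *)
Lemma mean_excess_le f : L1 f -> (forall w, 0 <= f w) ->
  forall e, 0 < e -> exists2 M, 0 < M & mean (fun w => Num.max 0 (f w - M)) <= e.
Proof.
move=> Lf f0 e e0; have mf := L1_measurable Lf.
pose g (n : nat) w := Num.max 0 (f w - n%:R).
have mg n : measurable_fun setT (g n).
  apply: measurable_maxr => //; exact: measurable_funB.
have gf n w : `|g n w| <= f w.
  rewrite ger0_norm ?le_max ?lexx// /g ge_max f0 /= gerBl//.
have Lg n : L1 (g n) by exact: L1_le Lf (gf n).
have gcvg w : g n w @[n --> \oo] --> 0.
  apply: cvg_near_cst; exists (Num.truncn (f w)).+1 => // n /= nw.
  apply/max_idPl; rewrite subr_le0 (le_trans (ltW (truncnS_gt _)))//.
  by rewrite ler_nat.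
have gcvgE : {ae P, forall w, setT w -> (g n w)%:E @[n --> \oo] --> 0%E}.
  by apply: aeW => w _; apply/fine_cvgP; split; [exact: nearW|exact: gcvg].
have gdom : {ae P, forall w n, setT w -> (`|(g n w)%:E| <= (EFin \o f) w)%E}.
  by apply: aeW => w n _; rewrite /= lee_fin.
have [_ _] := dominated_convergence measurableT
  (fun n => (measurable_EFinP _ _).2 (mg n)) (measurable_cst _) gcvgE Lf gdom.
rewrite integral0 => /fine_cvg/cvgr_lt/(_ _ e0)[n _ /(_ n.+1 (leqnSn n))/= gn].
by exists n.+1%:R => //; exact: ltW.
Qed.

Section same_law.
Context {d' : measure_display} {E : measurableType d'}.
Variables (U V : T -> E).
Hypotheses (mU : measurable_fun setT U) (mV : measurable_fun setT V).
Hypothesis UV : forall S, measurable S -> P (U @^-1` S) = P (V @^-1` S).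

Let Up : {mfun T >-> E} := HB.pack U (isMeasurableFun.Build _ _ _ _ U mU).
Let Vp : {mfun T >-> E} := HB.pack V (isMeasurableFun.Build _ _ _ _ V mV).

Let UVint (f : E -> \bar R) :
  (\int[distribution P Up]_x f x = \int[distribution P Vp]_x f x)%E.
Proof. by apply: eq_measure_integral => S mS _; exact: UV. Qed.

Lemma same_law_L1 (g : E -> R) : measurable_fun setT g ->
  L1 (g \o U) -> L1 (g \o V).
Proof.
move=> mg /integrableP[_ gU]; apply/integrableP; split.
  by apply/measurable_EFinP; exact: measurableT_comp.
have mabs : measurable_fun setT (fun x => `|(g x)%:E|%E).
  by apply: measurableT_comp => //; exact/measurable_EFinP.
rewrite -[X in (X < _)%E](@ge0_integral_distribution _ _ _ _ _ P Vp _ mabs)//.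
by rewrite -UVint ge0_integral_distribution.
Qed.

Lemma same_law_mean (g : E -> R) : measurable_fun setT g ->
  L1 (g \o U) -> mean (g \o U) = mean (g \o V).
Proof.
move=> mg LU; have LV := same_law_L1 mg LU; congr fine.
have mgE : measurable_fun setT (EFin \o g) by exact/measurable_EFinP.
rewrite -[LHS](@integral_distribution _ _ _ _ _ P Up _ mgE LU).
by rewrite UVint integral_distribution.
Qed.

End same_law.

Lemma independent_mean (U V : T -> R) :
  L1 U -> L1 V -> independent_maps P U V ->
  (forall w, 0 <= U w) -> (forall w, 0 <= V w) ->
  L1 (fun w => U w * V w) /\ mean (fun w => U w * V w) = mean U * mean V.
Proof.
move=> LU LV UV U0 V0.
have mU := L1_measurable LU; have mV := L1_measurable LV.
have E := independent_mul mU mV UV U0 V0.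
rewrite -(meanE LU) -(meanE LV) in E.
split; last by rewrite /mean /Rintegral E -EFinM.
apply/integrableP; split; first by apply/measurable_EFinP; exact: measurable_funM.
rewrite (eq_integral (fun w => (U w * V w)%:E)) ?E -?EFinM ?ltry// => w _.
by rewrite /= ger0_norm// mulr_ge0.
Qed.

End real_expectation.

(** * Random walks *)

Lemma measurable_nth d (E : measurableType d) (x0 : E) n k :
  measurable_fun setT (fun t : n.-tuple E => nth x0 t k).
Proof.
have [kn|nk] := ltnP k n; last first.
  rewrite (_ : (fun _ => _) = cst x0); first exact: measurable_cst.
  by apply/funext => t; rewrite nth_default// size_tuple.
rewrite (_ : (fun _ => _) = (fun t : n.-tuple E => tnth t (Ordinal kn))).
  exact: measurable_tnth.
by apply/funext => t; rewrite (tnth_nth x0).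
Qed.

Section sample_nth.
Context {d d' : measure_display} {T : measurableType d} {E : measurableType d'}.
Variables (V : nat -> T -> E) (x0 : E) (n : nat) (w : T).

Lemma nth_sample k : (k < n)%N -> nth x0 (sample V n w) k = V k w.
Proof. by move=> kn; rewrite -[k]/(val (Ordinal kn)) -tnth_nth tnth_mktuple. Qed.

Lemma nth_rev_sample k : (k < n)%N ->
  nth x0 (rev_sample V n w) k = V (n - k.+1)%N w.
Proof. by move=> kn; rewrite -[k]/(val (Ordinal kn)) -tnth_nth tnth_mktuple. Qed.

End sample_nth.

Section reflected_walk.
Context {R : realType}.
Implicit Types x y : nat -> R.

(** Lindley's recursion for the walk reflected at 0. Unrolled, it is the maximum of the sums of the
    last steps, which [reflected_le] expresses through upper bounds. *)
Fixpoint reflected x n : R :=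
  if n is m.+1 then Num.max 0 (reflected x m + x m) else 0.

Lemma reflected_ge0 x n : 0 <= reflected x n.
Proof. by case: n => //= n; rewrite le_max lexx. Qed.

Lemma reflected_le x n a :
  reflected x n <= a <-> forall k, (k <= n)%N -> \sum_(k <= i < n) x i <= a.
Proof.
elim: n a => [|n IH] a /=.
  split=> [a0 k|/(_ 0%N (leqnn 0))]; last by rewrite big_geq.
  by rewrite leqn0 => /eqP ->; rewrite big_geq.
rewrite ge_max; split=> [/andP[a0]|H].
  rewrite -lerBrDr => /IH H k; rewrite leq_eqVlt => /predU1P[->|kn].
    by rewrite big_geq.
  by rewrite big_nat_recr//= -lerBrDr; exact: H.
have := H n.+1 (leqnn _); rewrite big_geq// => -> /=.
rewrite -lerBrDr; apply/IH => k kn.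
by rewrite lerBrDr; have := H k (leqW kn); rewrite big_nat_recr.
Qed.

Lemma eq_reflected x y n : (forall i, (i < n)%N -> x i = y i) ->
  reflected x n = reflected y n.
Proof.
elim: n => //= n IH xy; rewrite xy// IH// => i ilt.
by apply: xy; exact: ltnW.
Qed.

Lemma reflected_bound x n K : 0 <= K -> (forall i, x i <= K) ->
  reflected x n <= n%:R * K.
Proof.
move=> K0 xK; elim: n => /= [|n IH]; first by rewrite mul0r.
by rewrite ge_max mulr_ge0//= -natr1 mulrDl mul1r lerD.
Qed.

Lemma measurable_reflected n k :
  measurable_fun setT (fun t : n.-tuple R => reflected (nth 0 t) k).
Proof.
elim: k => [|k IH] /=; first exact: measurable_cst.
apply: measurable_maxr; first exact: measurable_cst.
apply: measurable_funD => //; exact: measurable_nth.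
Qed.

End reflected_walk.

Section iid_walk.
Context {d : measure_display} {T : measurableType d} {R : realType}.
Variable P : probability T R.
Variable xi : nat -> T -> R.
Hypothesis xi_iid : iid P xi.

Local Notation prob := (prob P).
Local Notation mean := (mean P).
Local Notation L1 := (L1 P).

Let D n w := reflected (xi^~ w) n.
Let I n w := reflected (nth 0 (rev_sample xi n w)) n.

Let D_sample n w : D n w = reflected (nth 0 (sample xi n w)) n.
Proof. by apply: eq_reflected => i ilt; rewrite nth_sample. Qed.

Lemma measurable_reflected_walk n : measurable_fun setT (D n).
Proof.
rewrite (_ : D n = (fun t => reflected (nth 0 t) n) \o sample xi n).
  exact: measurableT_comp (@measurable_reflected R n n) (measurable_sample xi_iid (n := n)).
by apply/funext => w; rewrite D_sample.
Qed.

(** Reversing the sample turns sums of last steps into sums of first steps, so [I n] is the running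
    maximum of the original walk. *)
Lemma reversed_reflected_le n w a :
  I n w <= a <-> forall k, (k <= n)%N -> \sum_(i < k) xi i w <= a.
Proof.
have E k : (k <= n)%N -> \sum_(n - k <= i < n) nth 0 (rev_sample xi n w) i =
    \sum_(i < k) xi i w.
  move=> kn; rewrite -(big_mkord predT (xi^~ w)) [LHS]big_nat_rev/=.
  rewrite -{1}[(n - k)%N]add0n big_addn.
  have -> : (n - (n - k) = k)%N by rewrite subKn.
  rewrite big_nat [RHS]big_nat; apply: eq_bigr => i /andP[_ ik].
  have h : (n - k + n - (i + (n - k)).+1 < n)%N by lia.
  by rewrite nth_rev_sample//; congr xi; lia.
rewrite reflected_le; split=> H k kn; first by rewrite -E//; apply: H; exact: leq_subr.
by have := H (n - k)%N (leq_subr _ _); rewrite -E ?leq_subr// subKn.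
Qed.

Lemma measurable_partial_sums_le n a :
  measurable [set w | forall k, (k <= n)%N -> \sum_(i < k) xi i w <= a].
Proof.
rewrite (_ : [set w | _] = I n @^-1` `]-oo, a]).
  apply: measurable_preimage => //.
  exact: measurableT_comp (@measurable_reflected R n n)
    (measurable_rev_sample xi_iid (n := n)).
by apply/seteqP; split=> w /=; rewrite in_itv /= => /reversed_reflected_le.
Qed.

Lemma reflected_walk_law n a :
  P [set w | D n w <= a] =
  P [set w | forall k, (k <= n)%N -> \sum_(i < k) xi i w <= a].
Proof.
pose S : set (n.-tuple R) := [set t | reflected (nth 0 t) n <= a].
have mS : measurable S.
  rewrite (_ : S = (fun t : n.-tuple R => reflected (nth 0 t) n) @^-1` `]-oo, a]).
    by apply: measurable_preimage => //; exact: measurable_reflected.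
  by apply/seteqP; split=> w /=; rewrite in_itv.
have := rev_sample_law xi_iid mS.
rewrite (_ : _ @^-1` S = [set w | D n w <= a]); last first.
  by apply/seteqP; split=> w /=; rewrite /S/= D_sample.
move=> ->; congr (P _).
by apply/seteqP; split=> w /reversed_reflected_le.
Qed.

Lemma reflected_walk_independent n : independent_maps P (D n) (xi n).
Proof.
rewrite (_ : D n = (fun t => reflected (nth 0 t) n) \o sample xi n); last first.
  by apply/funext => w; rewrite D_sample.
have h := @independent_maps_comp _ _ _ P _ _ _ _ _ _ _ _ (sample xi n) (xi n) _ id (@measurable_reflected R n n) (@measurable_id _ _ _)
  (@sample_next_independent _ _ _ _ _ _ _ xi_iid n).
exact: h.
Qed.

(** [D n] is not monotone in [n] along a path, but it has the law of [I n], a running maximum, which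
    is. *)
Lemma mean_reflected_walk_nondecreasing n :
  (forall k, L1 (D k)) -> mean (D n) <= mean (D n.+1).
Proof.
move=> LD.
have DE k : D k = (fun t => reflected (nth 0 t) k) \o sample xi k.
  by apply/funext => w; rewrite D_sample.
have IE k : I k = (fun t => reflected (nth 0 t) k) \o rev_sample xi k by [].
have ID k : L1 (I k) /\ mean (D k) = mean (I k).
  have := LD k; rewrite DE IE => LDk.
  have mr := @measurable_reflected R k k.
  have ms := measurable_sample xi_iid (n := k).
  have mrs := measurable_rev_sample xi_iid (n := k).
  have sl := rev_sample_law xi_iid (n := k).
  split; first exact: (same_law_L1 ms mrs sl mr LDk).
  exact: (same_law_mean ms mrs sl mr LDk).
have [LI ->] := ID n; have [LI' ->] := ID n.+1.
apply: le_mean => // w; apply/reversed_reflected_le => k kn.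
have /reversed_reflected_le := lexx (I n.+1 w).
by apply; exact: leqW.
Qed.

Lemma prob_reflected_walk n a :
  prob [set w | D n w <= a] =
  prob [set w | forall k, (k <= n)%N -> \sum_(i < k) xi i w <= a].
Proof. by congr fine; exact: reflected_walk_law. Qed.

Lemma L1_reflected_walk K n : 0 <= K -> (forall i w, xi i w <= K) -> L1 (D n).
Proof.
move=> K0 xiK; apply: (@L1_bounded _ _ _ _ (n%:R * K)).
  exact: measurable_reflected_walk.
move=> w; rewrite ger0_norm ?reflected_ge0//.
by apply: reflected_bound => // i; exact: xiK.
Qed.

Lemma measurable_reflected_walk_le n a : measurable [set w | D n w <= a].
Proof.
rewrite (_ : [set w | _] = D n @^-1` `]-oo, a]).
  exact: measurable_preimage (@measurable_reflected_walk n) _.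
by apply/seteqP; split=> w /=; rewrite in_itv.
Qed.

Lemma iid_mean (g : R -> R) k : measurable_fun setT g -> L1 (g \o xi 0%N) ->
  L1 (g \o xi k) /\ mean (g \o xi k) = mean (g \o xi 0%N).
Proof.
move=> mg L0; have m0 := iid_measurable xi_iid 0; have mk := iid_measurable xi_iid k.
have law S : measurable S -> P (xi 0%N @^-1` S) = P (xi k @^-1` S).
  by move=> mS; rewrite [RHS](iid_law xi_iid).
split; first exact: (same_law_L1 m0 mk law).
by rewrite -(same_law_mean m0 mk law).
Qed.

End iid_walk.

(* If the drift is positive, the expectation of the reflected walk is
   nondecreasing, so the mean of [max 0 (xi n - D n)], the amount lost by the
   reflection, is at least the drift: the reflected walk cannot escape to
   infinity. *)
Lemma walk_bounded_below {d} {T : measurableType d} {R : realType}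
    (P : probability T R) (xi : nat -> T -> R) (b : R) :
  iid P xi -> 0 <= b -> (forall i w, - b <= xi i w) -> L1 P (xi 0%N) ->
  0 < mean P (xi 0%N) ->
  exists K kappa, [/\ 0 <= K, 0 < kappa & forall n,
    kappa <= prob P [set w | forall k, (k <= n)%N -> - K <= \sum_(i < k) xi i w]].
Proof.
move=> xi_iid b0 xib L0 m0.
pose nxi k := -%R \o xi k.
have nxi_iid : iid P nxi by exact: iid_comp xi_iid.
have nxib i w : nxi i w <= b by rewrite /nxi /= lerNl.
pose D n w := reflected (nxi^~ w) n.
have LD n : L1 P (D n) by exact: (L1_reflected_walk nxi_iid n b0).
have mpos : measurable_fun setT (fun x : R => Num.max 0 x).
  by apply: measurable_maxr => //; exact: measurable_cst.
have mxi k := iid_measurable xi_iid k.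
pose pos := fun w => Num.max 0 (xi 0%N w).
have Lpos : L1 P pos.
  have Lnorm : L1 P (fun w => `|xi 0%N w|) by exact: integrable_norm L0.
  apply: (L1_le _ Lnorm); first exact: measurableT_comp mpos (mxi 0%N).
  by move=> w; rewrite /pos ger0_norm ?le_max ?lexx// ge_max normr_ge0 ler_norm.
have pos0 w : 0 <= pos w by rewrite /pos le_max lexx.
have mpospos : 0 < mean P pos.
  by apply: (lt_le_trans m0); apply: le_mean => // w; rewrite /pos le_max lexx orbT.
(* Half of the drift is spent on the excess of the positive part over [K]; the other half, divided
   by the mean of the positive part, is the bound on the probability. *)
have e0 : 0 < mean P (xi 0%N) / 2 by rewrite divr_gt0.
have [K K0 Ktail] := mean_excess_le Lpos pos0 e0.
exists K, ((mean P (xi 0%N) / 2) / mean P pos).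
split; [exact: ltW|by rewrite divr_gt0|move=> n].
have -> : prob P [set w | forall k, (k <= n)%N -> - K <= \sum_(i < k) xi i w] =
    prob P [set w | D n w <= K].
  rewrite (prob_reflected_walk nxi_iid); congr prob.
  apply/seteqP; split=> w /= H k kn; have := H k kn.
    by rewrite lerNl -sumrN.
  by rewrite -[X in _ -> _ <= X]opprK lerN2 -sumrN.
rewrite ler_pdivrMr//.
have mA : measurable [set w | D n w <= K].
  exact: measurable_reflected_walk_le nxi_iid n K.
have [Ln mn] := iid_mean xi_iid n (@measurable_id _ _ setT) L0.
have [Lpn mpn] := iid_mean xi_iid n mpos Lpos.
have [Ltn mtn] : L1 P (fun w => Num.max 0 (Num.max 0 (xi n w) - K)) /\
    mean P (fun w => Num.max 0 (Num.max 0 (xi n w) - K)) =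
    mean P (fun w => Num.max 0 (Num.max 0 (xi 0%N w) - K)).
  have mt : measurable_fun setT (fun x : R => Num.max 0 (Num.max 0 x - K)).
    by apply: measurableT_comp (mpos) _; exact: measurable_funB.
  apply: (iid_mean xi_iid n mt); apply: (L1_le _ Lpos).
    exact: measurableT_comp mt (mxi 0%N).
  move=> w; rewrite /= ger0_norm; last by rewrite le_max lexx.
  by rewrite ge_max (pos0 w) lerBlDr lerDl ltW.
pose ind := \1_[set w | D n w <= K] : T -> R.
have Lind : L1 P ind by exact: L1_indic.
have indep : independent_maps P ind (fun w => Num.max 0 (xi n w)).
  have mi : measurable_fun setT (\1_(`]-oo, K] : set R) : R -> R) by exact: measurable_indic.
  have mposN : measurable_fun setT (fun x : R => Num.max 0 (- x)).
    exact: measurableT_comp mpos (@oppr_measurable R setT).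
  have h := @independent_maps_comp _ _ _ P _ _ _ _ _ _ _ _ (D n) (nxi n) _ _ mi mposN
    (@reflected_walk_independent _ _ _ _ _ nxi_iid n).
  rewrite (_ : (fun w => _) = (fun x : R => Num.max 0 (- x)) \o nxi n); last first.
    by apply/funext => w; rewrite /nxi /= opprK.
  rewrite (_ : ind = \1_(`]-oo, K] : set R) \o D n); first exact: h.
  by apply/funext => w; rewrite /ind /= !indicE; congr (_ %:R); apply/idP/idP;
    rewrite !inE /= in_itv.
have ind0 w : 0 <= ind w by rewrite /ind indicE.
have [Lprod mprod] := independent_mean Lind Lpn indep ind0
  (fun w => ltac:(by rewrite /= le_max lexx)).
(* The reflection loses [max 0 (xi n - D n)]. This is at most the positive part of [xi n] when
   [D n <= K], and otherwise at most its excess over [K]. *)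
have step : mean P (D n.+1) <= mean P (fun w =>
    D n w - xi n w + (ind w * Num.max 0 (xi n w) +
      Num.max 0 (Num.max 0 (xi n w) - K))).
  apply: le_mean => //; first by apply: L1D; [exact: L1B|exact: L1D].
  move=> w; rewrite /D /= -/(D n w) {1}/nxi /=.
  have D0 : 0 <= D n w by exact: reflected_ge0.
  have p0 : 0 <= Num.max 0 (xi n w) by rewrite le_max lexx.
  have px : xi n w <= Num.max 0 (xi n w) by rewrite le_max lexx orbT.
  have q0 : 0 <= Num.max 0 (Num.max 0 (xi n w) - K) by rewrite le_max lexx.
  have qp : Num.max 0 (xi n w) - K <= Num.max 0 (Num.max 0 (xi n w) - K).
    by rewrite [leRHS]maxC le_max lexx.
  move: p0 px q0 qp; set p := Num.max 0 (xi n w); set q := Num.max 0 (p - K).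
  move=> p0 px q0 qp.
  rewrite /ind indicE; have [DK|DK] := leP (D n w) K.
    by rewrite mem_set//= mul1r ge_max; clear -D0 DK K0 p0 px q0 qp; apply/andP; split; lra.
  rewrite memNset/=; last by apply/negP; rewrite -ltNge.
  by rewrite mul0r add0r ge_max; clear -D0 DK K0 p0 px q0 qp; apply/andP; split; lra.
rewrite meanD in step; [|exact: L1B|exact: L1D].
rewrite meanB// meanD// mtn mprod mn in step.
have nd := mean_reflected_walk_nondecreasing nxi_iid n LD.
rewrite -/(D n) -/(D n.+1) in nd.
rewrite mpn mean_indic// in step.
move: Ktail; rewrite /pos => Ktail.
move: step nd; rewrite /= -/pos.
set A := mean P (D n.+1); set B := mean P (D n); set m := mean P (xi 0%N) in m0 *.
set q := prob _ _; set u := mean P pos in mpospos *.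
move: Ktail; set t := mean _ _ => Ktail.
by move: Ktail; rewrite -/m; clear; lra.
Qed.

(** Summation gives [q n <= n B - delta n (n - 1) / 2], which is negative once
    [n - 1 > 2 |B| / delta]. *)
Lemma quadratic_growth_contradiction (R : realType) (q : nat -> R) (B delta : R) :
  (forall n, 0 <= q n) -> q 0%N = 0 -> 0 < delta ->
  (forall n, q n.+1 <= q n + B - delta * n%:R) -> False.
Proof.
move=> q0 q00 d0 qS.
have bound n : q n <= n%:R * B - delta * (n%:R * (n%:R - 1) / 2).
  elim: n => [|n IH]; first by rewrite q00; lra.
  have := qS n; rewrite -natr1; nra.
pose N := (Num.truncn (2 * `|B| / delta)).+2.
have NB : 2 * `|B| / delta < N%:R - 1.
  by rewrite ltrBrDr -[ltRHS]natr1 ltrD2r truncnS_gt.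
have := le_trans (q0 N) (bound N).
rewrite ltr_pdivrMr// in NB.
have N0 : 0 < N%:R :> R by rewrite ltr0n.
have := ler_norm B; nra.
Qed.

(* Second moments of the reflected walk [D n]: [E (D n.+1)^2 - E (D n)^2] is at
   most [2 E (xi 0) E (D n) + B^2], whereas [E (D n)] would grow linearly if the
   conclusion failed, since a step [- b] from [D n = 0] is lost entirely. *)
Lemma bounded_walk_nonpositive {d} {T : measurableType d} {R : realType}
    (P : probability T R) (xi : nat -> T -> R) (a b B : R) :
  iid P xi -> 0 <= b -> (forall i w, `|xi i w| <= B) ->
  (forall i w, - b <= xi i w) -> mean P (xi 0%N) < 0 ->
  (forall n, a <= prob P [set w | forall k, (k <= n)%N -> \sum_(i < k) xi i w <= 0]) ->
  a * b * prob P (xi 0%N @^-1` [set - b]) <= - mean P (xi 0%N).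
Proof.
move=> xi_iid b0 xiB xib mneg ha.
pose D n w := reflected (xi^~ w) n.
have B0 : 0 <= B by apply: le_trans (xiB 0%N point).
have xiB' i w : xi i w <= B by exact: le_trans (ler_norm _) (xiB i w).
have mxi k := iid_measurable xi_iid k.
have Lxi k : L1 P (xi k) by exact: (L1_bounded P (mxi k) (xiB k)).
have [LD mD] : (forall n, L1 P (D n)) /\ (forall n, measurable_fun setT (D n)).
  split=> n; first exact: (L1_reflected_walk xi_iid n B0).
  exact: (measurable_reflected_walk xi_iid).
have D0 n w : 0 <= D n w by exact: reflected_ge0.
have DB n w : D n w <= n%:R * B by exact: reflected_bound.
have LDsq n : L1 P (fun w => D n w * D n w).
  apply: (@L1_bounded _ _ _ _ ((n%:R * B) * (n%:R * B))).
    exact: measurable_funM.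
  by move=> w; rewrite normrM ger0_norm// ler_pM.
have mxin n : mean P (xi n) = mean P (xi 0%N).
  by have [_] := iid_mean xi_iid n (@measurable_id _ _ setT) (Lxi 0%N).
set m := mean P (xi 0%N) in mneg mxin *.
set p := prob P _.
have LDxi n : L1 P (fun w => D n w * xi n w) /\
    mean P (fun w => D n w * xi n w) = m * mean P (D n).
  (* [independent_mean] is stated for nonnegative factors, so [xi n] is shifted by its bound [B] and
     the shift is subtracted afterwards. *)
  have LB : L1 P (fun w => xi n w + B) by apply: L1D => //; exact: L1_cst.
  have indep : independent_maps P (D n) (fun w => xi n w + B).
    have mB : measurable_fun setT (fun x : R => x + B) by exact: measurable_funD.
    exact: (@independent_maps_comp _ _ _ P _ _ _ _ _ _ _ _ (D n) (xi n) id _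
      (@measurable_id _ _ _) mB (@reflected_walk_independent _ _ _ _ _ xi_iid n)).
  have xB0 w : 0 <= xi n w + B.
    by have := xiB n w; rewrite ler_norml => /andP[+ _]; rewrite -subr_ge0 opprK.
  have [Lp mp] := independent_mean (LD n) LB indep (D0 n) xB0.
  have E : (fun w => D n w * xi n w) =
      (fun w => D n w * (xi n w + B) - B * D n w).
    by apply/funext => w; ring.
  rewrite E; split; first by apply: L1B => //; exact: L1Z.
  rewrite meanB//; last exact: L1Z.
  rewrite mp meanZ// meanD//; last exact: L1_cst.
  by rewrite mxin mean_cst; ring.
rewrite leNgt; apply/negP => contra.
have eta0 : 0 < a * b * p + m by move: contra; lra.
(* A step [- b] taken from [D n = 0] gains [b] over the free walk. By independence this event has
   probability [P(D n <= 0) * p], and the first factor is at least [a] by time reversal. *)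
have ehat n : n%:R * (a * b * p + m) <= mean P (D n).
  elim: n => [|n IH]; first by rewrite mul0r mean_ge0.
  pose A := [set w | D n w <= 0] `&` (xi n @^-1` [set - b]).
  have mDn0 : measurable [set w | D n w <= 0].
    exact: measurable_reflected_walk_le xi_iid n 0.
  have mxb : measurable (xi n @^-1` [set - b]) by exact: measurable_preimage.
  have mA : measurable A by exact: measurableI.
  have pA : prob P A = prob P [set w | D n w <= 0] * p.
    apply: EFin_inj; rewrite EFinM -!probE//; last exact: measurable_preimage.
    have := @reflected_walk_independent _ _ _ _ _ xi_iid n [set` `]-oo, 0]] [set - b].
    rewrite (_ : _ @^-1` [set` `]-oo, 0]] = [set w | D n w <= 0]); last first.
      by apply/seteqP; split=> w /=; rewrite in_itv.
    by rewrite /A => -> //; rewrite (iid_law xi_iid).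
  have step : mean P (fun w => D n w + xi n w + b * \1_A w) <= mean P (D n.+1).
    have LI : L1 P (fun w => b * \1_A w) by apply: L1Z; exact: L1_indic.
    apply: le_mean => //; first by apply: L1D => //; exact: L1D.
    move=> w; rewrite /D /= -/(D n w) le_max.
    have Dn0 := D0 n w.
    rewrite indicE; have [|_] := boolP (w \in A); last first.
      by rewrite mulr0 addr0 lexx orbT.
    rewrite inE => -[/= Dw xw]; rewrite xw mulr1.
    have -> : D n w = 0 by apply/eqP; rewrite eq_le Dw Dn0.
    by rewrite add0r addNr lexx.
  have LI : L1 P (\1_A : T -> R) by exact: L1_indic.
  rewrite meanD in step; [|exact: L1D|exact: L1Z].
  rewrite meanD// meanZ// mean_indic// pA mxin in step.
  have := ha n; rewrite -(prob_reflected_walk xi_iid) -/(D n).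
  have p0 : 0 <= p by exact: prob_ge0.
  move: step IH; rewrite -natr1; set q := prob P _ => step IH aq.
  have : a * b * p <= b * (q * p).
    by rewrite (mulrC a) -mulrA ler_wpM2l// ler_wpM2r.
  move: step IH; clear; lra.
have qS n : mean P (fun w => D n.+1 w * D n.+1 w) <=
    mean P (fun w => D n w * D n w) + B * B
    - (2 * (- m) * (a * b * p + m)) * n%:R.
  have [LX mX] := LDxi n.
  have h : mean P (fun w => D n.+1 w * D n.+1 w) <=
      mean P (fun w => D n w * D n w + 2 * (D n w * xi n w) + B * B).
    apply: le_mean => //.
      apply: L1D; last exact: L1_cst.
      by apply: L1D => //; exact: L1Z.
    move=> w; rewrite /D /= -/(D n w).
    apply: (@le_trans _ _ ((D n w + xi n w) * (D n w + xi n w))).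
      case: (leP 0 (D n w + xi n w)) => [_|_]; first by [].
      by rewrite mul0r -expr2 sqr_ge0.
    have : xi n w * xi n w <= B * B.
      have := xiB n w; rewrite ler_norml => /andP[x1 x2].
      move: x1 x2; clear; nra.
    move: (xi n w) (D n w) => x y; clear; nra.
  rewrite meanD in h; [|by apply: L1D => //; exact: L1Z|exact: L1_cst].
  rewrite meanD// in h; last exact: L1Z.
  rewrite meanZ// mX mean_cst in h.
  apply: (le_trans h).
  have := ehat n; move: eta0 mneg.
  set e := a * b * p + m; set x := mean P (D n); set y := mean P _.
  move: (n%:R : R) => N; clear; nra.
apply: (quadratic_growth_contradiction _ _ _ qS).
- by move=> n; apply: mean_ge0 => w; rewrite mulr_ge0.
- rewrite (_ : (fun w => _) = fun=> 0) ?mean_cst//.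
  by apply/funext => w; rewrite /D /= mulr0.
- by rewrite !mulr_gt0// oppr_gt0.
Qed.

(** Truncating [zeta] at a level [M > 0] makes the steps bounded and only lowers the walk, so the
    hypothesis on its staying below 0 survives. The event [zeta = 0] is unchanged, and the mean
    drops by at most [e], which is arbitrary. *)
Lemma walk_nonpositive {d} {T : measurableType d} {R : realType}
    (P : probability T R) (zeta : nat -> T -> R) (a b : R) :
  iid P zeta -> 0 < b -> (forall i w, 0 <= zeta i w) -> L1 P (zeta 0%N) ->
  mean P (zeta 0%N) < b ->
  (forall n, a <= prob P
    [set w | forall k, (k <= n)%N -> \sum_(i < k) (zeta i w - b) <= 0]) ->
  a * b * prob P (zeta 0%N @^-1` [set 0]) <= b - mean P (zeta 0%N).
Proof.
move=> zi b0 z0 Lz mb ha.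
apply/ler_addgt0Pr => e e0.
have [M M0 tail] := mean_excess_le Lz (z0 0%N) e0.
pose phi (x : R) := Num.min x M - b.
have mphi : measurable_fun setT phi.
  by apply: measurable_funB => //; apply: measurable_minr => //; exact: measurable_cst.
pose xi k := phi \o zeta k.
have xi_iid : iid P xi by exact: iid_comp zi.
have mz k := iid_measurable zi k.
have minLz : L1 P (fun w => Num.min (zeta 0%N w) M).
  apply: (L1_le _ Lz); first by apply: measurable_minr => //; exact: measurable_cst.
  by move=> w; rewrite ger0_norm ?ge_min ?lexx// le_min z0 ltW.
have mxi : mean P (xi 0%N) = mean P (fun w => Num.min (zeta 0%N w) M) - b.
  by rewrite /xi /phi /comp meanB ?mean_cst//; exact: L1_cst.
have mmin : mean P (fun w => Num.min (zeta 0%N w) M) <= mean P (zeta 0%N).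
  by apply: le_mean => // w; rewrite ge_min lexx.
have mmin' : mean P (zeta 0%N) <= mean P (fun w => Num.min (zeta 0%N w) M) + e.
  apply: (@le_trans _ _ (mean P (fun w => Num.min (zeta 0%N w) M) +
      mean P (fun w => Num.max 0 (zeta 0%N w - M)))); last by rewrite lerD2l.
  have Lmax : L1 P (fun w => Num.max 0 (zeta 0%N w - M)).
    apply: (L1_le _ Lz).
      by apply: measurable_maxr; [exact: measurable_cst|exact: measurable_funB].
    move=> w; rewrite ger0_norm; last by rewrite le_max lexx.
    by rewrite ge_max z0 lerBlDr lerDl ltW.
  rewrite -meanD//; apply: le_mean => //; first exact: L1D.
  move=> w; case: (leP (zeta 0%N w) M) => h.
    by rewrite lerDl le_max lexx.
  by rewrite -lerBlDl le_max lexx orbT.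
have := @bounded_walk_nonpositive _ _ _ P xi a b (M + b) xi_iid (ltW b0).
rewrite (_ : xi 0%N @^-1` [set - b] = zeta 0%N @^-1` [set 0]); last first.
  apply/seteqP; split=> w; rewrite /xi /phi /=.
    by case: (leP (zeta 0%N w) M); lra.
  by move=> ->; rewrite min_l ?sub0r// ltW.
move=> h; apply: (le_trans (h _ _ _ _)).
- move=> i w; rewrite /xi /phi /= ler_norml.
  have := z0 i w; case: (leP (zeta i w) M) => ? ?; apply/andP; split; lra.
- move=> i w; rewrite /xi /phi /=.
  by have := z0 i w; case: (leP (zeta i w) M); lra.
- by rewrite mxi; lra.
- move=> n; apply: (le_trans (ha n)); apply: le_prob.
  + by apply: (measurable_partial_sums_le (xi := fun k => (fun x => x - b) \o zeta k));
      apply: iid_comp zi; exact: measurable_funB.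
  + exact: measurable_partial_sums_le xi_iid n 0.
  + move=> w /= H k kn; apply: le_trans (H k kn); apply: ler_sum => i _.
    by rewrite /xi /phi /= lerB// ge_min lexx.
- by rewrite mxi; lra.
Qed.

(** * Records of the minimum along a deterministic path *)

Section drifted_sums.
Context {R : realType}.
Variable b : R.
Implicit Types z : nat -> R.

Definition drifted z k := \sum_(i < k) (z i - b).

(** Minus the running minimum of the path; time [k] is a record exactly when this equals
    [- drifted z k]. *)
Fixpoint depth z k :=
  if k is j.+1 then Num.max (depth z j) (- drifted z j.+1) else 0.

Lemma drifted0 z : drifted z 0 = 0.
Proof. by rewrite /drifted big_ord0. Qed.

Lemma driftedS z k : drifted z k.+1 = drifted z k + (z k - b).
Proof. by rewrite /drifted big_ord_recr. Qed.

Lemma eq_drifted z z' k : (forall i, (i < k)%N -> z i = z' i) ->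
  drifted z k = drifted z' k.
Proof. by move=> E; apply: eq_bigr => i _; rewrite E. Qed.

Lemma depth_le z k a :
  depth z k <= a <-> forall j, (j <= k)%N -> - drifted z j <= a.
Proof.
elim: k => [|k IH] /=.
  split=> [a0 j|/(_ 0%N (leqnn 0))]; last by rewrite drifted0 oppr0.
  by rewrite leqn0 => /eqP ->; rewrite drifted0 oppr0.
rewrite ge_max; split=> [/andP[/IH H Hk] j|H].
  by rewrite leq_eqVlt => /predU1P[->//|]; exact: H.
by rewrite H// andbT; apply/IH => j jk; apply: H; exact: leqW.
Qed.

Lemma depth_ge0 z k : 0 <= depth z k.
Proof. by elim: k => //= k IH; rewrite le_max IH. Qed.

Lemma record_depth z k :
  depth z k <= - drifted z k <-> forall j, (j <= k)%N -> drifted z k <= drifted z j.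
Proof. by rewrite depth_le; split=> H j jk; have := H j jk; rewrite lerN2. Qed.

(* A record is short if the minimum drops by less than [b]; there is at most
   one short record for each positive [z k], and one at time [0]. *)
Lemma sum_over_records z (f F : R -> R) m :
  0 <= b -> (forall k, 0 <= z k) ->
  (forall x, 0 <= x -> 0 <= f x <= f 0) -> 0 <= F 0 ->
  (forall x y, 0 <= x -> x <= y -> (y - x) * f y <= F y - F x) ->
  b * (\sum_(k < m.+1)
    (depth z k <= - drifted z k)%R%:R * f (- drifted z k)) <=
  F (depth z m) + b * f 0 *
    ((\sum_(k < m) (0 < z k)%R%:R) + (depth z m <= - drifted z m)%R%:R).
Proof.
move=> b0 z0 f0 F0 fF; have f00 : 0 <= f 0 by have /andP[] := f0 0 (lexx _).
have bf0 : 0 <= b * f 0 by exact: mulr_ge0.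
(* The last indicator on the right is a credit held while the path sits at its minimum. It makes the
   induction close: each step is paid by [F], by a positive [z m], or by a change of this credit. *)
elim: m => [|m IH].
  by rewrite big_ord1 big_ord0 /= drifted0 oppr0 lexx mul1r add0r mulr1 lerDr.
rewrite big_ord_recr mulrDr [\sum_(k < m.+1) (0 < _)%R%:R]big_ord_recr.
move: IH; set A := b * \sum_(_ < _) _; set B := \sum_(k < m) _.
have d0 := depth_ge0 z m.
rewrite /= -/(depth z m) !driftedS ge_max lexx andbT.
set D := depth z m in d0 *; set S := drifted z m.
set S' := S + (z m - b).
have Fle x : D <= x -> F D <= F x.
  move=> Dx; rewrite -subr_ge0; apply: le_trans (fF _ _ d0 Dx).
  have /andP[? _] := f0 x (le_trans d0 Dx); by rewrite mulr_ge0// subr_ge0.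
have FD := Fle (Num.max D (- S')); rewrite le_max lexx /= in FD.
have {}FD := FD isT.
have rec : (D <= - S')%R%:R * f (- S') <= (D <= - S')%R%:R * f 0.
  have [DS|] := boolP (D <= - S'); last by rewrite !mul0r.
  by rewrite !mul1r; have /andP[] := f0 (- S') (le_trans d0 DS).
have brec : b * ((D <= - S')%R%:R * f (- S')) <= b * f 0 * (D <= - S')%R%:R.
  by rewrite -mulrA [f 0 * _]mulrC ler_wpM2l.
(* A positive [z m] pays for giving up the credit at time [m]; a record at time [m.+1] is then paid
   by the new credit. *)
move=> IH; have [zm|zm] := ltP 0 (z m).
  have : b * f 0 * (D <= - S)%R%:R <= b * f 0.
    by rewrite ler_piMr// lern1 leq_b1.
  move: IH FD brec; rewrite !mulrDr /= mulr1n mulr1; move: (F _) (F _) => ? ?; lra.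
have z00 : z m = 0 by apply/eqP; rewrite eq_le zm z0.
(* Away from the minimum and with [z m = 0], a new record may be short; the credit that appears with
   it pays for it. *)
have [DS|DS] := boolP (D <= - S); last first.
  move: IH FD brec; rewrite !mulrDr (negbTE DS) /= !mulr0n !mulr0.
  move: (F _) (F _) => ? ?; lra.
(* From a record, a step with [z m = 0] lowers the minimum by exactly [b], and the growth of [F]
   from [D] to [D + b] pays for it. *)
have DeqS : D = - S.
  apply/eqP; rewrite eq_le DS /=.
  by have /depth_le := lexx D; apply.
have S'E : - S' = D + b by rewrite /S' z00 DeqS; ring.
have DS' : D <= - S' by rewrite S'E lerDl.
have := fF D (- S') d0 DS'; rewrite S'E [D + b - D]addrAC subrr add0r.
move: IH; rewrite DS -S'E DS' max_r// !mulrDr mul1r /= S'E.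
move: (F _) (F _) => ? ?; lra.
Qed.

End drifted_sums.

(** * First passages caused by the first of two components *)

Section jump_first_passage.
Context {d : measure_display} {T : measurableType d} {R : realType}.
Variables (P : probability T R) (V : nat -> T -> R * R) (b : R).
Hypothesis V_iid : iid P V.
Hypothesis V_ge0 : forall k w, 0 <= (V k w).1 /\ 0 <= (V k w).2.
Hypothesis b_ge0 : 0 <= b.
Hypothesis V_L1 : L1 P (fun w => (V 0%N w).1).

Local Notation prob := (prob P).
Local Notation mean := (mean P).
Local Notation L1 := (L1 P).

Let total (x : R * R) := x.1 + x.2.
Let walk k w := drifted b (fun i => total (V i w)) k.
Let twalk n (t : n.-tuple (R * R)) k := drifted b (fun i => total (nth (0, 0) t i)) k.

Let measurable_twalk n k : measurable_fun setT (fun t : n.-tuple (R * R) => twalk t k).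
Proof.
apply: measurable_sum => i; apply: measurable_funB => //.
have mn := @measurable_nth _ _ ((0, 0) : R * R) n i.
apply: measurable_funD.
  exact: measurableT_comp measurable_fst mn.
exact: measurableT_comp measurable_snd mn.
Qed.

Let mV k : measurable_fun setT (V k). Proof. exact: iid_measurable V_iid k. Qed.
Let mV1 k : measurable_fun setT (fun w => (V k w).1).
Proof. exact: measurableT_comp measurable_fst (mV k). Qed.
Let mV2 k : measurable_fun setT (fun w => (V k w).2).
Proof. exact: measurableT_comp measurable_snd (mV k). Qed.

Let walk_sample n k w : (k <= n)%N -> twalk (sample V n w) k = walk k w.
Proof.
move=> kn; apply: eq_drifted => i ik.
by rewrite nth_sample// (leq_trans ik).
Qed.

Let measurable_walk k : measurable_fun setT (walk k).
Proof.
rewrite (_ : walk k = (fun t => twalk t k) \o sample V k).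
  exact: measurableT_comp (@measurable_twalk k k) (measurable_sample V_iid (n := k)).
by apply/funext => w; rewrite /= walk_sample.
Qed.

Let walk_rev_sample n k w : (k <= n)%N ->
  twalk (rev_sample V n w) k = walk n w - walk (n - k) w.
Proof.
move=> kn; rewrite /twalk /walk /drifted.
rewrite -!(big_mkord predT (fun i => total (V i w) - b)).
rewrite -(big_mkord predT (fun i => total (nth (0, 0) (rev_sample V n w) i) - b)).
rewrite (@big_cat_nat _ _ _ (n - k) 0 n)//= ?leq_subr//.
rewrite addrAC subrr add0r [RHS]big_nat_rev/=.
rewrite -{1}[(n - k)%N]add0n big_addn subKn//.
rewrite big_nat [RHS]big_nat; apply: eq_bigr => i /andP[_ ik].
rewrite nth_rev_sample ?(leq_trans ik)//.
by congr (total (V _ w) - b); lia.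
Qed.

Let tail y := prob [set w | y < (V 0%N w).1].

Let measurable_tail_set k y : measurable [set w | y < (V k w).1].
Proof.
rewrite (_ : [set w | _] = (fun w => (V k w).1) @^-1` `]y, +oo[).
  exact: measurable_preimage.
by apply/seteqP; split=> w /=; rewrite in_itv/= andbT.
Qed.

Let tail_nincr x y : x <= y -> tail y <= tail x.
Proof.
by move=> xy; apply: le_prob => // w /=; exact: le_lt_trans.
Qed.

Let measurable_tail : measurable_fun setT tail.
Proof. by apply: nonincreasing_measurable => //. Qed.

Let tail_law k y : prob [set w | y < (V k w).1] = tail y.
Proof.
congr fine; rewrite (_ : [set w | _] = V k @^-1` [set x | y < x.1])//.
rewrite (iid_law V_iid)// (_ : [set x | _] = fst @^-1` `]y, +oo[).
  by apply: measurable_preimage => //; exact: measurable_fst.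
by apply/seteqP; split=> w /=; rewrite in_itv/= andbT.
Qed.

Let below n : set (n.-tuple (R * R)) :=
  [set t | forall j, (j <= n)%N -> twalk t j <= 0].

Let measurable_below n : measurable (@below n).
Proof.
rewrite (_ : @below n = \bigcap_(j in [set j | (j <= n)%N])
    (fun t : n.-tuple (R * R) => twalk t j) @^-1` `]-oo, 0]).
  apply: bigcap_measurable => [|j _].
    by exists 0%N.
  exact: measurable_preimage (@measurable_twalk n j) _.
by apply/seteqP; split=> t /= H j /H; rewrite /= in_itv.
Qed.

(** The conditional probability, given the first [n] steps, that the next first component causes the
    first passage. *)
Let weight n (t : n.-tuple (R * R)) := \1_(@below n) t * tail (- twalk t n).

Let measurable_weight n : measurable_fun setT (@weight n).
Proof.
apply: measurable_funM; first by apply: measurable_indic; exact: measurable_below.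
apply: (measurableT_comp measurable_tail).
exact: measurableT_comp (@oppr_measurable R setT) (@measurable_twalk n n).
Qed.

Let weight_bound n t : 0 <= @weight n t <= 1.
Proof.
rewrite mulr_ge0 ?prob_ge0 ?indicE//= -[leRHS]mul1r.
by rewrite ler_pM ?prob_ge0// ?prob_le1// lern1 leq_b1.
Qed.

Let passage k := [set w |
  (forall j, (j <= k)%N -> walk j w <= 0) /\ 0 < walk k w + (V k w).1].

Let measurable_passage k : measurable (passage k).
Proof.
rewrite (_ : passage k = sample V k @^-1` (@below k) `&`
    (fun w => walk k w + (V k w).1) @^-1` `]0, +oo[).
  apply: measurableI.
    exact: measurable_preimage (measurable_sample V_iid (n := k))
      (@measurable_below k).
  by apply: measurable_preimage => //; exact: measurable_funD.
apply/seteqP; split=> w /=; rewrite in_itv/= andbT => -[H1 H2]; split=> // j jk.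
  by rewrite walk_sample//; exact: H1.
by rewrite -(walk_sample w jk); exact: H1.
Qed.

(** The next increment is independent of the first [k], so it can be averaged out with the past
    frozen. *)
Let passage_weight k : prob (passage k) = mean (@weight k \o sample V k).
Proof.
pose g (x : k.-tuple (R * R) * (R * R)) : \bar R :=
  (\1_[set x : k.-tuple (R * R) * (R * R) |
     below x.1 /\ 0 < twalk x.1 k + x.2.1] x)%:E.
have mG : measurable [set x : k.-tuple (R * R) * (R * R) |
     below x.1 /\ 0 < twalk x.1 k + x.2.1].
  rewrite (_ : [set x | _] = fst @^-1` (@below k) `&`
      (fun x : k.-tuple (R * R) * (R * R) => twalk x.1 k + x.2.1) @^-1` `]0, +oo[).
    apply: measurableI.
      exact: measurable_preimage measurable_fst (@measurable_below k).
    apply: measurable_preimage => //; apply: measurable_funD.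
      exact: measurableT_comp (@measurable_twalk k k) measurable_fst.
    exact: measurableT_comp measurable_fst measurable_snd.
  by apply/seteqP; split=> x /=; rewrite in_itv/= andbT.
have mg : measurable_fun setT g by apply/measurable_EFinP; exact: measurable_indic.
have g0 x : (0 <= g x)%E by rewrite lee_fin indicE.
have := independent_integral (measurable_sample V_iid (n := k)) (mV k)
  (@sample_next_independent _ _ _ _ _ _ _ V_iid k) mg g0.
have -> : (\int[P]_w g (sample V k w, V k w) = P (passage k))%E.
  transitivity (\int[P]_w (\1_(passage k) w)%:E)%E; last first.
    by rewrite (integral_indic P measurableT (@measurable_passage k)) setIT.
  apply: eq_integral => w _; rewrite /g /= !indicE; congr ((nat_of_bool _)%:R%:E).
  apply/idP/idP; rewrite !inE /= walk_sample// => -[H1 H2]; split=> // j jk.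
    by rewrite -(walk_sample w jk); exact: H1.
  by rewrite walk_sample//; exact: H1.
move=> E; rewrite -[LHS]/(fine (P (passage k))) E; congr fine.
apply: eq_integral => w _ /=.
rewrite /weight indicE; have [/= bw|bw] := boolP (sample V k w \in @below k).
  rewrite mul1r -(tail_law k) -probE//.
  transitivity (\int[P]_w' (\1_[set w' | - twalk (sample V k w) k < (V k w').1] w')%:E)%E;
    last by rewrite (integral_indic P measurableT (measurable_tail_set k _)) setIT.
  apply: eq_integral => w' _; rewrite /g /= !indicE; congr ((nat_of_bool _)%:R%:E).
  move: bw; rewrite inE => bw.
  apply/idP/idP; rewrite !inE /=.
    by move=> -[_]; rewrite -ltrBlDl sub0r.
  by move=> h; split=> //; rewrite -ltrBlDl sub0r.
rewrite mul0r integral0_eq// => w' _; rewrite /g indicE memNset//= => -[H _].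
by apply: (negP bw); rewrite inE.
Qed.

(** The reversed partial sums are [walk k - walk (k - j)]. That they are all nonpositive means that
    the path is at its minimum at time [k]. *)
Let record_weight k w : @weight k (rev_sample V k w) =
  (depth b (fun i => total (V i w)) k <= - walk k w)%R%:R * tail (- walk k w).
Proof.
have w0 : walk 0 w = 0 by exact: drifted0.
rewrite /weight walk_rev_sample// subnn w0 subr0; congr (_ * _).
rewrite indicE; congr ((nat_of_bool _)%:R); apply/idP/idP; rewrite inE => H.
  apply/record_depth => j jk; have := H (k - j)%N (leq_subr _ _).
  by rewrite walk_rev_sample ?leq_subr// subKn// subr_le0.
move=> j jk; rewrite walk_rev_sample// subr_le0.
by move/record_depth : H; apply; exact: leq_subr.
Qed.

(** This is the integral of [tail] over [[0, y]], the function to be used as [F] in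
    [sum_over_records] when [f] is [tail]. *)
Let mean_min (y : R) := mean (fun w => Num.min (V 0%N w).1 y).

Let L1_min y : 0 <= y -> L1 (fun w => Num.min (V 0%N w).1 y).
Proof.
move=> y0; apply: (L1_le _ V_L1).
  by apply: measurable_minr => //; exact: measurable_cst.
move=> w; have [v0 _] := V_ge0 0 w.
by rewrite ger0_norm ?ge_min ?lexx// le_min v0.
Qed.

Let mean_min_diff x y : 0 <= x -> x <= y -> (y - x) * tail y <= mean_min y - mean_min x.
Proof.
move=> x0 xy; have y0 := le_trans x0 xy.
rewrite /mean_min -meanB; [|exact: L1_min|exact: L1_min].
rewrite /tail -(mean_indic P (measurable_tail_set 0 y)) -meanZ; last exact: L1_indic.
apply: le_mean; first by apply: L1Z; exact: L1_indic.
  by apply: L1B; exact: L1_min.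
move=> w; rewrite indicE; have [|_] := boolP (w \in _).
  rewrite inE/= => h; rewrite mulr1 !min_r//; first by apply/ltW/(le_lt_trans xy).
  exact: ltW.
by rewrite mulr0 subr_ge0 le_min2.
Qed.

Let mean_min_le y : 0 <= y -> mean_min y <= mean (fun w => (V 0%N w).1).
Proof.
by move=> y0; apply: le_mean => //; [exact: L1_min|move=> w; rewrite ge_min lexx].
Qed.

(** Capping at [y <= x] a value larger than [2 x] loses at least [x]. The strict inequality for [X]
    originates here. *)
Let mean_min_le_small x y : 0 <= y -> y <= x ->
  mean_min y <= mean (fun w => (V 0%N w).1) - x * tail (2 * x).
Proof.
move=> y0 yx.
have LI : L1 (\1_[set w | 2 * x < (V 0%N w).1] : T -> R) by exact: L1_indic.
rewrite /tail -(mean_indic P (measurable_tail_set 0 (2 * x))) -meanZ// -meanB//; last exact: L1Z.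
apply: le_mean; [exact: L1_min|by apply: L1B => //; exact: L1Z|move=> w].
rewrite indicE; have [|_] := boolP (w \in _).
  by rewrite inE /= mulr1 ge_min => h; apply/orP; right; lra.
by rewrite mulr0 subr0 ge_min lexx.
Qed.

Let prob_active k : prob [set w | 0 < total (V k w)] <=
  tail 0 + prob [set w | 0 < (V 0%N w).2].
Proof.
have mtot : measurable_fun setT total by exact: measurable_funD.
have mpos : measurable [set x | 0 < total x].
  rewrite (_ : [set x | _] = total @^-1` `]0, +oo[); first exact: measurable_preimage.
  by apply/seteqP; split=> w /=; rewrite in_itv/= andbT.
have m2 : measurable [set w | 0 < (V 0%N w).2].
  rewrite (_ : [set w | _] = (fun w => (V 0%N w).2) @^-1` `]0, +oo[).
    exact: measurable_preimage.
  by apply/seteqP; split=> w /=; rewrite in_itv/= andbT.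
have m0 : measurable [set w | 0 < total (V 0%N w)].
  exact: measurable_preimage (mV 0%N) mpos.
have -> : prob [set w | 0 < total (V k w)] = prob [set w | 0 < total (V 0%N w)].
  by congr fine; exact: (iid_law V_iid k mpos).
rewrite /tail -!mean_indic// -meanD; [|exact: L1_indic..].
apply: le_mean; [exact: L1_indic|by apply: L1D; exact: L1_indic|move=> w].
rewrite !indicE -natrD ler_nat.
have [|//] := boolP (w \in [set w | 0 < total (V 0%N w)]).
have [h1|h1] := boolP (w \in [set w | 0 < (V 0%N w).1]); first by [].
rewrite inE /= => h; rewrite mem_set//=.
have : (V 0%N w).1 <= 0 by rewrite leNgt; apply: contra h1; rewrite inE.
by move: h; rewrite /total; lra.
Qed.

(* Conditioning on the past turns the left-hand side into a sum of
   [tail (- walk k)] over the walks that have stayed below [0]; after time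
   reversal these are the records of the minimum. *)
Lemma jump_first_passage N x : 0 <= x ->
  b * prob [set w | exists2 k, (k < N.+1)%N &
    (forall j, (j <= k)%N -> drifted b (fun i => (V i w).1 + (V i w).2) j <= 0) /\
    0 < drifted b (fun i => (V i w).1 + (V i w).2) k + (V k w).1] <=
  mean (fun w => (V 0%N w).1)
  - x * prob [set w | 2 * x < (V 0%N w).1] *
    prob [set w | forall k, (k <= N)%N ->
      - x <= drifted b (fun i => (V i w).1 + (V i w).2) k]
  + b * prob [set w | 0 < (V 0%N w).1] *
    (1 + N%:R * (prob [set w | 0 < (V 0%N w).1] + prob [set w | 0 < (V 0%N w).2])).
Proof.
move=> x0; rewrite -/(tail _) -/(tail _).
set shallow := [set w | forall k, _ -> - x <= _].
set q := prob [set w | 0 < (V 0%N w).2].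
have mshallow : measurable shallow.
  rewrite (_ : shallow = \bigcap_(k in [set k | (k <= N)%N]) walk k @^-1` `[- x, +oo[).
    apply: bigcap_measurable => [|k _]; first by exists 0%N.
    exact: measurable_preimage (measurable_walk k) _.
  by apply/seteqP; split=> w /= H k /H; rewrite /= in_itv/= andbT.
have shallowE w : shallow w <-> depth b (fun i => total (V i w)) N <= x.
  by rewrite depth_le; split=> H k kN; have := H k kN; rewrite lerNl.
pose rec k w := (depth b (fun i => total (V i w)) k <= - walk k w)%R%:R * tail (- walk k w).
have recE k : @weight k \o rev_sample V k = rec k.
  by apply/funext => w; exact: record_weight.
have Lweight k : L1 (@weight k \o sample V k).
  apply: (@L1_bounded _ _ _ P 1) => [|w].
    exact: measurableT_comp (@measurable_weight k) (measurable_sample V_iid (n := k)).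
  by have /andP[w0 w1] := @weight_bound k (sample V k w); rewrite /= ger0_norm.
have ms k := measurable_sample V_iid (n := k).
have mrs k := measurable_rev_sample V_iid (n := k).
have Lrec k : L1 (rec k).
  rewrite -recE.
  exact: (same_law_L1 (ms k) (mrs k) (@rev_sample_law _ _ _ _ _ _ _ V_iid k)
    (@measurable_weight k) (Lweight k)).
have precE k : prob (passage k) = mean (rec k).
  rewrite passage_weight -recE.
  exact: (same_law_mean (ms k) (mrs k) (@rev_sample_law _ _ _ _ _ _ _ V_iid k)
    (@measurable_weight k) (Lweight k)).
have h1 : b * prob [set w | exists2 k, (k < N.+1)%N & passage k w] <=
    mean (fun w => b * \sum_(k < N.+1) rec k w).
  rewrite meanZ; last by apply: L1_sum.
  rewrite mean_sum// ler_wpM2l//.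
  apply: le_trans (@prob_exists _ _ _ P N.+1 passage measurable_passage) _.
  by apply: ler_sum => k _; rewrite precE.
apply: (le_trans h1).
have tail0 : 0 <= tail 0 by exact: prob_ge0.
have mact k : measurable [set w | 0 < total (V k w)].
  have mt : measurable_fun setT (fun w => total (V k w)) by exact: measurable_funD.
  rewrite (_ : [set w | _] = (fun w => total (V k w)) @^-1` `]0, +oo[).
    exact: measurable_preimage.
  by apply/seteqP; split=> w /=; rewrite in_itv/= andbT.
pose act k w : R := \1_[set w | 0 < total (V k w)] w.
have Lact k : L1 (act k) by exact: L1_indic.
have Lsh : L1 (\1_shallow : T -> R) by exact: L1_indic.
have LS : L1 (fun w => \sum_(k < N) act k w) by exact: L1_sum.
have Lbound : L1 (fun w => (mean (fun w => (V 0%N w).1)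
    - x * tail (2 * x) * \1_shallow w) + b * tail 0 * (1 + \sum_(k < N) act k w)).
  apply: L1D; first by apply: L1B; [exact: L1_cst|exact: L1Z].
  by apply: L1Z; apply: L1D => //; exact: L1_cst.
have h2 : mean (fun w => b * \sum_(k < N.+1) rec k w) <=
    mean (fun w => (mean (fun w => (V 0%N w).1)
    - x * tail (2 * x) * \1_shallow w) + b * tail 0 * (1 + \sum_(k < N) act k w)).
  apply: le_mean => //; first by apply: L1Z; exact: L1_sum.
  move=> w; have tot0 k : 0 <= total (V k w).
    by have [? ?] := V_ge0 k w; exact: addr_ge0.
  have tl y : 0 <= y -> 0 <= tail y <= tail 0.
    by move=> y0; rewrite prob_ge0 tail_nincr.
  have mm0 : 0 <= mean_min 0.
    by apply: mean_ge0 => w'; have [? _] := V_ge0 0 w'; rewrite le_min lexx andbT.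
  apply: le_trans (@sum_over_records _ b _ tail mean_min N b_ge0 tot0 tl mm0 mean_min_diff) _.
  apply: lerD.
    (* On [shallow] the final depth is at most [x], so the gain of [mean_min_le_small] is available;
       elsewhere the full mean is used. *)
    rewrite indicE; have [|_] := boolP (w \in shallow).
      rewrite inE => /shallowE h; rewrite mulr1; apply: mean_min_le_small => //.
      exact: depth_ge0.
    by rewrite mulr0 subr0; apply: mean_min_le; exact: depth_ge0.
  (* The short records: at most one for each cell with a positive component, and one more for the
     indicator. *)
  rewrite ler_wpM2l ?mulr_ge0// addrC lerD ?lern1 ?leq_b1//.
  apply: ler_sum => k _; rewrite /act indicE ler_nat.
  by case: ltP => // h; rewrite mem_set.
apply: (le_trans h2).
rewrite meanD; [|by apply: L1B; [exact: L1_cst|exact: L1Z]|]; last first.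
  by apply: L1Z; apply: L1D => //; exact: L1_cst.
rewrite meanB; [|exact: L1_cst|exact: L1Z].
rewrite mean_cst !meanZ//; last by apply: L1D => //; exact: L1_cst.
rewrite mean_indic// meanD//; last exact: L1_cst.
rewrite mean_cst mean_sum// lerD2l ler_wpM2l ?mulr_ge0// lerD2l.
apply: (@le_trans _ _ (\sum_(k < N) (tail 0 + q))).
  by apply: ler_sum => k _; rewrite mean_indic//; exact: prob_active.
by rewrite sumr_const card_ord mulr_natl.
Qed.

End jump_first_passage.

(** * Increments and jumps of subordinators *)

Lemma pair_law_unique d1 d2 (A : measurableType d1) (B : measurableType d2)
    (R : realType) (m1 m2 : {measure set (A * B) -> \bar R}) :
  (m1 setT < +oo)%E ->
  (forall S S', measurable S -> measurable S' -> m1 (S `*` S') = m2 (S `*` S')) ->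
  forall S, measurable S -> m1 S = m2 S.
Proof.
move=> m1fin m12 S mS.
pose G : set (set (A * B)) :=
  [set X `*` Y | X in measurable & Y in measurable].
apply: (measure_unique G (fun=> setT)) => //.
- exact: measurable_prod_measurableType.
- move=> _ _ [X1 mX1 [Y1 mY1 <-]] [X2 mX2 [Y2 mY2 <-]]; rewrite -setXI.
  by exists (X1 `&` X2); [exact: measurableI|exists (Y1 `&` Y2) => //; exact: measurableI].
- by move=> _; exists setT => //; exists setT => //; rewrite setXTT.
- by rewrite bigcup_const.
- by move=> _ [X mX [Y mY <-]]; exact: m12.
Qed.

Section process_sigma.
Context {d : measure_display} {T : measurableType d} {R : realType}.
Implicit Types X : R -> T -> R.

(** The carrier [T] equipped with the sigma-algebra generated by the process, so that the closure
    lemmas on measurable functions prove membership in [process_sigma]. *)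
Definition sigma_type (D : set R) X : Type :=
  g_sigma_algebraType (\bigcup_(t in D) preimage_set_system setT (X t) measurable).

HB.instance Definition _ (D : set R) X := Measurable.on (sigma_type D X).

Lemma measurable_sigma_type D X t : D t ->
  measurable_fun (setT : set (sigma_type D X)) (X t : sigma_type D X -> R).
Proof.
move=> Dt _ B mB; apply: sub_sigma_algebra; exists t => //.
by exists B.
Qed.

Lemma process_sigma_measurable D X : (forall t, D t -> measurable_fun setT (X t)) ->
  process_sigma D X `<=` measurable.
Proof.
move=> mX; apply: smallest_sub; first exact: sigma_algebra_measurable.
by move=> _ [t Dt [B mB <-]]; exact: mX.
Qed.

Lemma process_sigma_sub D D' X : D `<=` D' -> process_sigma D X `<=` process_sigma D' X.
Proof.
move=> DD'; apply: smallest_sub; first exact: smallest_sigma_algebra.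
by move=> A [t Dt H]; apply: sub_sigma_algebra; exists t => //; exact: DD'.
Qed.

Lemma process_sigma_increment D X s t B : D s -> D t -> measurable B ->
  process_sigma D X ((X t \- X s) @^-1` B).
Proof.
move=> Ds Dt mB.
have := @measurable_preimage _ _ (sigma_type D X) R (X t \- X s) B.
by apply => //; apply: measurable_funB; exact: measurable_sigma_type.
Qed.

End process_sigma.

Section pair_process.
Context {d : measure_display} {T : measurableType d} {R : realType}.
Variables (P : probability T R) (Z C : R -> T -> R).
Hypotheses (levyZ : levy_process P Z) (levyC : levy_process P C).
Hypothesis ZC_indep : independent_processes P Z C.

(** These intersections are stable under intersection and generate the joint past of the two
    processes, the sigma-algebra of [past_type]. *)
Definition past_events (s : R) : set (set T) :=
  [set A `&` B | A in process_sigma `[0, s] Z & B in process_sigma `[0, s] C].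

Definition past_type (s : R) : Type := g_sigma_algebraType (past_events s).

HB.instance Definition _ (s : R) := Measurable.on (past_type s).

Let in0y (t : R) : 0 <= t -> `[0, +oo[%classic t.
Proof. by move=> t0; rewrite /= in_itv/= t0. Qed.

Let sub0y (s : R) : `[0, s]%classic `<=` `[0, +oo[%classic.
Proof. by move=> t /=; rewrite !in_itv/= andbT => /andP[]. Qed.

Let sigmaT X (D : set R) : process_sigma D X [set: T].
Proof. exact: (@measurableT _ (sigma_type D X)). Qed.

Lemma measurable_past_Z s t : 0 <= t <= s ->
  measurable_fun (setT : set (past_type s)) (Z t : past_type s -> R).
Proof.
move=> ts _ B mB; apply: sub_sigma_algebra.
exists (Z t @^-1` B); last by exists setT; [exact: sigmaT|rewrite setIC].
apply: sub_sigma_algebra; exists t; first by rewrite /= in_itv.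
by exists B => //; rewrite setTI.
Qed.

Lemma measurable_past_C s t : 0 <= t <= s ->
  measurable_fun (setT : set (past_type s)) (C t : past_type s -> R).
Proof.
move=> ts _ B mB; apply: sub_sigma_algebra.
exists setT; first exact: sigmaT.
exists (C t @^-1` B) => //.
apply: sub_sigma_algebra; exists t; first by rewrite /= in_itv.
by exists B => //; rewrite setTI.
Qed.

Let mZ t : 0 <= t -> measurable_fun setT (Z t).
Proof. exact: (levy_measurable levyZ). Qed.
Let mC t : 0 <= t -> measurable_fun setT (C t).
Proof. exact: (levy_measurable levyC). Qed.

Let sigmaZ s : process_sigma `[0, s] Z `<=` measurable.
Proof.
by apply: process_sigma_measurable => t /=; rewrite in_itv/= => /andP[t0 _]; exact: mZ.
Qed.
Let sigmaC s : process_sigma `[0, s] C `<=` measurable.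
Proof.
by apply: process_sigma_measurable => t /=; rewrite in_itv/= => /andP[t0 _]; exact: mC.
Qed.

Lemma past_events_measurable s : past_events s `<=` measurable.
Proof.
by move=> _ [A sA [B sB <-]]; apply: measurableI; [exact: sigmaZ sA|exact: sigmaC sB].
Qed.

Lemma past_measurable s (E : set T) : measurable (E : set (past_type s)) -> measurable E.
Proof.
apply: smallest_sub; first exact: sigma_algebra_measurable.
exact: past_events_measurable.
Qed.

Definition increment (s t : R) (w : T) : R * R := (Z t w - Z s w, C t w - C s w).

Lemma measurable_increment s t : 0 <= s -> 0 <= t ->
  measurable_fun setT (increment s t).
Proof.
move=> s0 t0; apply: measurable_fun_pair; apply: measurable_funB;
  by [exact: mZ|exact: mC].
Qed.

(** Independence of [Z] and [C] separates the two processes; the independent stationary increments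
    of each then separate its past from its increment. *)
Let increment_rectangle s t A B S S' : 0 <= s -> s <= t ->
  process_sigma `[0, s] Z A -> process_sigma `[0, s] C B ->
  measurable S -> measurable S' ->
  P (A `&` B `&` increment s t @^-1` (S `*` S')) =
  (P A * P (Z (t - s) @^-1` S) * (P B * P (C (t - s) @^-1` S')))%E.
Proof.
move=> s0 st sA sB mS mS'; have t0 := le_trans s0 st.
rewrite (_ : _ `&` _ = (A `&` (Z t \- Z s) @^-1` S) `&`
    (B `&` (C t \- C s) @^-1` S')); last first.
  by apply/seteqP; split=> w /=; [move=> [[? ?] [? ?]]|move=> [[? ?] [? ?]]].
rewrite ZC_indep.
- rewrite (levy_independent_increments levyZ s0 st)//; last first.
    by exists S => //; rewrite setTI.
  rewrite (levy_independent_increments levyC s0 st)//; last first.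
    by exists S' => //; rewrite setTI.
  rewrite (levy_stationary_increments levyZ s0 st)//.
  by rewrite (levy_stationary_increments levyC s0 st).
- apply: (@measurableI _ (sigma_type `[0, +oo[ Z)).
    exact: process_sigma_sub (@sub0y s) _ sA.
  exact: process_sigma_increment (in0y s0) (in0y t0) mS.
- apply: (@measurableI _ (sigma_type `[0, +oo[ C)).
    exact: process_sigma_sub (@sub0y s) _ sB.
  exact: process_sigma_increment (in0y s0) (in0y t0) mS'.
Qed.

Lemma start_rectangle r S S' : 0 <= r -> measurable S -> measurable S' ->
  P (increment 0 r @^-1` (S `*` S')) = (P (Z r @^-1` S) * P (C r @^-1` S'))%E.
Proof.
move=> r0 mS mS'.
have := @increment_rectangle 0 r setT setT S S' (lexx _) r0 (@sigmaT _ _) (@sigmaT _ _) mS mS'.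
by rewrite !setTI subr0 probability_setT !mul1e.
Qed.

(** Two monotone class arguments: the first extends [B] from rectangles with the past event in
    [past_events], the second extends the past event with [B] fixed. *)
Lemma past_increment s t (E : set T) B : 0 <= s -> s <= t ->
  measurable (E : set (past_type s)) -> measurable B ->
  P (E `&` increment s t @^-1` B) = (P E * P (increment 0 (t - s) @^-1` B))%E.
Proof.
move=> s0 st mE mB; have t0 := le_trans s0 st.
have ts0 : 0 <= t - s by rewrite subr_ge0.
have mI := measurable_increment s0 t0.
have mI0 := measurable_increment (lexx 0) ts0.
pose I : {mfun T >-> (R * R)%type} :=
  HB.pack (increment s t) (isMeasurableFun.Build _ _ _ _ _ mI).
pose I0 : {mfun T >-> (R * R)%type} :=
  HB.pack (increment 0 (t - s)) (isMeasurableFun.Build _ _ _ _ _ mI0).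
have mIB : measurable (increment s t @^-1` B) by exact: measurable_preimage.
have mIB0 : measurable (increment 0 (t - s) @^-1` B) by exact: measurable_preimage.
pose q := NngNum (fine_ge0 (measure_ge0 P (increment 0 (t - s) @^-1` B))).
have step1 A A' : process_sigma `[0, s] Z A -> process_sigma `[0, s] C A' ->
    P (A `&` A' `&` increment s t @^-1` B) =
    (P (A `&` A') * P (increment 0 (t - s) @^-1` B))%E.
  move=> sA sA'.
  have mAA : measurable (A `&` A').
    by apply: measurableI; [exact: sigmaZ sA|exact: sigmaC sA'].
  pose q1 := NngNum (fine_ge0 (measure_ge0 P (A `&` A'))).
  have q1E : P (A `&` A') = (q1%:num)%:E by rewrite /= fineK// fin_num_measure.
  pose m1 := pushforward (mrestr P mAA) I.
  pose m2 := mscale q1 (distribution P I0).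
  rewrite [in RHS]q1E setIC.
  apply: (@pair_law_unique _ _ _ _ _ m1 m2) => //.
    rewrite /= /pushforward /mrestr preimage_setT setTI.
    by rewrite (le_lt_trans (probability_le1 _ mAA)) ?ltry.
  move=> S S' mS mS'.
  have m2E : m2 (S `*` S') = (P (A `&` A') * P (increment 0 (t - s) @^-1` (S `*` S')))%E.
    by rewrite q1E.
  rewrite [RHS]m2E /= /pushforward /mrestr setIC increment_rectangle// start_rectangle//.
  rewrite ZC_indep; [|exact: process_sigma_sub (@sub0y s) _ sA|
    exact: process_sigma_sub (@sub0y s) _ sA'].
  by rewrite muleACA.
have qE : P (increment 0 (t - s) @^-1` B) = (q%:num)%:E.
  by rewrite /= fineK// fin_num_measure.
rewrite qE muleC.
apply: (@g_sigma_algebra_measure_unique _ _ T (past_events s) _ (fun=> setT) _ _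
  (mrestr P mIB) (mscale q P)) => //.
- exact: past_events_measurable.
- by move=> _; exists setT; [exact: sigmaT|exists setT; [exact: sigmaT|rewrite setTI]].
- by rewrite bigcup_const.
- move=> _ _ [A sA [A' sA' <-]] [D sD [D' sD' <-]]; rewrite setIACA.
  exists (A `&` D); first exact: (@measurableI _ (sigma_type `[0, s] Z)).
  by exists (A' `&` D') => //; exact: (@measurableI _ (sigma_type `[0, s] C)).
- move=> _ [A sA [A' sA' <-]].
  by have := step1 A A' sA sA'; rewrite qE muleC.
- move=> _; rewrite /= /mrestr setTI.
  by rewrite (le_lt_trans (probability_le1 _ mIB)) ?ltry.
Qed.

Definition cell_increment (h : R) (k : nat) := increment (k%:R * h) (k.+1%:R * h).

(** By induction: the event on the first [n] cells belongs to the past of time [n h], hence is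
    independent of the next increment. *)
Lemma iid_cell_increment h : 0 <= h -> iid P (cell_increment h).
Proof.
move=> h0; have kh0 k : 0 <= k%:R * h by rewrite mulr_ge0.
have kS k : k%:R * h <= k.+1%:R * h by rewrite ler_wpM2r// ler_nat.
split=> [k|n B mB]; first exact: measurable_increment.
have c0 : cell_increment h 0 = increment 0 h by rewrite /cell_increment mul0r mul1r.
elim: n => [|n IH].
  rewrite big_ord0 (_ : [set w | _] = setT) ?probability_setT//.
  by apply/seteqP; split.
rewrite big_ord_recr/= -IH.
pose E := [set w | forall k, (k < n)%N -> B k (cell_increment h k w)].
rewrite (_ : [set w | _] = E `&` cell_increment h n @^-1` B n); last first.
  apply/seteqP; split=> w /=.
    by move=> H; split; [move=> k kn; apply: H; exact: leqW|exact: H].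
  by move=> [H Hn] k; rewrite ltnS leq_eqVlt => /predU1P[->|/H].
rewrite past_increment//.
  by rewrite c0 -mulrBl -natr1 addrAC subrr add0r mul1r.
rewrite (_ : E = \bigcap_(k in [set k | (k < n)%N]) (cell_increment h k @^-1` B k))//.
case: n {IH} @E => [|n].
  by rewrite bigcap_mkcond; apply: bigcapT_measurable => k; case: ifP => //; rewrite inE.
apply: bigcap_measurable => [|k kn]; first by exists 0%N.
apply: (@measurable_preimage _ _ (past_type (n.+1%:R * h)) (R * R)%type) => //.
have [b1 b2] : 0 <= k%:R * h <= n.+1%:R * h /\ 0 <= k.+1%:R * h <= n.+1%:R * h.
  by rewrite !kh0 !ler_wpM2r// ler_nat// ltnW.
apply: measurable_fun_pair; apply: measurable_funB.
- exact: measurable_past_Z.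
- exact: measurable_past_Z.
- exact: measurable_past_C.
- exact: measurable_past_C.
Qed.

End pair_process.

Lemma grid_cell (R : realType) (h t : R) N : 0 < t -> t <= N%:R * h ->
  exists2 i, (i < N)%N & i%:R * h < t <= i.+1%:R * h.
Proof.
move=> t0; elim: N => [|N IH] tN; first by move: tN; rewrite mul0r leNgt t0.
have [/IH[i iN it]|Nt] := leP t (N%:R * h); first by exists i => //; exact: ltnW.
by exists N; rewrite // Nt.
Qed.

(** * Paths that are sums of their jumps *)

Section pure_jump_path.
Context {R : realType}.
Variable f : R -> R.
Hypothesis f_cadlag : cadlag f.
Hypothesis f_nd : forall s t, 0 <= s -> s <= t -> f s <= f t.
Hypothesis f0 : f 0 = 0.
Hypothesis f_jumps : forall t, 0 <= t ->
  (f t)%:E = \esum_(s in `]0, t]) (jump f s)%:E.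

Lemma left_lim_ge a t : 0 <= a -> a < t -> f a <= left_lim f t.
Proof.
move=> a0 at_; apply: limr_ge; first by apply: f_cadlag.2; exact: le_lt_trans at_.
near=> u; apply: f_nd => //; apply: ltW; near: u; exact: nbhs_left_gt.
Unshelve. all: by end_near. Qed.

Lemma left_lim_le t : 0 < t -> left_lim f t <= f t.
Proof.
move=> t0; apply: limr_le; first exact: f_cadlag.2.
near=> u; apply: f_nd.
  by apply: ltW; near: u; exact: nbhs_left_gt.
by apply: ltW; near: u; exact: nbhs_left_lt.
Unshelve. all: by end_near. Qed.

Lemma jump_ge0 t : 0 < t -> 0 <= jump f t.
Proof. by move=> t0; rewrite subr_ge0 left_lim_le. Qed.

Lemma jump_le a t b : 0 <= a -> a < t -> t <= b -> jump f t <= f b - f a.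
Proof.
move=> a0 at_ tb; apply: lerB; last exact: left_lim_ge.
by apply: f_nd => //; apply: ltW; exact: le_lt_trans at_.
Qed.

(** The absence of drift enters here: both values are sums of jumps, and the two sums differ only by
    the jumps in []a, b]]. *)
Lemma no_jump_cst a b : 0 <= a -> a <= b ->
  (forall t, a < t -> t <= b -> jump f t = 0) -> f b = f a.
Proof.
move=> a0 ab H; apply: EFin_inj.
rewrite !f_jumps//; last exact: le_trans ab.
rewrite esum_mkcond [RHS]esum_mkcond; apply: eq_esum => t _.
rewrite !mem_setE !in_itv/=.
case: (ltP 0 t) => //= t0; case: (leP t b) => /= tb; case: (leP t a) => //= ta.
  by rewrite H.
by move: (lt_le_trans tb ta); rewrite ltNge ab.
Qed.

Lemma jump_between a b : 0 <= a -> a <= b -> f a < f b ->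
  exists t, [/\ a < t, t <= b & 0 < jump f t].
Proof.
move=> a0 ab; apply: contraPP => /forallNP H; apply/negP; rewrite -leNgt.
rewrite (no_jump_cst a0 ab)// => t at_ tb; apply/eqP.
have t0 := le_lt_trans a0 at_.
rewrite eq_le jump_ge0// andbT leNgt; apply/negP => jt.
by apply: (H t).
Qed.

End pure_jump_path.

(* Applied to the number of jumps, whose measurability is not established. *)
Lemma ge0_le_integral_any d (T : measurableType d) (R : realType)
    (mu : {measure set T -> \bar R}) (f g : T -> \bar R) :
  (forall w, 0 <= f w)%E -> (forall w, f w <= g w)%E ->
  (\int[mu]_w f w <= \int[mu]_w g w)%E.
Proof.
move=> f0 fg; rewrite !ge0_integralTE//; last first.
  by move=> w; exact: le_trans (f0 w) (fg w).
apply: ge_ereal_sup => _ [h /= hf <-]; apply: ereal_sup_ubound; exists h => //.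
by move=> w; exact: le_trans (hf w) (fg w).
Qed.

(** * A subordinator sampled on a grid *)

Section subordinator_facts.
Context {d : measure_display} {T : measurableType d} {R : realType}.
Variables (P : probability T R) (X : R -> T -> R).
Variable nu : {finite_measure set R -> \bar R}.
Hypothesis subX : subordinator P X.
Hypothesis driftX : without_drift X.
Hypothesis levyX : is_levy_measure P X nu.

Local Notation prob := (prob P).
Local Notation mean := (mean P).
Local Notation L1 := (L1 P).

Let lX : levy_process P X := subX.1.

Lemma subordinator_measurable t : 0 <= t -> measurable_fun setT (X t).
Proof. exact: (levy_measurable lX). Qed.

Lemma subordinator_nd w s t : 0 <= s -> s <= t -> X s w <= X t w.
Proof. exact: subX.2. Qed.

Lemma subordinator_ge0 w t : 0 <= t -> 0 <= X t w.
Proof. by move=> t0; rewrite -(levy_start lX w) subordinator_nd. Qed.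

Lemma path_jump_le w a t b : 0 <= a -> a < t -> t <= b ->
  jump (path X w) t <= X b w - X a w.
Proof.
exact: (@jump_le R (path X w) (levy_cadlag lX w) (subX.2 w)).
Qed.

Lemma path_jump_ge0 w t : 0 < t -> 0 <= jump (path X w) t.
Proof. exact: (@jump_ge0 R (path X w) (levy_cadlag lX w) (subX.2 w)). Qed.

Lemma path_no_jump_cst w a b : 0 <= a -> a <= b ->
  (forall t, a < t -> t <= b -> jump (path X w) t = 0) -> X b w = X a w.
Proof.
exact: (@no_jump_cst R (path X w) (driftX w)).
Qed.

Lemma path_jump_between w a b : 0 <= a -> a <= b -> X a w < X b w ->
  exists t, [/\ a < t, t <= b & 0 < jump (path X w) t].
Proof.
exact: (@jump_between R (path X w) (levy_cadlag lX w) (subX.2 w) (driftX w)).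
Qed.

Lemma increment_law s t B : 0 <= s -> s <= t -> measurable B ->
  P [set w | B (X t w - X s w)] = P (X (t - s) @^-1` B).
Proof. by move=> s0 st mB; exact: (levy_stationary_increments lX s0 st). Qed.

Definition active_cell h i := [set w | X (i%:R * h) w < X (i.+1%:R * h) w].

Lemma measurable_increment_gt x s t : 0 <= s -> 0 <= t ->
  measurable [set w | x < X t w - X s w].
Proof.
move=> s0 t0; rewrite (_ : [set w | _] = (X t \- X s) @^-1` `]x, +oo[).
  apply: measurable_preimage => //.
  by apply: measurable_funB; exact: subordinator_measurable.
by apply/seteqP; split=> w /=; rewrite in_itv/= andbT.
Qed.

Lemma measurable_active_cell h i : 0 <= h -> measurable (active_cell h i).
Proof.
move=> h0; rewrite (_ : active_cell h i =
  [set w | 0 < X (i.+1%:R * h) w - X (i%:R * h) w]).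
  by apply: measurable_increment_gt; rewrite mulr_ge0.
by apply/seteqP; split=> w /=; rewrite subr_gt0.
Qed.

Lemma prob_increment_gt x h i : 0 <= h ->
  prob [set w | x < X (i.+1%:R * h) w - X (i%:R * h) w] =
  prob [set w | x < X h w].
Proof.
move=> h0; congr fine.
have st : i%:R * h <= i.+1%:R * h by rewrite ler_wpM2r// ler_nat.
have := @increment_law _ _ `]x, +oo[ (mulr_ge0 (ler0n _ i) h0) st.
rewrite -mulrBl -natr1 addrAC subrr add0r mul1r => /(_ (measurable_itv _)) E.
rewrite (_ : [set w | _ < X h w] = X h @^-1` `]x, +oo[); last first.
  by apply/seteqP; split=> w /=; rewrite in_itv/= andbT.
by rewrite -E; congr (P _); apply/seteqP; split=> w /=; rewrite in_itv/= andbT.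
Qed.

Lemma prob_active_cell h i : 0 <= h ->
  prob (active_cell h i) = prob [set w | 0 < X h w].
Proof.
move=> h0; rewrite -(prob_increment_gt 0 i h0); congr prob.
by apply/seteqP; split=> w /=; rewrite subr_gt0.
Qed.

Definition jump_times w t : set R := [set s | [/\ 0 < s, s <= t & jump (path X w) s != 0]].

Let choose_jump w h : 0 <= h -> exists tau : nat -> R, forall i, active_cell h i w ->
  [/\ i%:R * h < tau i, tau i <= i.+1%:R * h & jump (path X w) (tau i) != 0].
Proof.
move=> h0; have H i : exists t, active_cell h i w ->
    [/\ i%:R * h < t, t <= i.+1%:R * h & jump (path X w) t != 0].
  have [a|na] := pselect (active_cell h i w); last by exists 0.
  have ih : i%:R * h <= i.+1%:R * h by rewrite ler_wpM2r// ler_nat.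
  have [t [t1 t2 t3]] := path_jump_between (mulr_ge0 (ler0n _ i) h0) ih a.
  by exists t => _; split; rewrite // gt_eqF.
by have [tau Htau] := choice H; exists tau.
Qed.

(** Choosing a jump time in each active cell is injective, because the cells are disjoint. *)
Lemma active_cells_le_jumps w h N : 0 <= h ->
  finite_set (jump_times w (N%:R * h)) ->
  (\sum_(i < N) (w \in active_cell h i) <= #|` fset_set (jump_times w (N%:R * h)%R)|)%N.
Proof.
move=> h0 fJ; have [tau Htau] := choose_jump w h0.
pose s := [seq i <- iota 0 N | w \in active_cell h i].
have -> : (\sum_(i < N) (w \in active_cell h i) = size s)%N.
  rewrite -(big_mkord predT (fun i => nat_of_bool (w \in active_cell h i))).
  rewrite /index_iota subn0 /s size_filter -sum1_count [RHS]big_mkcond.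
  by apply: eq_bigr => i _; case: (_ \in _).
rewrite -(size_map tau); apply: uniq_leq_size.
  rewrite map_inj_in_uniq ?filter_uniq ?iota_uniq// => i j.
  rewrite !mem_filter => /andP[/set_mem ai _] /andP[/set_mem aj _] tij.
  have [ti1 ti2 _] := Htau i ai; have [tj1 tj2 _] := Htau j aj.
  rewrite tij in ti1 ti2; have [hp|hn] := ltP 0 h; last first.
    have := lt_le_trans ti1 ti2; rewrite -subr_gt0 -mulrBl -natr1 addrAC subrr.
    by rewrite add0r mul1r ltNge hn.
  have := lt_le_trans ti1 tj2; have := lt_le_trans tj1 ti2.
  by rewrite !ltr_pM2r// !ltr_nat !ltnS => *; apply/eqP; rewrite eqn_leq; apply/andP.
move=> t /mapP[i]; rewrite mem_filter mem_iota add0n => /andP[/set_mem ai iN] ->.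
have [t1 t2 t3] := Htau i ai.
rewrite in_fset_set//; apply/mem_set; split=> //.
  by apply: le_lt_trans t1; rewrite mulr_ge0.
by apply: (le_trans t2); rewrite ler_wpM2r// ler_nat.
Qed.

(** By stationarity the left-hand side is the expected number of active cells among the [m] cells of
    []0, 1]]. That number is at most the number of jumps, whose integral is [nu setT]. *)
Lemma prob_active_le m : (0 < m)%N ->
  m%:R * prob [set w | 0 < X m%:R^-1 w] <= fine (nu setT).
Proof.
move=> m0; have h0 : 0 <= m%:R^-1 :> R by rewrite invr_ge0.
have ma i := measurable_active_cell i h0.
pose F i : T -> R := \1_(active_cell m%:R^-1 i).
pose f w := (\sum_(i < m) F i w)%:E.
have LF i : (i < m)%N -> L1 (F i) by move=> _; exact: L1_indic.
rewrite -lee_fin fineK ?fin_num_measure//.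
apply: (@le_trans _ _ (\int[P]_w f w)%E).
  rewrite -(meanE (L1_sum LF)) lee_fin (mean_sum LF).
  under eq_bigr do rewrite mean_indic// prob_active_cell//.
  by rewrite sumr_const card_ord mulr_natl.
rewrite levyX//; apply: ge0_le_integral_any => w.
  by rewrite lee_fin sumr_ge0// => i _; rewrite /F indicE.
have -> : [set t : R | [/\ 0 < t <= 1, jump (path X w) t != 0 &
    setT (jump (path X w) t)]] = jump_times w (m%:R * m%:R^-1).
  rewrite mulfV ?pnatr_eq0 -?lt0n//.
  by apply/seteqP; split=> t /= => [[/andP[? ?] ? _]|[-> -> ->]].
rewrite /counting; case: ifPn => [/asboolP fJ|_]; last exact: leey.
rewrite lee_fin; apply: (@le_trans _ _ (\sum_(i < m) (w \in active_cell m%:R^-1 i))%N%:R).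
  by rewrite natr_sum; apply: ler_sum => i _; rewrite /F indicE.
by rewrite ler_nat active_cells_le_jumps.
Qed.

Lemma subordinator_nontrivial : nu setT <> 0%E -> 0 < prob [set w | 0 < X 1 w].
Proof.
move=> nu0; rewrite lt_neqAle prob_ge0 andbT eq_sym; apply/eqP => p0; apply: nu0.
have m1 : measurable [set w | 0 < X 1 w].
  rewrite (_ : [set w | _] = X 1 @^-1` `]0, +oo[).
    by apply: measurable_preimage => //; exact: subordinator_measurable.
  by apply/seteqP; split=> w /=; rewrite in_itv/= andbT.
apply/eqP; rewrite eq_le measure_ge0 andbT levyX//.
(* Off the event [X 1 > 0] a nondecreasing path has no jump in []0, 1]]; on it, a null event, the
   count may be bounded by infinity. *)
apply: (@le_trans _ _ (\int[P]_(w in [set w | (0 < X 1 w)%R]) +oo)%E); last first.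
  have PE : P [set w | 0 < X 1 w] = 0%E by rewrite probE// p0.
  by rewrite integral_cst// [X in (_ * X)%E]PE mule0.
rewrite [leRHS]integral_mkcond; apply: ge0_le_integral_any => // w.
rewrite /patch; case: ifPn => [_|]; first exact: leey.
rewrite notin_setE /= => /negP; rewrite -leNgt => X1.
rewrite (_ : [set t : R | _] = set0) ?/counting ?asboolT ?fset_set0//.
apply/seteqP; split=> // t /= [/andP[t0 t1] jt _].
have := path_jump_le w (lexx 0) t0 t1.
rewrite (levy_start lX) subr0 => jX.
by move/negP: jt; apply; rewrite eq_le (le_trans jX X1) path_jump_ge0.
Qed.

(** If [X 1 > 0] there is a jump larger than some [j.+1%:R^-1], and on every grid the cell
    containing it has an increment at least as large. Hence some [G j.+1%:R^-1], which does not
    depend on the grid, has positive probability; a union bound over the [m] cells turns this into a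
    rate. *)
Lemma jump_size_bound : 0 < prob [set w | 0 < X 1 w] ->
  exists x delta, [/\ 0 < x, 0 < delta & forall m, (0 < m)%N ->
    delta <= m%:R * prob [set w | x < X m%:R^-1 w]].
Proof.
move=> pX.
pose big x m := [set w | exists2 i, (i < m.+1)%N &
  x < X (i.+1%:R * m.+1%:R^-1) w - X (i%:R * m.+1%:R^-1) w].
have mbig x m : measurable (big x m).
  rewrite (_ : big x m = \bigcup_(i in [set i | (i < m.+1)%N])
    [set w | x < X (i.+1%:R * m.+1%:R^-1) w - X (i%:R * m.+1%:R^-1) w])//.
  by apply: bigcup_measurable => i _; apply: measurable_increment_gt; rewrite mulr_ge0.
pose G x := \bigcap_m big x m.
have mG x : measurable (G x) by apply: bigcapT_measurable.
have sub : [set w | 0 < X 1 w] `<=` \bigcup_j G j.+1%:R^-1.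
  move=> w /= X1.
  have X01 : X 0 w < X 1 w by rewrite (levy_start lX).
  have [t [t0 t1 jt]] := path_jump_between (lexx 0) ler01 X01.
  exists (Num.truncn (jump (path X w) t)^-1) => // m _.
  have [i im /andP[it ti]] : exists2 i, (i < m.+1)%N &
      i%:R * m.+1%:R^-1 < t <= i.+1%:R * m.+1%:R^-1.
    by apply: grid_cell => //; rewrite mulfV.
  exists i => //; apply: lt_le_trans (path_jump_le w _ it ti); last by rewrite mulr_ge0.
  by rewrite invf_plt ?posrE// truncnS_gt.
have [j Gj] : exists j, 0 < prob (G j.+1%:R^-1).
  apply: contrapT => /forallNP H; move: pX; apply/negP; rewrite -leNgt.
  have PG j : P (G j.+1%:R^-1) = 0%E.
    rewrite probE//; congr _%:E; apply/eqP; rewrite eq_le prob_ge0 andbT leNgt.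
    exact/negP/H.
  rewrite -lee_fin -probE; last first.
    rewrite (_ : [set w | _] = X 1 @^-1` `]0, +oo[).
      by apply: measurable_preimage => //; exact: subordinator_measurable.
    by apply/seteqP; split=> w /=; rewrite in_itv/= andbT.
  apply: (@le_trans _ _ (\sum_(j <oo) P (G (j.+1%:R^-1)%R))%E).
    apply: measure_sigma_subadditive => //.
    rewrite (_ : [set w | _] = X 1 @^-1` `]0, +oo[).
      by apply: measurable_preimage => //; exact: subordinator_measurable.
    by apply/seteqP; split=> w /=; rewrite in_itv/= andbT.
  by rewrite eseries0.
exists j.+1%:R^-1, (prob (G j.+1%:R^-1)); split => // m m0.
case: m m0 => // m _.
have h0 : 0 <= m.+1%:R^-1 :> R by rewrite invr_ge0.
apply: (@le_trans _ _ (prob (big j.+1%:R^-1 m))).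
  by apply: le_prob => // w; exact.
apply: le_trans (@prob_exists _ _ _ P m.+1 (fun i => [set w |
  j.+1%:R^-1 < X (i.+1%:R * m.+1%:R^-1) w - X (i%:R * m.+1%:R^-1) w]) _) _.
  by move=> i; apply: measurable_increment_gt; rewrite mulr_ge0.
under eq_bigr do rewrite prob_increment_gt//.
by rewrite sumr_const card_ord mulr_natl.
Qed.

Hypothesis X_fin : ('E_P[X 1] < +oo)%E.

Lemma subordinator_L1 t : 0 <= t -> t <= 1 -> L1 (X t).
Proof.
move=> t0 t1.
have L : L1 (X 1).
  apply/integrableP; split; first by apply/measurable_EFinP; exact: subordinator_measurable.
  move: X_fin; rewrite unlock; congr (_ < _)%E; apply: eq_integral => w _.
  by rewrite /= ger0_norm// subordinator_ge0.
apply: (L1_le _ L); first exact: subordinator_measurable.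
by move=> w; rewrite ger0_norm ?subordinator_ge0// subordinator_nd.
Qed.

Lemma subordinator_mean m : (0 < m)%N -> mean (X 1) = m%:R * mean (X m%:R^-1).
Proof.
move=> m0; have h0 : 0 <= m%:R^-1 :> R by rewrite invr_ge0.
have h1 : m%:R^-1 <= 1 :> R by rewrite invf_le1 ?ltr0n// ler1n.
pose D i w := X (i.+1%:R * m%:R^-1) w - X (i%:R * m%:R^-1) w.
have mD i : measurable_fun setT (D i).
  by apply: measurable_funB; apply: subordinator_measurable; rewrite mulr_ge0.
have mXh : measurable_fun setT (X m%:R^-1) by exact: subordinator_measurable.
have law i S : measurable S -> P (X m%:R^-1 @^-1` S) = P (D i @^-1` S).
  move=> mS; have st : i%:R * m%:R^-1 <= i.+1%:R * m%:R^-1 :> R.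
    by rewrite ler_wpM2r// ler_nat.
  have := increment_law (mulr_ge0 (ler0n _ i) h0) st mS.
  have -> : i.+1%:R * m%:R^-1 - i%:R * m%:R^-1 = m%:R^-1 :> R.
    by rewrite -mulrBl -natr1 addrAC subrr add0r mul1r.
  by move=> E; exact: esym E.
have LXh : L1 (X m%:R^-1) by exact: subordinator_L1.
have LD i : L1 (D i).
  exact: (same_law_L1 mXh (mD i) (law i) (@measurable_id _ _ setT) LXh).
have mDE i : mean (D i) = mean (X m%:R^-1).
  exact: esym (same_law_mean mXh (mD i) (law i) (@measurable_id _ _ setT) LXh).
have -> : X 1 = fun w => \sum_(i < m) D i w.
  apply/funext => w; rewrite -(big_mkord predT (fun i => D i w)).
  rewrite (telescope_sumr (fun i => X (i%:R * m%:R^-1) w))// mulfV ?pnatr_eq0 -?lt0n//.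
  by rewrite mul0r (levy_start lX) subr0.
rewrite mean_sum//; under eq_bigr do rewrite mDE.
by rewrite sumr_const card_ord mulr_natl.
Qed.

End subordinator_facts.

Lemma prob_bigcup_nondecreasing_le d (T : measurableType d) (R : realType)
    (P : probability T R) (F : nat -> set T) (a : R) :
  (forall k, measurable (F k)) -> (forall k, F k `<=` F k.+1) ->
  (forall k, prob P (F k) <= a) -> prob P (\bigcup_k F k) <= a.
Proof.
move=> mF ndF Fa; have mU : measurable (\bigcup_k F k) by exact: bigcupT_measurable.
rewrite -lee_fin -probE//.
have ndF' : nondecreasing_seq F.
  by apply/nondecreasing_seqP => n; apply/subsetPset.
have /cvg_lim <- // := nondecreasing_cvg_mu (mu := P) mF mU ndF'.
apply: lime_le.
  by apply/cvg_ex; exists (P (\bigcup_k F k)); exact: nondecreasing_cvg_mu.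
by apply: nearW => k /=; rewrite probE// lee_fin.
Qed.

Lemma le0_of_le_divS (R : realType) (x a : R) :
  (forall n, x <= a / n.+1%:R) -> x <= 0.
Proof.
move=> H; rewrite leNgt; apply/negP => x0.
have := H (Num.truncn (a / x)); rewrite leNgt => /negP; apply.
by rewrite ltr_pdivrMr// mulrC -ltr_pdivrMr// truncnS_gt.
Qed.

Lemma pairwise_separated (R : realType) (s : seq R) :
  exists2 e, 0 < e & forall x y, x \in s -> y \in s -> x != y -> e <= `|x - y|.
Proof.
elim: s => [|z s [e e0 He]]; first by exists 1.
have [e' e'0 He'] : exists2 e', 0 < e' & forall y, y \in s -> z != y -> e' <= `|z - y|.
  elim: s {He} => [|y s [e' e'0 He']]; first by exists 1.
  have [zy|zy] := eqVneq z y.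
    exists e' => // y'; rewrite inE -zy => /predU1P[->|]; first by rewrite eqxx.
    exact: He'.
  exists (Num.min e' `|z - y|); first by rewrite lt_min e'0 normr_gt0 subr_eq0.
  move=> y'; rewrite inE => /predU1P[-> _|/He' H /H].
    by rewrite ge_min lexx orbT.
  by rewrite ge_min => ->.
exists (Num.min e e'); first by rewrite lt_min e0.
move=> x y; rewrite !inE => /predU1P[->|xs] /predU1P[->|ys] xy.
- by rewrite eqxx in xy.
- by rewrite ge_min He' ?orbT.
- by rewrite distrC ge_min He' ?orbT// eq_sym.
- by rewrite ge_min He.
Qed.

(** * Local finiteness of the jump times *)

Section jumps_finite.
Context {d : measure_display} {T : measurableType d} {R : realType}.
Variables (P : probability T R) (X : R -> T -> R).
Variable nu : {finite_measure set R -> \bar R}.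
Hypothesis subX : subordinator P X.
Hypothesis driftX : without_drift X.
Hypothesis levyX : is_levy_measure P X nu.

Local Notation prob := (prob P).
Local Notation mean := (mean P).

Definition active_count N m (w : T) : nat :=
  (\sum_(i < N * m) (w \in active_cell X (m%:R^-1) i))%N.

Let mactive m i : measurable (active_cell X (m%:R^-1) i).
Proof. by apply: (measurable_active_cell subX); rewrite invr_ge0. Qed.

Let active_countE N m w : (active_count N m w)%:R =
  \sum_(i < N * m) (\1_(active_cell X (m%:R^-1) i) w : R).
Proof. by rewrite /active_count natr_sum; apply: eq_bigr => i _; rewrite indicE. Qed.

Let measurable_active_count N m M : measurable [set w | (M <= active_count N m w)%N].
Proof.
have h0 : 0 <= m%:R^-1 :> R by rewrite invr_ge0.
pose f w : R := \sum_(i < N * m) \1_(active_cell X (m%:R^-1) i) w.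
have mf : measurable_fun setT f.
  by apply: measurable_sum => i; apply: measurable_indic; exact: mactive.
rewrite (_ : [set w | _] = f @^-1` `[M%:R, +oo[).
  exact: measurable_preimage.
by apply/seteqP; split=> w /=; rewrite in_itv/= andbT /f -active_countE ler_nat.
Qed.

Let prob_active_count N m M : (0 < m)%N ->
  prob [set w | (M.+1 <= active_count N m w)%N] <= N%:R * fine (nu setT) / M.+1%:R.
Proof.
move=> m0; have h0 : 0 <= m%:R^-1 :> R by rewrite invr_ge0.
rewrite ler_pdivlMr// mulrC.
pose F i : T -> R := \1_(active_cell X (m%:R^-1) i).
have LF i : L1 P (F i) by apply: L1_indic; exact: mactive.
have LS : L1 P (fun w => \sum_(i < N * m) F i w) by exact: L1_sum.
rewrite -mean_indic// -meanZ; last exact: L1_indic.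
apply: (@le_trans _ _ (mean (fun w => \sum_(i < N * m) F i w))).
  apply: le_mean => //; first by apply: L1Z; exact: L1_indic.
  move=> w; rewrite /F -active_countE indicE.
  have [/set_mem/= h|_] := boolP (w \in [set w | (M.+1 <= active_count N m w)%N]).
    by rewrite mulr1 ler_nat.
  by rewrite mulr0.
rewrite mean_sum//.
under eq_bigr do rewrite mean_indic// (prob_active_cell subX)//.
rewrite sumr_const card_ord -[_ *+ (N * m)]mulr_natl natrM -mulrA ler_wpM2l//.
exact: (prob_active_le subX driftX levyX m0).
Qed.

(** Once the mesh is smaller than the least gap between the chosen jump times, these lie in
    different cells. *)
Let jumps_le_active w N (s : seq R) : uniq s ->
  (forall t, t \in s -> jump_times X w N%:R t) ->
  exists k, forall m, (k <= m)%N -> (size s <= active_count N m.+1 w)%N.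
Proof.
move=> us Hs; have [e e0 He] := pairwise_separated s.
exists (Num.truncn e^-1) => m km; pose h : R := m.+1%:R^-1.
have he : h < e.
  by rewrite invf_plt ?posrE// (lt_le_trans (truncnS_gt _))// ler_nat ltnS.
have h0 : 0 < h by rewrite invr_gt0.
have Hc t : exists i, t \in s -> [/\ (i < N * m.+1)%N, i%:R * h < t & t <= i.+1%:R * h].
  have [ts|_] := boolP (t \in s); last by exists 0%N.
  have [t0 tN _] := Hs t ts.
  have [] := @grid_cell R h t (N * m.+1) t0.
    by rewrite natrM -mulrA mulfV// mulr1.
  by move=> i iN /andP[? ?]; exists i.
have [c Hcell] := choice Hc.
have -> : active_count N m.+1 w =
    size [seq i <- iota 0 (N * m.+1) | w \in active_cell X m.+1%:R^-1 i].
  rewrite /active_count.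
  rewrite -(big_mkord predT (fun i => nat_of_bool (w \in active_cell X m.+1%:R^-1 i))).
  rewrite /index_iota subn0 size_filter -sum1_count [RHS]big_mkcond.
  by apply: eq_bigr => i _; case: (_ \in _).
rewrite -(size_map c); apply: uniq_leq_size.
  rewrite map_inj_in_uniq// => t u ts us' ctu.
  apply/eqP; apply: contraT => tu.
  have [_ t1 t2] := Hcell t ts; have [_ u1 u2] := Hcell u us'.
  rewrite ctu in t1 t2; have := He _ _ ts us' tu.
  rewrite leNgt => /negP[]; apply: le_lt_trans he.
  move: t1 t2 u1 u2; rewrite -natr1 mulrDl mul1r ler_norml => *; apply/andP; split; lra.
move=> i /mapP[t ts ->]; have [tN t1 t2] := Hcell t ts.
have [t0 _ jt] := Hs t ts.
rewrite mem_filter mem_iota add0n tN !andbT; apply/mem_set.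
rewrite /active_cell /= -subr_gt0.
apply: lt_le_trans (path_jump_le subX w _ t1 t2); last by rewrite mulr_ge0// ltW.
by rewrite lt_neqAle eq_sym jt (path_jump_ge0 subX).
Qed.

(** The number of active cells is measurable and stands in for the number of jumps. Markov's
    inequality bounds the probability of more than [M] active cells by a multiple of [1 / M.+1],
    uniformly in the mesh, while infinitely many jumps give more than [M] active cells on all fine
    grids, for every [M]. *)
Lemma jump_times_finite : exists Bad, [/\ measurable Bad, P Bad = 0%E &
  forall w, ~ Bad w -> forall N, finite_set (jump_times X w N%:R)].
Proof.
pose F N M k := \bigcap_(m in [set m | (k <= m)%N])
  [set w | (M.+1 <= active_count N m.+1 w)%N].
have mF N M k : measurable (F N M k).
  by apply: bigcap_measurable => // ; exists k => /=.
pose B N := \bigcap_M \bigcup_k F N M k.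
have mB N : measurable (B N).
  by apply: bigcapT_measurable => M; apply: bigcupT_measurable.
have B0 N : prob (B N) <= 0.
  apply: (@le0_of_le_divS _ _ (N%:R * fine (nu setT))) => M.
  apply: (@le_trans _ _ (prob (\bigcup_k F N M k))).
    by apply: le_prob => // [|w]; [exact: bigcupT_measurable|exact].
  apply: prob_bigcup_nondecreasing_le => // k.
    by move=> w Fw m /= km; apply: Fw => /=; exact: ltnW.
  apply: le_trans (prob_active_count N M (ltn0Sn k)); apply: le_prob => //.
  by move=> w; apply => /=.
exists (\bigcup_N B N); split; first exact: bigcupT_measurable.
  apply/eqP; rewrite eq_le measure_ge0 andbT.
  apply: (@le_trans _ _ (\sum_(N <oo) P (B N))%E).
    by apply: measure_sigma_subadditive => //; exact: bigcupT_measurable.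
  rewrite eseries0// => N _ _; rewrite probE//; congr _%:E.
  by apply/eqP; rewrite eq_le B0 prob_ge0.
move=> w Bw N; apply: contrapT => inf; apply: Bw; exists N => // M _.
have [J Jsub JM] := infinite_set_fset M.+1 inf.
have [k Hk] := jumps_le_active (fset_uniq J) (fun t tJ => Jsub t tJ).
by exists k => // m km; apply: leq_trans (Hk m km).
Qed.

End jumps_finite.

(** * Cells in which both subordinators increase *)

Section no_common_cell.
Context {d : measure_display} {T : measurableType d} {R : realType}.
Variables (P : probability T R) (Z C : R -> T -> R).
Variables nuZ nuC : {finite_measure set R -> \bar R}.
Hypotheses (subZ : subordinator P Z) (subC : subordinator P C).
Hypotheses (driftZ : without_drift Z) (driftC : without_drift C).
Hypotheses (levyZ : is_levy_measure P Z nuZ) (levyC : is_levy_measure P C nuC).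
Hypothesis ZC_indep : independent_processes P Z C.

Local Notation prob := (prob P).

Definition mesh n : R := (2 ^ n)%:R^-1.

Lemma meshE n : mesh n = (2 ^ n)%:R^-1. Proof. by []. Qed.

Definition common_cell N n := [set w | exists2 i, (i < N * 2 ^ n)%N &
  (active_cell Z (mesh n) i `&` active_cell C (mesh n) i) w].

Let mesh_ge0 n : 0 <= mesh n. Proof. by rewrite invr_ge0. Qed.

Lemma measurable_common_cell N n : measurable (common_cell N n).
Proof.
rewrite (_ : common_cell N n = \bigcup_(i in [set i | (i < N * 2 ^ n)%N])
  (active_cell Z (mesh n) i `&` active_cell C (mesh n) i))//.
by apply: bigcup_measurable => i _; apply: measurableI;
  [exact: (measurable_active_cell subZ)|exact: (measurable_active_cell subC)].
Qed.

Lemma prob_both_active n i :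
  prob (active_cell Z (mesh n) i `&` active_cell C (mesh n) i) =
  prob [set w | 0 < Z (mesh n) w] * prob [set w | 0 < C (mesh n) w].
Proof.
have h0 := mesh_ge0 n.
have mZ := measurable_active_cell subZ i h0.
have mC := measurable_active_cell subC i h0.
rewrite -(prob_active_cell subZ i h0) -(prob_active_cell subC i h0).
apply: EFin_inj; rewrite EFinM -!probE//; last exact: measurableI.
have in0y j : `[0, +oo[%classic (j%:R * mesh n).
  by rewrite /= in_itv/= andbT mulr_ge0.
have E X : active_cell X (mesh n) i =
    (X (i.+1%:R * mesh n) \- X (i%:R * mesh n)) @^-1` `]0, +oo[.
  by apply/seteqP; split=> w /=; rewrite in_itv/= andbT subr_gt0.
by apply: ZC_indep; rewrite E; apply: process_sigma_increment.
Qed.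

(** There are [N * 2 ^ n] cells, and in each the two independent increments are positive with
    probability at most [nuZ setT * nuC setT * mesh n ^ 2]. *)
Lemma prob_common_cell N n :
  prob (common_cell N n) <= N%:R * fine (nuZ setT) * fine (nuC setT) * mesh n.
Proof.
have pZ := prob_active_le subZ driftZ levyZ (expn_gt0 2 n).
have pC := prob_active_le subC driftC levyC (expn_gt0 2 n).
apply: le_trans (@prob_exists _ _ _ P (N * 2 ^ n) (fun i =>
  active_cell Z (mesh n) i `&` active_cell C (mesh n) i) _) _.
  by move=> i; apply: measurableI;
    [exact: (measurable_active_cell subZ)|exact: (measurable_active_cell subC)].
under eq_bigr do rewrite prob_both_active.
rewrite sumr_const card_ord -[_ *+ (N * _)]mulr_natl natrM.
rewrite -/(mesh n) in pZ pC.
move: pZ pC; set p := prob _; set q := prob _; set a := fine _; set b := fine _.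
have p0 : 0 <= p by exact: prob_ge0.
have q0 : 0 <= q by exact: prob_ge0.
move=> pa qb; rewrite -!mulrA ler_wpM2l//.
have -> : (2 ^ n)%:R * (p * q) = ((2 ^ n)%:R * p) * ((2 ^ n)%:R * q) * mesh n.
  have : (2 ^ n)%:R != 0 :> R by rewrite pnatr_eq0 -lt0n expn_gt0.
  by rewrite /mesh; move: (2 ^ n)%:R => M M0; field.
by rewrite [a * _]mulrA ler_wpM2r// ler_pM// mulr_ge0.
Qed.

Lemma meshS n : mesh n = 2 * mesh n.+1.
Proof. by rewrite /mesh expnS natrM invfM mulrA mulfV ?mul1r. Qed.

(** Dyadic grids are nested: cell [i] of level [n.+1] lies in cell [i./2] of level [n]. *)
Lemma common_cell_nonincreasing N n : common_cell N n.+1 `<=` common_cell N n.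
Proof.
move=> w [i iN [aZ aC]]; exists i./2.
  by rewrite ltn_half_double -mul2n mulnCA -expnS.
have h0 := mesh_ge0 n.+1.
have i1 : (i./2)%:R * mesh n <= i%:R * mesh n.+1.
  rewrite (meshS n) mulrA -natrM ler_wpM2r// ler_nat.
  by rewrite muln2 -{2}(odd_double_half i) leq_addl.
have i2 : i.+1%:R * mesh n.+1 <= (i./2).+1%:R * mesh n.
  rewrite (meshS n) mulrA -natrM ler_wpM2r// ler_nat.
  by rewrite muln2 doubleS -{1}(odd_double_half i) ltnS; case: (odd i).
split; rewrite /active_cell /=.
  apply: le_lt_trans (lt_le_trans aZ _).
    by apply: subordinator_nd subZ _ _ _ _ i1; rewrite mulr_ge0.
  by apply: subordinator_nd subZ _ _ _ _ i2; rewrite mulr_ge0.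
apply: le_lt_trans (lt_le_trans aC _).
  by apply: subordinator_nd subC _ _ _ _ i1; rewrite mulr_ge0.
by apply: subordinator_nd subC _ _ _ _ i2; rewrite mulr_ge0.
Qed.

(** The events decrease in [n] and their probabilities tend to 0, so their intersection is null; by
    monotonicity, one level without a common cell settles all finer ones. *)
Lemma eventually_no_common_cell : exists Bad, [/\ measurable Bad, P Bad = 0%E &
  forall w, ~ Bad w -> forall N, exists n0, forall n, (n0 <= n)%N -> ~ common_cell N n w].
Proof.
pose B N := \bigcap_n common_cell N n.
have mB N : measurable (B N).
  by apply: bigcapT_measurable => n; exact: measurable_common_cell.
have B0 N : prob (B N) <= 0.
  apply: (@le0_of_le_divS _ _ (N%:R * fine (nuZ setT) * fine (nuC setT))) => n.
  apply: (@le_trans _ _ (prob (common_cell N n))).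
    by apply: le_prob => //; [exact: measurable_common_cell|move=> w; exact].
  apply: (le_trans (prob_common_cell N n)); rewrite ler_wpM2l ?mulr_ge0 ?fine_ge0//.
  by rewrite /mesh lef_pV2 ?posrE ?ltr0n ?expn_gt0// ler_nat ltn_expl.
exists (\bigcup_N B N); split; first exact: bigcupT_measurable.
  apply/eqP; rewrite eq_le measure_ge0 andbT.
  apply: (@le_trans _ _ (\sum_(N <oo) P (B N))%E).
    by apply: measure_sigma_subadditive => //; exact: bigcupT_measurable.
  rewrite eseries0// => N _ _; rewrite probE//; congr _%:E.
  by apply/eqP; rewrite eq_le B0 prob_ge0.
move=> w Bw N.
have [n0 Hn0] : exists n0, ~ common_cell N n0 w.
  by apply/existsNP => H; apply: Bw; exists N => // n _; exact: H.
exists n0 => n; elim: n => [|n IH]; first by rewrite leqn0 => /eqP <-.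
rewrite leq_eqVlt => /predU1P[<-//|/IH H]; apply: contra_not H.
exact: common_cell_nonincreasing.
Qed.

End no_common_cell.

(** * Measurability of the suprema *)

Lemma dense_right (R : realType) (t e : R) : 0 <= t -> 0 < e ->
  exists i m, t < i%:R / m.+1%:R < t + e.
Proof.
move=> t0 e0; pose m := Num.truncn e^-1.
exists (Num.truncn (t * m.+1%:R)).+1, m.
have m0 : 0 < m.+1%:R :> R by rewrite ltr0n.
rewrite ltr_pdivlMr// truncnS_gt /= ltr_pdivrMr//.
have : (Num.truncn (t * m.+1%:R))%:R <= t * m.+1%:R.
  by rewrite -[leLHS]/(_) truncn_le// mulr_ge0// ltW.
have : 1 < e * m.+1%:R.
  by rewrite mulrC -ltr_pdivrMr// mul1r truncnS_gt.
by rewrite -natr1 mulrDl => ? ?; lra.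
Qed.

Section cadlag_approximation.
Context {R : realType}.
Implicit Type f : R -> R.

Lemma left_lim_approx f s e : cvg (f u @[u --> s^'-]) -> 0 < e ->
  exists2 r, 0 < r & forall a, s - r < a -> a < s -> `|f a - left_lim f s| < e.
Proof.
move=> cf e0; have /cvgrPdist_lt/(_ _ e0) := cf.
move=> [r /= r0 Hr]; exists r => // a sa as_.
rewrite distrC; apply: Hr => //=.
by rewrite ger0_norm ?subr_ge0 ?ltW//; lra.
Qed.

Lemma right_lim_approx f s e : f u @[u --> s^'+] --> f s -> 0 < e ->
  exists2 r, 0 < r & forall a, s <= a -> a < s + r -> `|f a - f s| < e.
Proof.
move=> /cvgrPdist_lt cf e0; have [r /= r0 Hr] := cf _ e0.
exists r => // a; rewrite le_eqVlt => /predU1P[<- _|sa as_].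
  by rewrite subrr normr0.
rewrite distrC; apply: Hr => //=.
by rewrite distrC ger0_norm ?subr_ge0 ?ltW//; lra.
Qed.

Lemma cadlagD f g : cadlag f -> cadlag g -> cadlag (fun t => f t + g t).
Proof.
move=> [fr fl] [gr gl]; split=> t t0; first by apply: cvgD; [exact: fr|exact: gr].
by apply: is_cvgD; [exact: fl|exact: gl].
Qed.

Lemma cadlag_linear c : cadlag (fun t : R => c * t).
Proof.
have h t : (fun u => c * u) @ t --> c * t by apply: cvgM; [exact: cvg_cst|exact: cvg_id].
split=> t _; first exact: cvg_at_right_filter (h t).
by apply/cvg_ex; exists (c * t); exact: cvg_at_left_filter (h t).
Qed.

Lemma left_limD f g t : cvg (f u @[u --> t^'-]) -> cvg (g u @[u --> t^'-]) ->
  left_lim (fun u => f u + g u) t = left_lim f t + left_lim g t.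
Proof. by move=> cf cg; exact: limD. Qed.

Section running_sup.
Variable g : R -> R.
Hypothesis g_bounded : forall q, exists B, forall t, 0 <= t -> t <= q -> g t <= B.
Let M := running_sup g.

Lemma le_running_sup t a : 0 <= t -> t <= a -> g t <= M a.
Proof.
move=> t0 ta; apply: ub_le_sup; last by exists t => //=; rewrite in_itv/= t0.
have [B HB] := g_bounded a; exists B => _ [u /=+ <-].
by rewrite in_itv/= => /andP[u0 ua]; exact: HB.
Qed.

Lemma running_sup_le a y : 0 <= a ->
  (forall t, 0 <= t -> t <= a -> g t <= y) -> M a <= y.
Proof.
move=> a0 H; apply: ge_sup; first by exists (g 0), 0 => //=; rewrite in_itv/= lexx.
by move=> _ [u /=+ <-]; rewrite in_itv/= => /andP[u0 ua]; exact: H.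
Qed.

Lemma running_sup_nd a b : 0 <= a -> a <= b -> M a <= M b.
Proof.
move=> a0 ab; apply: running_sup_le => // t t0 ta.
by apply: le_running_sup => //; exact: le_trans ab.
Qed.

Lemma running_sup_is_cvg s : 0 < s -> cvg (M u @[u --> s^'-]).
Proof.
move=> s0; apply: nondecreasing_at_left_is_cvgr.
  near=> x => a b; rewrite !in_itv/= => /andP[xa _] _ ab.
  apply: running_sup_nd => //; apply/ltW/(le_lt_trans _ xa).
  by apply: ltW; near: x; exact: nbhs_left_gt.
near=> x; exists (M s) => _ [y /=+ <-]; rewrite in_itv/= => /andP[xy ys].
apply: running_sup_nd; last exact: ltW.
apply/ltW/(le_lt_trans _ xy).
by apply: ltW; near: x; exact: nbhs_left_gt.
Unshelve. all: by end_near. Qed.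

Lemma running_sup_left_lim s a : 0 <= a -> a < s -> M a <= left_lim M s.
Proof.
move=> a0 as_; apply: limr_ge.
  by apply: running_sup_is_cvg; exact: le_lt_trans as_.
near=> u; apply: running_sup_nd => //; apply: ltW; near: u; exact: nbhs_left_gt.
Unshelve. all: by end_near. Qed.

End running_sup.

Section new_sup_jump.
Variables f g : R -> R.
Hypotheses (f_cadlag : cadlag f) (g_cadlag : cadlag g).
Hypothesis f_nd : forall s t, 0 <= s -> s <= t -> f s <= f t.
Hypothesis g_bounded : forall q, exists B, forall t, 0 <= t -> t <= q -> g t <= B.
Let M := running_sup g.

Let f_left_ge a t : 0 <= a -> a < t -> f a <= left_lim f t.
Proof.
move=> a0 at_; apply: limr_ge; first by apply: f_cadlag.2; exact: le_lt_trans at_.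
near=> u; apply: f_nd => //; apply: ltW; near: u; exact: nbhs_left_gt.
Unshelve. all: by end_near. Qed.

Let cell q n i : R := i%:R * (q / n.+1%:R).

Let mesh_lt (q r : R) : 0 < q -> 0 < r -> exists n0, forall n, (n0 <= n)%N -> q / n.+1%:R < r.
Proof.
move=> q0 r0; exists (Num.truncn (q / r)) => n n0n.
rewrite ltr_pdivrMr// mulrC -ltr_pdivrMr//.
by rewrite (lt_le_trans (truncnS_gt _))// ler_nat ltnS.
Qed.

(* The gap [k.+1%:R^-1] is uniform in the mesh, so it survives at a cluster point
   of the selected cells; this makes the existence of a jump a countable
   condition. *)
Lemma new_sup_jump_grid q : 0 < q ->
  (exists s, [/\ 0 < s, s <= q & left_lim M s - left_lim g s < jump f s]) <->
  (exists k n0, forall n, (n0 <= n)%N -> exists2 i, (i < n.+1)%N &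
    M (cell q n i) - g (cell q n i) + k.+1%:R^-1 < f (cell q n i.+1) - f (cell q n i)).
Proof.
move=> q0; split=> [[s [s0 sq Js]]|[k [n0 H]]].
  pose e := jump f s - (left_lim M s - left_lim g s).
  have e0 : 0 < e by rewrite subr_gt0.
  (* One third of the slack covers the approximation of the left limit of [g], another covers
     [k.+1%:R^-1]. Monotonicity handles [f] and [M] at no cost. *)
  have e30 : 0 < e / 3 by rewrite divr_gt0.
  exists (Num.truncn (e / 3)^-1).
  have ke : (Num.truncn (e / 3)^-1).+1%:R^-1 < e / 3 by rewrite invf_plt ?posrE ?truncnS_gt.
  have [r r0 Hr] := left_lim_approx (g_cadlag.2 _ s0) e30.
  have [n0 Hn0] := mesh_lt q0 r0.
  exists n0 => n /Hn0 hr; have h0 : 0 < q / n.+1%:R by rewrite divr_gt0.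
  have [i im /andP[is_ si]] : exists2 i, (i < n.+1)%N & cell q n i < s <= cell q n i.+1.
    have : s <= n.+1%:R * (q / n.+1%:R) by rewrite mulrC divfK.
    rewrite /cell; move: (q / n.+1%:R) => h.
    elim: n.+1 => [|m IH] sm; first by move: sm; rewrite mul0r leNgt s0.
    have [/IH[i im it]|ms] := leP s (m%:R * h); first by exists i => //; exact: ltnW.
    by exists m; rewrite // ms.
  exists i => //.
  have a0 : 0 <= cell q n i by rewrite mulr_ge0// ltW.
  have cS : cell q n i.+1 = cell q n i + q / n.+1%:R by rewrite /cell -natr1 mulrDl mul1r.
  have ga : `|g (cell q n i) - left_lim g s| < e / 3.
    apply: Hr => //; move: hr si; rewrite cS; move: (q / n.+1%:R) (cell q n i) => h x ? ?; lra.
  have Ma := running_sup_left_lim g_bounded a0 is_; rewrite -/M in Ma.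
  have fa := f_left_ge a0 is_.
  have fb : f s <= f (cell q n i.+1) by apply: f_nd => //; exact: ltW.
  move: ga; rewrite ltr_norml => /andP[ga1 ga2].
  move: ke; move: ((Num.truncn (e / 3)^-1).+1%:R^-1) => x ke.
  move: ke ga1 ga2 Ma fa fb; rewrite /e /jump.
  move: (left_lim M s) (left_lim g s) (left_lim f s) (M _) (g _) (f s).
  by move: (f _) (f _) => b a Ms gs fs Ma ga s' *; lra.
have Ha n : exists i, (n0 <= n)%N -> (i < n.+1)%N /\
    M (cell q n i) - g (cell q n i) + k.+1%:R^-1 < f (cell q n i.+1) - f (cell q n i).
  have [/H[i im Hi]|_] := boolP (n0 <= n)%N; first by exists i.
  by exists 0%N.
have [idx Hidx] := choice Ha.
pose a n := cell q n (idx n).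
have k0 : 0 < k.+1%:R^-1 :> R by rewrite invr_gt0.
have [hh hhE] : exists hh : nat -> R, forall n, hh n = q / n.+1%:R.
  by exists (fun n => q / n.+1%:R).
have cS n : cell q n (idx n).+1 = a n + hh n.
  by rewrite hhE /a /cell -natr1 mulrDl mul1r.
have a0 n : 0 <= a n by rewrite mulr_ge0// divr_ge0// ltW.
have bq n : (n0 <= n)%N -> cell q n (idx n).+1 <= q.
  move=> nn; have [im _] := Hidx n nn.
  rewrite /cell mulrCA -[leRHS]mulr1 ler_pM2l// ler_pdivrMr// mul1r ler_nat.
  exact: im.
have h0 n : 0 < hh n by rewrite hhE divr_gt0.
have [s [sq cls]] : exists s, s \in `[0, q] /\ cluster (a n @[n --> \oo]) s.
  have [] := @segment_compact R 0 q (a n @[n --> \oo]) _.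
    exists n0 => // n /= nn; rewrite in_itv/= a0/=.
    by apply: le_trans (bq n nn); rewrite cS lerDl ltW.
  by move=> s [? ?]; exists s.
have near_s r : 0 < r -> exists n, [/\ (n0 <= n)%N, `|a n - s| < r & hh n < r].
  move=> r0; have [n1 Hn1] := mesh_lt q0 r0.
  have FA : (a n @[n --> \oo]) (a @` [set n | (maxn n0 n1 <= n)%N]).
    by exists (maxn n0 n1) => // n nn; exists n.
  have [x [[n Hn <-] xs]] := cls _ _ FA (nbhsx_ballx s _ r0).
  move: Hn; rewrite /= geq_max => /andP[? ?]; exists n; split=> //; last by rewrite hhE; exact: Hn1.
  by rewrite distrC.
move: sq; rewrite in_itv/= => /andP[s0 sq].
have Mg n : g (a n) <= M (a n) by exact: le_running_sup.
have k80 : 0 < k.+1%:R^-1 / 8 :> R by rewrite divr_gt0.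
(* The gap is cut into eight parts; at most four errors smaller than [e] are made below, so
   strictness survives. *)
set e := k.+1%:R^-1 / 8 in k80.
have eE : k.+1%:R^-1 = 8 * e by rewrite /e mulrC divfK.
have gap n : (n0 <= n)%N -> M (a n) - g (a n) + 8 * e < f (a n + hh n) - f (a n).
  by move=> /Hidx[_]; rewrite cS eE.
clearbody e.
have [r r0 Hr] := right_lim_approx (f_cadlag.1 _ s0) k80.
(* A cell just to the right of [s] would see an increment of [f] below [2 e] by right continuity,
   whereas the gap demands more than [8 e]. *)
have not_right n : (n0 <= n)%N -> `|a n - s| < r / 2 -> hh n < r / 2 -> a n < s.
  move=> nn an hn; rewrite ltNge; apply/negP => sa.
  move: an; rewrite ltr_norml => /andP[an1 an2].
  have := gap n nn; have := Mg n; have hn0 := h0 n.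
  have /ltr_normlP[f1 f1'] := Hr (a n) sa ltac:(lra).
  have /ltr_normlP[f2 f2'] : `|f (a n + hh n) - f s| < e by apply: Hr; lra.
  lra.
have s_gt0 : 0 < s.
  have r20 : 0 < r / 2 by rewrite divr_gt0.
  have [n [nn an hn]] := near_s _ r20.
  exact: le_lt_trans (a0 n) (not_right n nn an hn).
exists s; split => //.
have [rf rf0 Hf] := left_lim_approx (f_cadlag.2 _ s_gt0) k80.
have [rg rg0 Hg] := left_lim_approx (g_cadlag.2 _ s_gt0) k80.
have [rM rM0 HM] := left_lim_approx (running_sup_is_cvg g_bounded s_gt0) k80.
pose p := Num.min (r / 2) (Num.min rf (Num.min rg rM)).
have p0 : 0 < p by rewrite !lt_min rf0 rg0 rM0 divr_gt0.
have [n [nn an hn]] := near_s _ p0.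
move: (an) (hn); rewrite !lt_min => /and4P[an1 an2 an3 an4] /and4P[hn1 hn2 hn3 hn4].
have as_ := not_right n nn an1 hn1.
have Ln : `|a n - s| = s - a n by rewrite distrC gtr0_norm ?subr_gt0.
rewrite !Ln in an1 an2 an3 an4.
have /ltr_normlP[f1 f1'] : `|f (a n) - left_lim f s| < e by apply: Hf => //; lra.
have /ltr_normlP[g1 g1'] : `|g (a n) - left_lim g s| < e by apply: Hg => //; lra.
have /ltr_normlP[M1 M1'] : `|M (a n) - left_lim M s| < e by apply: HM => //; lra.
(* Likewise a cell just to the left of [s] would have too small an increment, so the selected cell
   straddles [s] and its increment approximates the jump there. *)
have sb : s <= a n + hh n.
  rewrite leNgt; apply/negP => bs.
  have hn0 := h0 n; have an0 := a0 n.
  have /ltr_normlP[f2 f2'] : `|f (a n + hh n) - left_lim f s| < e.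
    by apply: Hf => //; lra.
  by have := gap n nn; have := Mg n; lra.
have /ltr_normlP[f2 f2'] : `|f (a n + hh n) - f s| < e.
  by apply: Hr => //; lra.
by have := gap n nn; rewrite /jump; lra.
Qed.

End new_sup_jump.
End cadlag_approximation.

Section supremum_measurable.
Context {d : measure_display} {T : measurableType d} {R : realType}.

Let frac i m : R := i%:R / m.+1%:R.

Let frac_ge0 i m : 0 <= frac i m. Proof. by rewrite divr_ge0. Qed.

Section one_process.
Variable G : R -> T -> R.
Hypothesis mG : forall t, 0 <= t -> measurable_fun setT (G t).
Hypothesis G_cadlag : forall w, cadlag (path G w).

Let mGgt t y : 0 <= t -> measurable [set w | y < G t w].
Proof.
move=> t0; rewrite (_ : [set w | _] = G t @^-1` `]y, +oo[).
  by apply: measurable_preimage => //; exact: mG.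
by apply/seteqP; split=> w /=; rewrite in_itv/= andbT.
Qed.

Let exceeds_frac w y t e : 0 <= t -> 0 < e -> y < G t w ->
  exists i m, [/\ t < frac i m, frac i m < t + e & y < G (frac i m) w].
Proof.
move=> t0 e0 yG; have Gy : 0 < G t w - y by rewrite subr_gt0.
have [r r0 Hr] := right_lim_approx ((G_cadlag w).1 t t0) Gy.
have [|i [m /andP[ti it]]] := @dense_right R t (Num.min e r) t0.
  by rewrite lt_min e0.
exists i, m; split=> //.
  by apply: lt_le_trans it _; rewrite lerD2l ge_min lexx.
have : `|path G w (frac i m) - path G w t| < G t w - y.
  apply: Hr; first exact: ltW.
  by apply: lt_le_trans it _; rewrite lerD2l ge_min lexx orbT.
by rewrite /path ltr_norml => /andP[+ _]; lra.
Qed.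

Lemma measurable_running_sup a : 0 <= a ->
  (forall w q, exists B, forall t, 0 <= t -> t <= q -> path G w t <= B) ->
  measurable_fun setT (fun w => running_sup (path G w) a).
Proof.
move=> a0 Gb mT; apply: (measurability _ (RGenOInfty.measurableE R)) => //.
move=> /= _ [_ [y ->] <-]; rewrite setTI.
(* The endpoint [a] is listed separately: fractions approximating it from the right lie outside
   [[0, a]]. *)
pose U := [set w | y < G a w] `|`
  \bigcup_i \bigcup_(m in [set m | frac i m <= a]) [set w | y < G (frac i m) w].
rewrite (_ : _ @^-1` _ = U).
  apply: measurableU; first exact: mGgt.
  apply: bigcupT_measurable => i; apply: bigcup_measurable => m _; exact: mGgt.
apply/seteqP; split=> w; rewrite /= in_itv/= andbT.
  move=> yM.
  have [t [t0 ta yt]] : exists t, [/\ 0 <= t, t <= a & y < G t w].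
    apply: contrapT => /forallNP H; move: yM; apply/negP; rewrite -leNgt.
    apply: running_sup_le => // t t0 ta; rewrite leNgt; apply/negP => yt.
    by apply: (H t).
  move: ta; rewrite le_eqVlt => /predU1P[tE|ta]; first by left; rewrite /= -tE.
  right; have ta0 : 0 < a - t by rewrite subr_gt0.
  have [i [m [ti it yG]]] := exceeds_frac t0 ta0 yt.
  exists i => //; exists m => //=; apply: ltW; move: it.
  by rewrite addrC subrK.
move=> [yG|[i _ [m /= ia yG]]]; apply: lt_le_trans yG _.
  exact: (le_running_sup (Gb w)).
exact: (le_running_sup (Gb w)).
Qed.

(** As the time set is open to the right, right continuity lets any time be replaced by a slightly
    later fraction, which makes the supremum countable. *)
Lemma measurable_sup_process (D : T -> set R) :
  (forall t, 0 <= t -> measurable [set w | D w t]) ->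
  (forall w t, 0 <= t -> D w t -> exists2 e, 0 < e & forall u, t <= u -> u < t + e -> D w u) ->
  measurable_fun setT
    (fun w => ereal_sup [set (G t w)%:E | t in [set t : R | 0 <= t /\ D w t]]).
Proof.
move=> mD oD mT; apply: (measurability _ (ErealGenOInfty.measurableE R)) => //.
move=> /= _ [_ [y ->] <-]; rewrite setTI.
rewrite (_ : _ @^-1` _ = \bigcup_i \bigcup_m
    ([set w | D w (frac i m)] `&` [set w | y < G (frac i m) w])).
  apply: bigcupT_measurable => i; apply: bigcupT_measurable => m.
  by apply: measurableI; [exact: mD|exact: mGgt].
apply/seteqP; split=> w; rewrite /= in_itv/= andbT.
  move=> /ereal_sup_gt[_ [t [t0 Dt] <-]]; rewrite lte_fin => yG.
  have [e e0 He] := oD w t t0 Dt.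
  have [i [m [ti it yG']]] := exceeds_frac t0 e0 yG.
  by exists i => //; exists m => //; split=> //=; apply: He => //; exact: ltW.
move=> [i _ [m _ [/= Dt yG]]].
apply: (@lt_le_trans _ _ (G (frac i m) w)%:E); first by rewrite lte_fin.
by apply: ereal_sup_ubound; exists (frac i m).
Qed.

End one_process.

Section first_new_sup_jump.
Variables X C : R -> T -> R.
Hypothesis mX : forall t, 0 <= t -> measurable_fun setT (X t).
Hypothesis mC : forall t, 0 <= t -> measurable_fun setT (C t).
Hypothesis X_cadlag : forall w, cadlag (path X w).
Hypothesis C_cadlag : forall w, cadlag (path C w).
Hypothesis C_nd : forall w s t, 0 <= s -> s <= t -> path C w s <= path C w t.
Hypothesis X_bounded :
  forall w q, exists B, forall t, 0 <= t -> t <= q -> path X w t <= B.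

Definition new_sup_jump_at (w : T) (t : R) : Prop :=
  0 < t /\ left_lim (running_sup (path X w)) t - left_lim (path X w) t
    < jump (path C w) t.

Lemma lt_first_new_sup_jump_open w t : (t%:E < first_new_sup_jump X C w)%E ->
  exists2 e, 0 < e & forall u, u < t + e -> (u%:E < first_new_sup_jump X C w)%E.
Proof.
case: (first_new_sup_jump X C w) => [r| |] //.
  rewrite lte_fin => tr; exists (r - t); first by rewrite subr_gt0.
  by move=> u; rewrite addrC subrK lte_fin.
by move=> _; exists 1 => // u _; exact: ltry.
Qed.

(** A strict bound on the infimum leaves room for a fraction before which no such jump occurs; the
    event becomes a countable union. *)
Lemma lt_first_new_sup_jump w t : 0 <= t -> (t%:E < first_new_sup_jump X C w)%E <->
  exists i m, t < frac i m /\ ~ (exists s, s <= frac i m /\ new_sup_jump_at w s).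
Proof.
move=> t0; split=> [/lt_first_new_sup_jump_open[e e0 He]|[i [m [ti H]]]].
  have [i [m /andP[ti it]]] := dense_right t0 e0.
  exists i, m; split=> // -[s [si Hs]].
  have := He _ it; rewrite ltNge => /negP; apply.
  apply: (@le_trans _ _ s%:E); last by rewrite lee_fin.
  by apply: ereal_inf_lbound; exists s.
apply: (@lt_le_trans _ _ (frac i m)%:E); first by rewrite lte_fin.
apply: le_ereal_inf_tmp => _ [s Hs <-]; rewrite lee_fin leNgt; apply/negP => si.
by apply: H; exists s; split => //; exact: ltW.
Qed.

Let measurable_gap k a b : 0 <= a -> 0 <= b -> measurable [set w |
  running_sup (path X w) a - path X w a + k < path C w b - path C w a].
Proof.
move=> a0 b0.
pose F w := path C w b - path C w a - (running_sup (path X w) a - path X w a + k).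
have mF : measurable_fun setT F.
  have mM := measurable_running_sup mX X_cadlag a0 X_bounded.
  apply: measurable_funB; first by apply: measurable_funB; exact: mC.
  apply: measurable_funD => //; apply: measurable_funB => //; exact: mX.
rewrite (_ : [set w | _] = F @^-1` `]0, +oo[); first exact: measurable_preimage.
by apply/seteqP; split=> w; rewrite /= in_itv/= andbT subr_gt0.
Qed.

Lemma measurable_lt_first_new_sup_jump t : 0 <= t ->
  measurable [set w | (t%:E < first_new_sup_jump X C w)%E].
Proof.
move=> t0.
rewrite (_ : [set w | _] = \bigcup_i \bigcup_(m in [set m | t < frac i m])
    ~` [set w | exists s, s <= frac i m /\ new_sup_jump_at w s]); last first.
  apply/seteqP; split=> w /=.
    by move/(lt_first_new_sup_jump w t0) => [i [m [ti H]]]; exists i => //; exists m.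
  by move=> [i _ [m ti H]]; apply/(lt_first_new_sup_jump w t0); exists i, m.
apply: bigcupT_measurable => i; apply: bigcup_measurable => m /= ti.
apply: measurableC; set q := frac i m in ti *.
have q0 : 0 < q by exact: le_lt_trans ti.
pose cell n j := j%:R * (q / n.+1%:R).
have cell0 n j : 0 <= cell n j by rewrite mulr_ge0// divr_ge0// ltW.
rewrite (_ : [set w | _] = \bigcup_k \bigcup_n0 \bigcap_(n in [set n | (n0 <= n)%N])
    \bigcup_(j in [set j | (j < n.+1)%N]) [set w |
      running_sup (path X w) (cell n j) - path X w (cell n j) + k.+1%:R^-1 <
      path C w (cell n j.+1) - path C w (cell n j)]).
  apply: bigcupT_measurable => k; apply: bigcupT_measurable => n0.
  apply: bigcap_measurable => [|n _]; first by exists n0 => /=.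
  by apply: bigcup_measurable => j _; exact: measurable_gap.
apply/seteqP; split=> w /=.
  move=> [s [sq [s0 Hs]]].
  have [k [n0 H]] := (new_sup_jump_grid (C_cadlag w) (X_cadlag w) (C_nd w)
    (X_bounded w) q0).1 (ex_intro _ s (And3 s0 sq Hs)).
  by exists k => //; exists n0 => // n /= /H[j jn Hj]; exists j.
move=> [k _ [n0 _ H]].
have [|s [s0 sq Hs]] := (new_sup_jump_grid (C_cadlag w) (X_cadlag w) (C_nd w)
    (X_bounded w) q0).2; last by exists s.
by exists k, n0 => n /H[j jn Hj]; exists j.
Qed.

End first_new_sup_jump.
End supremum_measurable.

(** * Passage of the net process above zero *)

Lemma finite_set_min (R : realType) (A : set R) : finite_set A -> A !=set0 ->
  exists2 m, A m & forall y, A y -> m <= y.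
Proof.
move=> /finite_seqP[s ->] [x xs]; elim: s x xs => // y s IH x _.
have [->|] := eqVneq s [::].
  by exists y; [exact: mem_head|move=> z /=; rewrite inE => /eqP ->].
case: s IH => // z s /(_ z (mem_head _ _))[m ms Hm] _.
have [ym|my] := leP y m.
  exists y; first exact: mem_head.
  by move=> u /=; rewrite inE => /predU1P[->//|/Hm]; exact: le_trans.
exists m; first by rewrite /= inE [_ \in _]ms orbT.
by move=> u /=; rewrite inE => /predU1P[->|/Hm//]; exact: ltW.
Qed.

Lemma finite_set_max (R : realType) (A : set R) : finite_set A -> A !=set0 ->
  exists2 m, A m & forall y, A y -> y <= m.
Proof.
move=> fA [x Ax]; have fNA : finite_set (-%R @` A) by exact: finite_image.
have [|_ [m Am <-] Hm] := finite_set_min fNA; first by exists (- x), x.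
by exists m => // y Ay; rewrite -lerN2; apply: Hm; exists y.
Qed.

Section two_subordinators.
Context {d : measure_display} {T : measurableType d} {R : realType}.
Variables (P : probability T R) (c : R) (Z C : R -> T -> R).
Variables nuZ nuC : {finite_measure set R -> \bar R}.
Hypothesis c_gt0 : 0 < c.
Hypotheses (subZ : subordinator P Z) (subC : subordinator P C).
Hypothesis ZC_indep : independent_processes P Z C.
Hypotheses (driftZ : without_drift Z) (driftC : without_drift C).
Hypotheses (levyZ : is_levy_measure P Z nuZ) (levyC : is_levy_measure P C nuC).
Hypotheses (muZ_fin : ('E_P[Z 1%R] < +oo)%E) (muC_fin : ('E_P[C 1%R] < +oo)%E).

Local Notation prob := (prob P).
Local Notation mean := (mean P).
Local Notation mesh := (@mesh R).

Definition net (t : R) (w : T) : R := - c * t + Z t w + C t w.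

Let cell n := cell_increment Z C (mesh n).
Let total (x : R * R) := x.1 + x.2.
Let walk n w := drifted (c * mesh n) (fun i => total (cell n i w)).

Let mesh_gt0 n : 0 < mesh n.
Proof. by rewrite invr_gt0 ltr0n expn_gt0. Qed.
Let mesh_ge0 n : 0 <= mesh n. Proof. exact: ltW. Qed.

Let Z0 w : Z 0 w = 0. Proof. exact: levy_start subZ.1 w. Qed.
Let C0 w : C 0 w = 0. Proof. exact: levy_start subC.1 w. Qed.

Let net0 w : net 0 w = 0. Proof. by rewrite /net Z0 C0 mulr0 !addr0. Qed.

Lemma measurable_net t : 0 <= t -> measurable_fun setT (net t).
Proof.
move=> t0; apply: measurable_funD; last exact: (subordinator_measurable subC).
apply: measurable_funD; first exact: measurable_cst.
exact: (subordinator_measurable subZ).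
Qed.

Lemma net_bounded w q :
  exists B, forall t, 0 <= t -> t <= q -> path net w t <= B.
Proof.
exists (Z q w + C q w) => t t0 tq; rewrite /path /net -addrA.
have ct : - c * t <= 0 by rewrite mulNr oppr_le0 mulr_ge0// ltW.
have Zt : Z t w <= Z q w by exact: subordinator_nd subZ _ _ _ t0 tq.
have Ct : C t w <= C q w by exact: subordinator_nd subC _ _ _ t0 tq.
lra.
Qed.

Lemma net_cadlag w : cadlag (path net w).
Proof.
apply: cadlagD; last exact: levy_cadlag subC.1 w.
by apply: cadlagD; [exact: cadlag_linear|exact: levy_cadlag subZ.1 w].
Qed.

Lemma walk_net n w k : walk n w k = net (k%:R * mesh n) w.
Proof.
elim: k => [|k IH]; first by rewrite /walk drifted0 mul0r net0.
rewrite /walk driftedS -/(walk n w k) IH /net /cell /cell_increment /increment /total /=.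
rewrite -[in X in _ = - c * X + _ + _]natr1; ring.
Qed.

(* A cell in which [C] jumps but [Z] does not can only lift [net] above [0] by a
   jump of [C] that creates a new supremum. *)
Lemma exceed_in_Z_flat_cell w a s N :
  0 <= a -> a < s -> s <= N%:R -> finite_set (jump_times C w N%:R) ->
  (forall v, 0 <= v -> v <= a -> net v w <= 0) -> Z s w = Z a w ->
  0 < net s w -> exists2 u, u <= s & new_sup_jump_at net C w u.
Proof.
move=> a0 as_ sN fJ below Zflat Xs.
have Zc v : a <= v -> v <= s -> Z v w = Z a w.
  move=> av vs; apply/eqP; rewrite eq_le -{1}Zflat.
  by rewrite !(subordinator_nd subZ)//; exact: le_trans av.
(* With [Z] flat, [net] decreases between jumps of [C]. A positive value thus presupposes a jump in
   []a, v]], and the last one already has a positive value. *)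
have climb v : a < v -> v <= s -> 0 < net v w ->
    exists u, [/\ jump_times C w N%:R u, a < u, u <= v & 0 < net u w].
  move=> av vs Xv; pose J := jump_times C w N%:R `&` [set u | a < u <= v].
  have fJv : finite_set J by exact: finite_setIl.
  have [J0|/set0P/(finite_set_max fJv)[u [Ju /andP[au uv]] umax]] := eqVneq J set0.
    have Ca : C v w = C a w.
      apply: (path_no_jump_cst driftC) => //; first exact: ltW.
      move=> t at_ tv; apply/eqP; apply: contraT => jt.
      suff : J t by rewrite J0.
      split; last by rewrite /= at_.
      split=> //; first exact: le_lt_trans at_.
      by rewrite (le_trans tv)// (le_trans vs).
    have := below a a0 (lexx a); move: Xv; rewrite /net Ca Zc//; last exact: ltW.
    have : c * a < c * v by rewrite ltr_pM2l.
    lra.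
  have u0 : 0 <= u by exact: le_trans a0 (ltW au).
  have Cu : C v w = C u w.
    apply: (path_no_jump_cst driftC) => // t ut tv; apply/eqP; apply: contraT => jt.
    suff /umax : J t by rewrite leNgt ut.
    split; last by rewrite /= tv (lt_trans au).
    split=> //; first exact: le_lt_trans ut.
    by rewrite (le_trans tv)// (le_trans vs).
  exists u; split=> //; apply: lt_le_trans Xv _.
  rewrite /net Cu !Zc//; [|exact: ltW|exact: le_trans vs|exact: ltW].
  by rewrite !lerD2r !mulNr lerN2 ler_pM2l.
(* The earliest jump at which [net] is positive; by [climb], no earlier time has a positive
   value. *)
pose J := jump_times C w N%:R `&` [set u | a < u <= s /\ 0 < net u w].
have fJs : finite_set J by exact: finite_setIl.
have [|u [Ju [/andP[au us] Xu]] umin] := finite_set_min fJs.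
  have [u [Ju au us Xu]] := climb s as_ (lexx s) Xs.
  by exists u; split=> //; split=> //; rewrite au.
exists u => //.
have u0 : 0 < u by exact: le_lt_trans au.
have Xv v : 0 <= v -> v < u -> net v w <= 0.
  move=> v0 vu; have [va|av] := leP v a; first exact: below.
  rewrite leNgt; apply/negP => Xv.
  have [u' [Ju' au' u'v Xu']] := climb v av (ltW (lt_le_trans vu us)) Xv.
  have /umin : J u'.
    split=> //; split=> //; rewrite au' (le_trans u'v)//.
    exact/ltW/(lt_le_trans vu).
  by rewrite leNgt (le_lt_trans u'v).
split=> //.
(* Since [net] starts at 0, the supremum before [u] is 0, and a jump lifting [net] above 0 exceeds
   it. *)
have supM v : 0 <= v -> v < u -> running_sup (path net w) v = 0.
  have gb := net_bounded w.
  move=> v0 vu; apply/eqP; rewrite eq_le; apply/andP; split.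
    by apply: running_sup_le => // t t0 tv; apply: Xv => //; exact: le_lt_trans vu.
  by rewrite -(net0 w) -[net 0 w]/(path net w 0); exact: le_running_sup.
have -> : left_lim (running_sup (path net w)) u = 0.
  apply: lim_near_cst => //; near=> v; apply: supM.
    by apply: ltW; near: v; exact: nbhs_left_gt.
  by near: v; exact: nbhs_left_lt.
have LZ : left_lim (path Z w) u = Z u w.
  rewrite (Zc u (ltW au) us); apply: lim_near_cst => //; near=> v.
  apply: (Zc v); first by apply: ltW; near: v; exact: nbhs_left_gt.
  by apply: le_trans us; apply: ltW; near: v; exact: nbhs_left_lt.
have cZ := (levy_cadlag subZ.1 w).2 u u0.
have cC := (levy_cadlag subC.1 w).2 u u0.
have cl := (@cadlag_linear R (- c)).2 u u0.
have Ll : left_lim (fun t : R => - c * t) u = - c * u.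
  apply: cvg_lim => //; apply: cvg_at_left_filter.
  by apply: cvgM; [exact: cvg_cst|exact: cvg_id].
have -> : left_lim (path net w) u = - c * u + Z u w + left_lim (path C w) u.
  have -> : path net w = (fun t => (- c * t + path Z w t) + path C w t) by [].
  rewrite left_limD//; last exact: is_cvgD.
  by rewrite left_limD// Ll LZ.
by move: Xu; rewrite /jump /net /path; lra.
Unshelve. all: by end_near. Qed.

Definition Z_passage N n := [set w | exists2 k, (k < N * 2 ^ n)%N &
  (forall j, (j <= k)%N -> walk n w j <= 0) /\ 0 < walk n w k + (cell n k w).1].

(** On a fine grid, the first cell in which [net] becomes positive has only one active component. If
    that were not [Z], [exceed_in_Z_flat_cell] would give a new supremum by a jump of [C] before
    [sigma]. *)
Lemma sup_before_jump_Z_passage w :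
  (forall N, finite_set (jump_times C w N%:R)) ->
  (forall N, exists n0, forall n, (n0 <= n)%N -> ~ common_cell Z C N n w) ->
  (exists t, [/\ 0 <= t, (t%:E < first_new_sup_jump net C w)%E & 0 < net t w]) ->
  exists N n0, forall n, (n0 <= n)%N -> Z_passage N n w.
Proof.
move=> fJ ncc [t [t0 ts Xt]].
have t_gt0 : 0 < t.
  by rewrite lt_neqAle t0 andbT; apply: contraTneq Xt => <-; rewrite net0 ltxx.
pose N := (Num.truncn t).+1; exists N.
have tN : t <= N%:R by apply: ltW; exact: truncnS_gt.
have [n0 Hn0] := ncc N; exists n0 => n /Hn0 ncn.
set h := mesh n; have h_gt0 : 0 < h by exact: mesh_gt0.
have Nh : (N * 2 ^ n)%:R * h = N%:R.
  by rewrite /h !meshE natrM -mulrA mulfV ?mulr1// pnatr_eq0 -lt0n expn_gt0.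
pose up k := `[< exists s, [/\ k%:R * h < s, s <= k.+1%:R * h, s <= t & 0 < net s w] >].
have cellof s : 0 < s -> s <= t -> 0 < net s w -> exists2 k, (k < N * 2 ^ n)%N &
    [/\ up k, k%:R * h < s & s <= k.+1%:R * h].
  move=> s0 st Xs; have [|k kN /andP[ks sk]] := @grid_cell R h s (N * 2 ^ n) s0.
    by rewrite Nh (le_trans st).
  by exists k => //; split=> //; apply/asboolP; exists s.
have [k0 k0N [upk0 _ _]] := cellof t t_gt0 (lexx t) Xt.
have exup : exists k, up k by exists k0.
have [k /asboolP[s [ks sk st Xs]] kmin] := ex_minnP exup.
have kh0 : 0 <= k%:R * h by rewrite mulr_ge0// ltW.
have below v : 0 <= v -> v <= k%:R * h -> net v w <= 0.
  rewrite le_eqVlt => /predU1P[<- _|v0 vk]; first by rewrite net0.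
  rewrite leNgt; apply/negP => Xv.
  have [|k' _ [upk' k'v _]] := cellof v v0 _ Xv; first by apply: le_trans st; exact/ltW/(le_lt_trans vk).
  have := lt_le_trans k'v vk; rewrite ltr_pM2r// ltr_nat ltnNge.
  by rewrite kmin.
exists k; first exact: leq_ltn_trans (kmin _ upk0) k0N.
split=> [j jk|].
  rewrite walk_net; apply: below; first by rewrite mulr_ge0// ltW.
  by rewrite ler_wpM2r ?ler_nat// ltW.
have kN : (k < N * 2 ^ n)%N by exact: leq_ltn_trans (kmin _ upk0) k0N.
have kS0 : 0 <= k.+1%:R * h by rewrite mulr_ge0// ltW.
have kkS : k%:R * h <= k.+1%:R * h by rewrite ler_wpM2r ?ler_nat// ltW.
have s0 : 0 <= s by exact: le_trans (ltW ks).
rewrite walk_net -/h /cell /cell_increment /increment /= -/h.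
have Zs : Z s w <= Z (k.+1%:R * h) w by exact: subordinator_nd subZ _ _ _ s0 sk.
(* If [Z] is active then [C] is flat, and the increment of [Z] over the whole cell lifts the walk at
   least to [net s], as the drift only helps. *)
have [aZ|naZ] := pselect (active_cell Z h k w).
  have naC : ~ active_cell C h k w by move=> aC; apply: ncn; exists k.
  have Cs : C s w <= C (k%:R * h) w.
    apply: le_trans (subordinator_nd subC _ s0 sk) _.
    by rewrite leNgt; apply/negP.
  apply: lt_le_trans Xs _; rewrite /net.
  have : c * (k%:R * h) <= c * s by rewrite ler_pM2l// ltW.
  lra.
have Zflat : Z s w = Z (k%:R * h) w.
  apply/eqP; rewrite eq_le; apply/andP; split.
    by apply: le_trans Zs _; rewrite leNgt; apply/negP.
  exact: subordinator_nd subZ _ _ _ kh0 (ltW ks).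
have [u us [u0 Hu]] := exceed_in_Z_flat_cell kh0 ks (le_trans st tN) (fJ N) below Zflat Xs.
exfalso; move: ts; apply/negP; rewrite -leNgt.
apply: (@le_trans _ _ u%:E); last by rewrite lee_fin (le_trans us).
by apply: ereal_inf_lbound; exists u.
Qed.

Let cell_iid n : iid P (cell n).
Proof. exact: iid_cell_increment subZ.1 subC.1 ZC_indep _ (mesh_ge0 n). Qed.

Let cell_ge0 n k w : 0 <= (cell n k w).1 /\ 0 <= (cell n k w).2.
Proof.
have h0 := mesh_ge0 n.
by rewrite /= !subr_ge0; split; [apply: (subordinator_nd subZ)|
  apply: (subordinator_nd subC)]; rewrite ?mulr_ge0// ler_wpM2r// ler_nat.
Qed.

Let cell0_Z n : (fun w => (cell n 0%N w).1) = Z (mesh n).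
Proof.
by apply/funext => w; rewrite /cell /cell_increment /= mul0r mul1r Z0 subr0.
Qed.

Let cell0_C n : (fun w => (cell n 0%N w).2) = C (mesh n).
Proof.
by apply/funext => w; rewrite /cell /cell_increment /= mul0r mul1r C0 subr0.
Qed.

Let mesh_le1 n : mesh n <= 1.
Proof. by rewrite invf_le1 ?ltr0n ?expn_gt0// ler1n expn_gt0. Qed.

Let L1_Z n : L1 P (Z (mesh n)).
Proof. exact: subordinator_L1 subZ muZ_fin _ _ (mesh_le1 n). Qed.
Let L1_C n : L1 P (C (mesh n)).
Proof. exact: subordinator_L1 subC muC_fin _ _ (mesh_le1 n). Qed.

Let mean_Z n : mean (Z (mesh n)) = mean (Z 1) * mesh n.
Proof.
rewrite (subordinator_mean subZ muZ_fin (expn_gt0 2 n)) mulrAC mulfV ?mul1r//.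
Qed.

Let prob_Z_jump n : prob [set w | 0 < Z (mesh n) w] <= fine (nuZ setT) * mesh n.
Proof.
rewrite -ler_pdivrMr// invrK mulrC.
exact: (prob_active_le subZ driftZ levyZ (expn_gt0 2 n)).
Qed.

Let prob_C_jump n : prob [set w | 0 < C (mesh n) w] <= fine (nuC setT) * mesh n.
Proof.
rewrite -ler_pdivrMr// invrK mulrC.
exact: (prob_active_le subC driftC levyC (expn_gt0 2 n)).
Qed.

Lemma measurable_Z_passage N n : measurable (Z_passage N n).
Proof.
have mw k : measurable_fun setT (fun w => walk n w k).
  rewrite (_ : (fun w => _) = net (k%:R * mesh n)); first by apply: measurable_net; rewrite mulr_ge0.
  by apply/funext => w; rewrite walk_net.
rewrite (_ : Z_passage N n = \bigcup_(k in [set k | (k < N * 2 ^ n)%N])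
  ((\bigcap_(j in [set j | (j <= k)%N]) (fun w => walk n w j) @^-1` `]-oo, 0]) `&`
   (fun w => walk n w k + (cell n k w).1) @^-1` `]0, +oo[)).
  apply: bigcup_measurable => k _; apply: measurableI.
    apply: bigcap_measurable => [|j _]; first by exists 0%N.
    exact: measurable_preimage (mw j) _.
  apply: measurable_preimage => //; apply: measurable_funD => //.
  exact: measurableT_comp measurable_fst (iid_measurable (cell_iid n) k).
apply/seteqP; split=> w /= [k kN].
  move=> [H1 H2]; exists k => //; split; last by rewrite /= in_itv/= andbT.
  by move=> j /= jk; rewrite in_itv/=; exact: H1.
move=> [H1 H2]; exists k => //; split; last by move: H2; rewrite /= in_itv/= andbT.
by move=> j jk; have := H1 j jk; rewrite /= in_itv.
Qed.

Let cells_pos N n : (0 < N)%N -> (0 < N * 2 ^ n)%N.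
Proof. by move=> N0; rewrite muln_gt0 N0 expn_gt0. Qed.

(** [jump_first_passage] with [b = c * mesh n], divided by [mesh n]. The short records carry one
    factor [mesh n] from [b] and one from the probability that [Z] jumps, while the expected number
    of active cells stays bounded, so a factor [mesh n] is left. *)
Lemma prob_Z_passage N n x : (0 < N)%N -> 0 <= x ->
  c * prob (Z_passage N n) <= mean (Z 1)
  - x * ((2 ^ n)%:R * prob [set w | 2 * x < Z (mesh n) w]) *
    prob [set w | forall k, (k <= N * 2 ^ n)%N -> - x <= net (k%:R * mesh n) w]
  + c * fine (nuZ setT) * (1 + N%:R * (fine (nuZ setT) + fine (nuC setT))) * mesh n.
Proof.
move=> N0 x0; have h0 := mesh_gt0 n.
have LZ : L1 P (fun w => (cell n 0 w).1) by rewrite cell0_Z.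
have ch0 : 0 <= c * mesh n by rewrite mulr_ge0// ltW.
(* The predecessor matches the [N.+1] cells of [jump_first_passage]; the resulting event [shallow]
   has one constraint less, which only enlarges it. *)
have := jump_first_passage (cell_iid n) (cell_ge0 n) ch0 LZ (N * 2 ^ n).-1 x0.
rewrite prednK ?cells_pos// -/(Z_passage N n).
set shallow := [set w | forall k, _ -> - x <= _].
set shallow' := [set w | forall k, _ -> - x <= _].
have msh m (F : nat -> T -> R) : (forall k, F k = net (k%:R * mesh n)) ->
    measurable [set w | forall k, (k <= m)%N -> - x <= F k w].
  move=> FE; rewrite (_ : [set w | _] =
    \bigcap_(k in [set k | (k <= m)%N]) F k @^-1` `[- x, +oo[).
    apply: bigcap_measurable => [|k _]; first by exists 0%N.
    by rewrite FE; apply: measurable_preimage => //; apply: measurable_net; rewrite mulr_ge0.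
  by apply/seteqP; split=> w /= H k km; have := H k km; rewrite /= in_itv/= andbT.
have shle : prob shallow' <= prob shallow.
  apply: le_prob.
  - exact: msh.
  - by apply: msh => k; apply/funext => w; exact: walk_net.
  - move=> w /= H k kN; rewrite -[leRHS]/(walk n w k) walk_net; apply: H.
    by apply: leq_trans kN _; exact: leq_pred.
have -> : [set w | 2 * x < (cell n 0%N w).1] = [set w | 2 * x < Z (mesh n) w].
  by rewrite -cell0_Z.
have -> : [set w | 0 < (cell n 0%N w).1] = [set w | 0 < Z (mesh n) w].
  by rewrite -cell0_Z.
have -> : [set w | 0 < (cell n 0%N w).2] = [set w | 0 < C (mesh n) w].
  by rewrite -cell0_C.
rewrite cell0_Z mean_Z.
have := prob_C_jump n; have := prob_Z_jump n; move: shle.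
have p0 : 0 <= prob [set w | 0 < Z (mesh n) w] by exact: prob_ge0.
have q0 : 0 <= prob [set w | 0 < C (mesh n) w] by exact: prob_ge0.
have r0 : 0 <= prob [set w | 2 * x < Z (mesh n) w] by exact: prob_ge0.
move: p0 q0 r0.
set p := prob [set w | 0 < Z _ w]; set q := prob [set w | 0 < C _ w].
set r := prob [set w | 2 * x < _].
set A := prob (Z_passage _ _); set s := prob shallow; set s' := prob shallow'.
set a := fine _; set b := fine _; set m := mean _.
move=> p0 q0 r0 ss pa qb H.
have a0 : 0 <= a by rewrite fine_ge0.
have b0 : 0 <= b by rewrite fine_ge0.
have N1 : ((N * 2 ^ n).-1)%:R * (p + q) <= N%:R * (a + b).
  apply: (@le_trans _ _ ((N * 2 ^ n)%:R * ((a + b) * mesh n))).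
    by rewrite ler_pM ?ler_nat ?leq_pred ?addr_ge0// mulrDl lerD.
  rewrite natrM !meshE; have M0 : (2 ^ n)%:R != 0 :> R.
    by rewrite pnatr_eq0 -lt0n expn_gt0.
  by rewrite -mulrA [(2 ^ n)%:R * _]mulrCA mulfV// mulr1.
rewrite -(ler_pM2r h0); apply: (@le_trans _ _ (c * mesh n * A)).
  by rewrite mulrAC.
apply: (le_trans H); rewrite mulrDl mulrBl; apply: lerD.
  apply: lerB => //.
  have -> : x * ((2 ^ n)%:R * r) * s' * mesh n = x * r * s'.
    have M0 : (2 ^ n)%:R != 0 :> R by rewrite pnatr_eq0 -lt0n expn_gt0.
    by rewrite !meshE; move: M0; move: ((2 ^ n)%:R : R) => M M0; field.
  by rewrite ler_wpM2l// mulr_ge0.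
have -> : c * a * (1 + N%:R * (a + b)) * mesh n * mesh n =
  c * mesh n * (a * mesh n) * (1 + N%:R * (a + b)) by ring.
apply: ler_pM => //.
- by rewrite mulr_ge0.
- by rewrite addr_ge0// mulr_ge0// addr_ge0.
- by rewrite ler_wpM2l.
- by rewrite lerD2l.
Qed.

Let step n k w := total (cell n k w) - c * mesh n.

Let step_iid n : iid P (step n).
Proof.
apply: (iid_comp (f := fun x : R * R => total x - c * mesh n)) (cell_iid n).
by apply: measurable_funB => //; exact: measurable_funD.
Qed.

Let sum_step n m w : \sum_(i < m) step n i w = net (m%:R * mesh n) w.
Proof. by rewrite -walk_net. Qed.

Let sum_step_tail n k m w : (k <= m)%N ->
  \sum_(k <= i < m) step n i w = net (m%:R * mesh n) w - net (k%:R * mesh n) w.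
Proof.
move=> km; rewrite -!sum_step -!(big_mkord predT (fun i => step n i w)).
by rewrite (@big_cat_nat _ _ _ k 0 m)//= addrAC subrr add0r.
Qed.

(** The maximum of [- net] along the grid has the law of the reflected walk with steps [- step],
    whose upper bounds are those of [net] at earlier times minus [net] at the end. *)
Let prob_net_reversal n m y :
  prob [set w | forall k, (k <= m)%N -> - y <= net (k%:R * mesh n) w] =
  prob [set w | forall k, (k <= m)%N ->
    net (k%:R * mesh n) w - net (m%:R * mesh n) w <= y].
Proof.
have nstep_iid : iid P (fun k => -%R \o step n k) by exact: iid_comp (step_iid n).
have := prob_reflected_walk nstep_iid m y.
have -> : [set w | reflected ((fun k => -%R \o step n k)^~ w) m <= y] =
    [set w | forall k, (k <= m)%N ->
      net (k%:R * mesh n) w - net (m%:R * mesh n) w <= y].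
  apply/seteqP; split=> w /=.
    move=> /reflected_le H k km; have := H k km.
    by rewrite sumrN sum_step_tail// opprB.
  by move=> H; apply/reflected_le => k km; rewrite sumrN sum_step_tail// opprB; exact: H.
move=> ->; congr prob; apply/seteqP; split=> w /= H k km; have := H k km.
  by rewrite sumrN sum_step lerNl.
by rewrite sumrN sum_step lerNl.
Qed.

Let net_decrease s t w : 0 <= s -> s <= t -> net s w - c * (t - s) <= net t w.
Proof.
move=> s0 st; have Zst := subordinator_nd subZ w s0 st.
have Cst := subordinator_nd subC w s0 st.
rewrite /net mulrBr !mulNr; move: Zst Cst; move: (c * t) (c * s) => x y; lra.
Qed.

Let measurable_net_ge n m y :
  measurable [set w | forall k, (k <= m)%N -> - y <= net (k%:R * mesh n) w].
Proof.
rewrite (_ : [set w | _] =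
    \bigcap_(k in [set k | (k <= m)%N]) net (k%:R * mesh n) @^-1` `[- y, +oo[).
  apply: bigcap_measurable => [|k _]; first by exists 0%N.
  by apply: measurable_preimage => //; apply: measurable_net; rewrite mulr_ge0.
by apply/seteqP; split=> w /= H k km; have := H k km; rewrite /= in_itv/= andbT.
Qed.

(** [walk_bounded_below] is applied on the integer grid only. Since [net] falls by at most [c]
    within a unit of time, enlarging [K] by [c] covers all finer grids with the same [kappa]. *)
Lemma net_bounded_below : c < mean (Z 1) + mean (C 1) ->
  exists K kappa, [/\ 0 <= K, 0 < kappa & forall n m,
    kappa <= prob [set w | forall k, (k <= m)%N -> - K <= net (k%:R * mesh n) w]].
Proof.
move=> c_lt.
have mesh0 : mesh 0 = 1 by rewrite !meshE expn0 invr1.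
have LZ : L1 P (Z 1) by have := L1_Z 0; rewrite mesh0.
have LC : L1 P (C 1) by have := L1_C 0; rewrite mesh0.
have step0 : step 0 0%N = fun w => Z 1 w + C 1 w - c.
  apply/funext => w; rewrite /step /total mesh0 mulr1.
  have := congr1 (@^~ w) (cell0_Z 0); have := congr1 (@^~ w) (cell0_C 0).
  by rewrite /= mesh0 => -> ->.
have LZC : L1 P (fun w => Z 1 w + C 1 w) by exact: L1D.
have L0 : L1 P (step 0 0%N) by rewrite step0; apply: L1B => //; exact: L1_cst.
have m0 : 0 < mean (step 0 0%N).
  by rewrite step0 meanB ?meanD// ?mean_cst ?subr_gt0//; exact: L1_cst.
have stepb i w : - c <= step 0 i w.
  have [? ?] := cell_ge0 0 i w.
  by rewrite /step mesh0 mulr1 lerBrDr addNr addr_ge0.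
have [K [kappa [K0 kappa0 H]]] := walk_bounded_below (step_iid 0) (ltW c_gt0) stepb L0 m0.
exists (K + c), kappa; split=> //; first by rewrite addr_ge0// ltW.
move=> n m; apply: le_trans (H m) _.
have -> : [set w | forall k, (k <= m)%N -> - K <= \sum_(i < k) step 0 i w] =
    [set w | forall k, (k <= m)%N -> - K <= net (k%:R * mesh 0) w].
  by apply/seteqP; split=> w /= G k km; have := G k km; rewrite sum_step.
apply: le_prob => // w /= G k km.
have t0 : 0 <= k%:R * mesh n by rewrite mulr_ge0.
have tk : k%:R * mesh n <= k%:R by rewrite ler_piMr.
pose j := Num.truncn (k%:R * mesh n).
have jt : j%:R <= k%:R * mesh n by rewrite -truncn_ge_nat.
have tj : k%:R * mesh n - j%:R <= 1.
  by have := truncnS_gt (k%:R * mesh n); rewrite -/j -natr1; lra.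
have jm : (j <= m)%N.
  by apply: leq_trans km; rewrite -(ler_nat R); exact: le_trans jt tk.
have := G j jm; rewrite mesh0 mulr1.
have := net_decrease w (ler0n R j) jt.
have : c * (k%:R * mesh n - j%:R) <= c by rewrite ger_pMr// ltW.
by move: (net _ w) (net _ w) => u v; lra.
Qed.

(** Divide the time [mesh q] into [m] cells with [m x >= K]; with positive probability each of the
    independent increments exceeds [x]. *)
Let prob_Z_large (K : R) q : nuZ setT <> 0%E ->
  0 < prob [set w | K <= Z (mesh q) w].
Proof.
move=> nu0; have pZ := subordinator_nontrivial subZ levyZ nu0.
have [x [delta [x0 d0 H]]] := jump_size_bound subZ driftZ pZ.
pose m := (Num.truncn (K / x)).+1.
have mK : K <= m%:R * x by rewrite -ler_pdivrMr//; apply: ltW; exact: truncnS_gt.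
pose h : R := (2 ^ q * m)%:R^-1.
have h0 : 0 <= h by rewrite invr_ge0.
have mh : m%:R * h = mesh q.
  by rewrite /h !meshE natrM invfM mulrCA mulfV ?mulr1// pnatr_eq0.
have iidZ : iid P (fun k => fst \o cell_increment Z C h k).
  apply: iid_comp; first exact: measurable_fst.
  exact: iid_cell_increment subZ.1 subC.1 ZC_indep _ h0.
pose B := [set y : R | x < y].
have mx : measurable B.
  rewrite (_ : B = `]x, +oo[%classic) //.
  by apply/seteqP; split=> y /=; rewrite in_itv/= andbT.
have px : 0 < prob [set w | x < Z h w].
  have := H (2 ^ q * m)%N; rewrite muln_gt0 expn_gt0/= => /(_ isT) H'.
  have := lt_le_trans d0 H'; rewrite pmulr_rgt0// ltr0n.
  by rewrite muln_gt0 expn_gt0.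
pose E := [set w | forall k, (k < m)%N -> x < (fst \o cell_increment Z C h k) w].
have PE : P E = (\prod_(k < m)
    P ((fst \o cell_increment Z C h 0%N) @^-1` B))%E.
  exact: (@iid_product _ _ _ _ _ _ _ iidZ m (fun=> B) (fun=> mx)).
have E0 : (fst \o cell_increment Z C h 0%N) @^-1` B = [set w | x < Z h w].
  by apply/seteqP; split=> w /=; rewrite mul0r mul1r Z0 subr0.
have mE : measurable E.
  rewrite (_ : E = \bigcap_(k in [set k | (k < m)%N])
    (fst \o cell_increment Z C h k) @^-1` B)//.
  apply: bigcap_measurable => [|k _]; first by exists 0%N.
  exact: measurable_preimage (iid_measurable iidZ k) mx.
have mZh : measurable [set w | x < Z h w].
  by rewrite -E0; exact: measurable_preimage (iid_measurable iidZ 0%N) mx.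
apply: (@lt_le_trans _ _ (prob E)).
  rewrite -lte_fin -probE// PE E0.
  under eq_bigr do rewrite probE//.
  by rewrite prodEFin lte_fin prodr_gt0.
apply: le_prob => //.
  rewrite (_ : [set w | _] = Z (mesh q) @^-1` `[K, +oo[).
    by apply: measurable_preimage => //; exact: (subordinator_measurable subZ).
  by apply/seteqP; split=> w /=; rewrite in_itv/= andbT.
move=> w Ew; apply: (le_trans mK); rewrite -mh.
have : \sum_(i < m) x <= \sum_(i < m) (Z (i.+1%:R * h) w - Z (i%:R * h) w).
  by apply: ler_sum => i _; apply: ltW; exact: (Ew i (ltn_ord i)).
rewrite sumr_const card_ord mulr_natl => /le_trans; apply.
rewrite -(big_mkord predT (fun i => Z (i.+1%:R * h) w - Z (i%:R * h) w)).
by rewrite (telescope_sumr (fun i => Z (i%:R * h) w))// mul0r Z0 subr0.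
Qed.

(* A large initial jump of [Z] together with a later path bounded below by [- K]
   keeps the path above [- x]; it is read off the time-reversed path, so that
   the jump comes last and is independent of the past. *)
Lemma net_stays_above x : nuZ setT <> 0%E -> c < mean (Z 1) + mean (C 1) -> 0 < x ->
  exists kappa q, 0 < kappa /\ forall N n, (0 < N)%N -> (q <= n)%N ->
    kappa <= prob [set w | forall k, (k <= N * 2 ^ n)%N -> - x <= net (k%:R * mesh n) w].
Proof.
move=> nu0 c_lt x0; have [K [kappa [K0 kappa0 HK]]] := net_bounded_below c_lt.
(* With this [q], the drift over a time [mesh q] costs at most [x]. *)
pose q := Num.truncn (c / x).
have cq : c * mesh q <= x.
  rewrite mulrC -ler_pdivlMr// -[x / c]invf_div lef_pV2 ?posrE ?divr_gt0 ?ltr0n ?expn_gt0//.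
  by apply/ltW/(lt_le_trans (truncnS_gt _)); rewrite ler_nat ltn_expl.
exists (kappa * prob [set w | K <= Z (mesh q) w]), q.
split; first by rewrite mulr_gt0// prob_Z_large.
move=> N n N0 qn; rewrite prob_net_reversal.
pose j := (2 ^ (n - q))%N.
have jN : (j <= N * 2 ^ n)%N.
  by rewrite (leq_trans _ (leq_pmull _ N0))// leq_exp2l// leq_subr.
pose m := (N * 2 ^ n - j)%N.
have jh : j%:R * mesh n = mesh q.
  by rewrite /j !meshE -{2}(subnK qn) expnD natrM invfM mulrA mulfV ?mul1r//.
have mj : (N * 2 ^ n)%:R * mesh n = m%:R * mesh n + mesh q.
  by rewrite -jh -mulrDl -natrD subnK.
set s := m%:R * mesh n in mj; set t := (N * 2 ^ n)%:R * mesh n in mj *.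
have s0 : 0 <= s by rewrite mulr_ge0.
have st : s <= t by rewrite mj lerDl.
have ts : t - s = mesh q by rewrite mj addrAC subrr add0r.
(* The reversed form of the bound by [- K]. It involves times up to [s] only, hence is independent
   of the increment of [Z] over the final stretch of length [mesh q]. *)
pose E := [set w | forall k, (k <= m)%N -> net (k%:R * mesh n) w - net s w <= K].
have pE : kappa <= prob E by rewrite -prob_net_reversal.
have past : measurable (E : set (past_type Z C s)).
  have mn u : 0 <= u <= s ->
      measurable_fun (setT : set (past_type Z C s)) (net u : past_type Z C s -> R).
    move=> us; apply: measurable_funD; last exact: measurable_past_C.
    by apply: measurable_funD; [exact: measurable_cst|exact: measurable_past_Z].
  rewrite (_ : E = \bigcap_(k in [set k | (k <= m)%N])
      (fun w => net (k%:R * mesh n) w - net s w) @^-1` `]-oo, K]); last first.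
    by apply/seteqP; split=> w /= H k km; have := H k km; rewrite /= in_itv.
  apply: bigcap_measurable => [|k km]; first by exists 0%N.
  apply: (@measurable_preimage _ _ (past_type Z C s) R) => //.
  apply: measurable_funB; apply: mn; last by rewrite s0 lexx.
  by rewrite mulr_ge0//= ler_wpM2r// ler_nat.
have mE := past_measurable subZ.1 subC.1 past.
have mB : measurable ([set y : R * R | K <= y.1]).
  rewrite (_ : [set y | _] = fst @^-1` `[K, +oo[).
    by apply: measurable_preimage => //; exact: measurable_fst.
  by apply/seteqP; split=> y /=; rewrite in_itv/= andbT.
have t0 := le_trans s0 st.
have mI := measurable_preimage (measurable_increment subZ.1 subC.1 s0 t0) mB.
have mEI : measurable (E `&` increment Z C s t @^-1` [set y | K <= y.1]).
  exact: measurableI.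
have inc := past_increment subZ.1 subC.1 ZC_indep s0 st past mB.
have I0 : increment Z C 0 (t - s) @^-1` [set y : R * R | K <= y.1] = [set w | K <= Z (mesh q) w].
  by apply/seteqP; split=> w /=; rewrite ts Z0 subr0.
have mZq : measurable [set w | K <= Z (mesh q) w].
  rewrite -I0; apply: measurable_preimage mB.
  by apply: (measurable_increment subZ.1 subC.1); rewrite // ts.
have incE : prob (E `&` increment Z C s t @^-1` [set y | K <= y.1]) =
    prob E * prob [set w | K <= Z (mesh q) w].
  by apply: EFin_inj; rewrite EFinM -!probE// inc I0.
apply: (@le_trans _ _ (prob E * prob [set w | K <= Z (mesh q) w])).
  by rewrite ler_wpM2r// prob_ge0.
rewrite -incE; apply: le_prob => //.
  rewrite (_ : [set w | _] = \bigcap_(k in [set k | (k <= N * 2 ^ n)%N])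
      (fun w => net (k%:R * mesh n) w - net t w) @^-1` `]-oo, x]); last first.
    by apply/seteqP; split=> w /= H k km; have := H k km; rewrite /= in_itv.
  apply: bigcap_measurable => [|k km]; first by exists 0%N.
  apply: measurable_preimage => //.
  by apply: measurable_funB; apply: measurable_net => //; rewrite mulr_ge0.
move=> w [Ew /= Iw] k kN.
have kh0 : 0 <= k%:R * mesh n by rewrite mulr_ge0.
have kt : k%:R * mesh n <= t by rewrite ler_wpM2r// ler_nat.
(* Before [s], the final increment of [Z] makes up for [K] and the drift costs at most [x]; after
   [s], only drift over less than [mesh q] can be lost. *)
have [km|mk] := leqP k m.
  have Cst := subordinator_nd subC w s0 st.
  have e : c * (t - s) <= x by rewrite ts.
  have : net s w + K - x <= net t w.
    move: Iw Cst e; rewrite /net mulrBr !mulNr; move: (c * t) (c * s) => y y'; lra.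
  by have := Ew k km; move: (net _ w) (net s w) (net t w) => u v v'; lra.
have := net_decrease w kh0 kt.
have : c * (t - k%:R * mesh n) <= x.
  apply: le_trans cq; rewrite ler_pM2l// -ts lerB// ler_wpM2r// ler_nat.
  exact: ltnW.
by move: (net _ w) (net _ w) => u v; lra.
Qed.

End two_subordinators.

Lemma mesh_le_inv (R : realType) n : @mesh R n <= n.+1%:R^-1.
Proof. by rewrite lef_pV2 ?posrE ?ltr0n ?expn_gt0// ler_nat ltn_expl. Qed.

Lemma le_of_le_mesh (R : realType) (x y k : R) n0 : 0 <= k ->
  (forall n, (n0 <= n)%N -> x <= y + k * @mesh R n) -> x <= y.
Proof.
move=> k0 H; rewrite -subr_le0; apply: (@le0_of_le_divS _ _ k) => n.
have := H (maxn n0 n) (leq_maxl _ _); rewrite -lerBlDl => /le_trans; apply.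
rewrite ler_wpM2l//; apply: (le_trans (mesh_le_inv _ _)).
by rewrite lef_pV2 ?posrE ?ltr0n// ler_nat ltnS leq_maxr.
Qed.

Lemma measurable_set_le0 d (T : measurableType d) (R : realType) (S : T -> \bar R) :
  measurable_fun setT S -> measurable [set w | (S w <= 0)%E].
Proof.
move=> mS; rewrite (_ : [set w | _] = S @^-1` `]-oo, 0%E]).
  exact: measurable_preimage mS (emeasurable_itv _).
by apply/seteqP; split=> w /=; rewrite in_itv.
Qed.

(** * The two bounds and their comparison *)

Section suprema.
Context {d : measure_display} {T : measurableType d} {R : realType}.
Variables (P : probability T R) (c : R) (Z C : R -> T -> R).
Variables nuZ nuC : {finite_measure set R -> \bar R}.
Hypothesis c_gt0 : 0 < c.
Hypotheses (subZ : subordinator P Z) (subC : subordinator P C).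
Hypothesis ZC_indep : independent_processes P Z C.
Hypotheses (driftZ : without_drift Z) (driftC : without_drift C).
Hypotheses (levyZ : is_levy_measure P Z nuZ) (levyC : is_levy_measure P C nuC).
Hypotheses (muZ_fin : ('E_P[Z 1%R] < +oo)%E) (muC_fin : ('E_P[C 1%R] < +oo)%E).

Local Notation prob := (prob P).
Local Notation mean := (mean P).
Local Notation mesh := (@mesh R).

Let supY w := ereal_sup [set (- c * t + Z t w)%:E | t in [set t : R | 0 <= t]].
Let supX w := ereal_sup [set (net c Z C t w)%:E |
  t in [set t : R | 0 <= t /\ (t%:E < first_new_sup_jump (net c Z C) C w)%E]].

Lemma measurable_supY : measurable_fun setT supY.
Proof.
have := @measurable_sup_process _ T R (fun t w => - c * t + Z t w) _ _ (fun=> setT).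
rewrite (_ : (fun w => _) = supY); last first.
  apply/funext => w; congr ereal_sup; congr image.
  by apply/seteqP; split=> t /= => [[]|].
apply.
- move=> t t0; apply: measurable_funD; first exact: measurable_cst.
  exact: (subordinator_measurable subZ).
- by move=> w; apply: cadlagD; [exact: cadlag_linear|exact: levy_cadlag subZ.1 w].
- by move=> t _; rewrite (_ : [set w | _] = setT)//; apply/seteqP; split.
- by move=> w t _ _; exists 1.
Qed.

Lemma measurable_supX : measurable_fun setT supX.
Proof.
have mnet := measurable_net c subZ subC.
have cnet := net_cadlag c subZ subC.
apply: (@measurable_sup_process _ T R (net c Z C) mnet cnet
  (fun w t => (t%:E < first_new_sup_jump (net c Z C) C w)%E)).
  move=> t t0; apply: measurable_lt_first_new_sup_jump => //.
  - by move=> s s0; exact: (subordinator_measurable subC).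
  - by move=> w; exact: levy_cadlag subC.1 w.
  - by move=> w s u; exact: (subordinator_nd subC).
  - exact: net_bounded c_gt0 subZ subC.
move=> w t _ /lt_first_new_sup_jump_open[e e0 He].
by exists e => // u _; exact: He.
Qed.

(** [walk_nonpositive] with [b = c h] gives [a c h P(Z_h = 0) <= c h - mu_Z h]. Divide by [h], use
    [P(Z_h = 0) >= 1 - nuZ h], and let the mesh tend to 0. *)
Lemma prob_supY_le0 : mean (Z 1) < c ->
  c * prob [set w | (supY w <= 0)%E] <= c - mean (Z 1).
Proof.
move=> Zc; have nu0 : 0 <= fine (nuZ setT) by rewrite fine_ge0.
set a := prob _.
have mY := measurable_set_le0 measurable_supY.
have a1 : a <= 1 by exact: prob_le1.
have a0 : 0 <= a by exact: prob_ge0.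
apply: (@le_of_le_mesh _ _ _ (c * fine (nuZ setT)) 0).
  by rewrite mulr_ge0// ltW.
move=> n _; have h0 : 0 < mesh n by rewrite invr_gt0 ltr0n expn_gt0.
have h1 : mesh n <= 1 by rewrite invf_le1 ?ltr0n ?expn_gt0// ler1n expn_gt0.
pose zeta k w := (cell_increment Z C (mesh n) k w).1.
have zeta_iid : iid P zeta.
  have := iid_cell_increment subZ.1 subC.1 ZC_indep (ltW h0).
  by move/(iid_comp measurable_fst).
have zeta_ge0 i w : 0 <= zeta i w.
  rewrite subr_ge0; apply: (subordinator_nd subZ); first by rewrite mulr_ge0// ltW.
  by rewrite ler_wpM2r ?ler_nat// ltW.
have zeta0 : zeta 0%N = Z (mesh n).
  by apply/funext => w; rewrite /zeta /= mul0r mul1r (levy_start subZ.1) subr0.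
have Lz : L1 P (zeta 0%N).
  by rewrite zeta0; exact: subordinator_L1 subZ muZ_fin _ (ltW h0) h1.
have mz : mean (zeta 0%N) = mean (Z 1) * mesh n.
  rewrite zeta0 (subordinator_mean subZ muZ_fin (expn_gt0 2 n)) mulrAC mulfV ?mul1r//.
have sum_zeta m w : \sum_(i < m) (zeta i w - c * mesh n) =
    - c * (m%:R * mesh n) + Z (m%:R * mesh n) w.
  elim: m => [|m IH].
    by rewrite big_ord0 mul0r mulr0 (levy_start subZ.1) addr0.
  rewrite big_ord_recr /= IH /zeta /= -[in X in _ = - c * X + _]natr1; ring.
have mzb : mean (zeta 0%N) < c * mesh n by rewrite mz ltr_pM2r.
have ha m : a <= prob [set w | forall k, (k <= m)%N ->
    \sum_(i < k) (zeta i w - c * mesh n) <= 0].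
  have iidb : iid P (fun k w => zeta k w - c * mesh n).
    apply: (iid_comp (f := fun x : R => x - c * mesh n)) zeta_iid.
    exact: measurable_funB.
  apply: le_prob => //; first exact: measurable_partial_sums_le iidb m 0.
  move=> w /= Yw k _; rewrite sum_zeta -lee_fin; apply: le_trans Yw.
  by apply: ereal_sup_ubound; exists (k%:R * mesh n) => //=; rewrite mulr_ge0// ltW.
have := walk_nonpositive zeta_iid (mulr_gt0 c_gt0 h0) zeta_ge0 Lz mzb ha.
rewrite mz zeta0.
have mZ : measurable_fun setT (Z (mesh n)) by apply: (subordinator_measurable subZ); exact: ltW.
have -> : prob (Z (mesh n) @^-1` [set 0]) = 1 - prob [set w | 0 < Z (mesh n) w].
  rewrite -probC.
    congr prob; apply/seteqP; split=> w /=; first by move=> ->; rewrite ltxx.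
    move=> /negP; rewrite -leNgt => Zle; apply/eqP; rewrite eq_le Zle.
    by rewrite (subordinator_ge0 subZ)// ltW.
  rewrite (_ : [set w | _] = Z (mesh n) @^-1` `]0, +oo[); first exact: measurable_preimage.
  by apply/seteqP; split=> w /=; rewrite in_itv/= andbT.
have := prob_active_le subZ driftZ levyZ (expn_gt0 2 n).
rewrite mulrC -ler_pdivlMr ?ltr0n ?expn_gt0// -/(mesh n).
set p := prob _; set nu := fine _ in nu0 *; set m := mean _; set h := mesh n in h0 h1 *.
move=> pnu; rewrite [a * _]mulrA -!mulrA [h * _]mulrC !mulrA -mulrBl ler_pM2r// => H.
have : c * a * p <= c * (nu * h).
  rewrite -mulrA ler_pM2l//; apply: (@le_trans _ _ (1 * p)).
    by rewrite ler_wpM2r ?prob_ge0.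
  by rewrite mul1r.
by move: H; rewrite mulrBr mulr1 [a * c]mulrC !mulrA; lra.
Qed.

Lemma prob_supX_gt0 : nuZ setT <> 0%E -> c < mean (Z 1) + mean (C 1) ->
  exists2 eta, 0 < eta &
    c * prob [set w | (0 < supX w)%E] <= mean (Z 1) - eta.
Proof.
move=> nu0 c_lt.
have pZ := subordinator_nontrivial subZ levyZ nu0.
have [x2 [delta [x20 delta0 Hdelta]]] := jump_size_bound subZ driftZ pZ.
pose x := x2 / 2; have x0 : 0 < x by rewrite divr_gt0.
have xE : 2 * x = x2 by rewrite mulrC divfK.
have [kappa [q [kappa0 Hkappa]]] :=
  net_stays_above c_gt0 subZ subC ZC_indep driftZ levyZ muZ_fin muC_fin nu0 c_lt x0.
exists (x * delta * kappa); first by rewrite !mulr_gt0.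
have [B1 [mB1 PB1 HB1]] := jump_times_finite subC driftC levyC.
have [B2 [mB2 PB2 HB2]] :=
  eventually_no_common_cell subZ subC driftZ driftC levyZ levyC ZC_indep.
have mX := measurable_supX.
have mpos : measurable [set w | (0 < supX w)%E].
  rewrite (_ : [set w | _] = ~` [set w | (supX w <= 0)%E]).
    by apply: measurableC; exact: measurable_set_le0.
  by apply/seteqP; split=> w /=; rewrite ltNge => /negP.
pose A N n := Z_passage c Z C N n.
have mA N n : measurable (A N n).
  exact: (measurable_Z_passage c subZ subC ZC_indep N n).
have h_ge0 n : 0 <= mesh n by rewrite invr_ge0.
have nuZ_ge0 : 0 <= fine (nuZ setT) by rewrite fine_ge0.
have nuC_ge0 : 0 <= fine (nuC setT) by rewrite fine_ge0.
pose k N := c * fine (nuZ setT) * (1 + N%:R * (fine (nuZ setT) + fine (nuC setT))).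
have k0 N : 0 <= k N.
  apply: mulr_ge0; first by rewrite mulr_ge0// ltW.
  by rewrite addr_ge0// mulr_ge0// addr_ge0.
have pA N n : (q <= n)%N ->
    c * prob (A N.+1 n) <= mean (Z 1) - x * delta * kappa + k N.+1 * mesh n.
  move=> qn; have := prob_Z_passage c_gt0 subZ subC ZC_indep driftZ driftC
    levyZ levyC muZ_fin n (ltn0Sn N) (ltW x0).
  move=> /le_trans; apply; rewrite lerD2r lerB//.
  rewrite xE -mulrA -[leRHS]mulrA ler_pM2l//.
  apply: ler_pM; [exact: ltW|exact: ltW| |exact: Hkappa].
  by apply: Hdelta; rewrite expn_gt0.
(* Horizon and starting level are merged into one index so that the events increase. Within each,
   the horizon is fixed and the mesh may tend to 0, which removes the error [k j.+1 * mesh n]. *)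
pose E j := \bigcap_(n in [set n | (j <= n)%N]) A j.+1 n.
have mE j : measurable (E j).
  by apply: bigcap_measurable => [|n _]; first by exists j => /=.
have ndE j : E j `<=` E j.+1.
  move=> w Ew n /= jn; have [i iN Hi] := Ew n (ltnW jn).
  by exists i => //; apply: leq_trans iN _; rewrite leq_mul2r leqnSn orbT.
have pE j : prob (E j) <= (mean (Z 1) - x * delta * kappa) / c.
  rewrite ler_pdivlMr// mulrC.
  apply: (@le_of_le_mesh _ _ _ (k j.+1) (maxn q j)) => // n.
  rewrite geq_max => /andP[qn jn]; apply: le_trans (pA j n qn).
  by rewrite ler_pM2l//; apply: le_prob => // w; exact.
have mU : measurable (\bigcup_j E j) by exact: bigcupT_measurable.
have pU := prob_bigcup_nondecreasing_le mE ndE pE.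
rewrite mulrC -ler_pdivlMr//; apply: le_trans pU.
have sub : [set w | (0 < supX w)%E] `<=` (\bigcup_j E j) `|` (B1 `|` B2).
  move=> w /= Xw.
  have [b1|nb1] := pselect (B1 w); first by right; left.
  have [b2|nb2] := pselect (B2 w); first by right; right.
  left; have [_ [t [t0 ts] <-]] := ereal_sup_gt Xw; rewrite lte_fin => Xt.
  have [N [n0 HN]] := sup_before_jump_Z_passage c_gt0 subZ subC driftC
    (HB1 w nb1) (HB2 w nb2) (ex_intro _ t (And3 t0 ts Xt)).
  exists (maxn N n0) => // n /=; rewrite geq_max => /andP[Nn n0n].
  have [i iN Hi] := HN n n0n; exists i => //; apply: leq_trans iN _.
  by rewrite leq_mul2r (leqW (leq_maxl _ _)) orbT.
have mB : measurable (B1 `|` B2) by exact: measurableU.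
have PB : P (B1 `|` B2) = 0%E by rewrite null_set_setU.
rewrite -lee_fin -!probE//.
apply: (@le_trans _ _ (P ((\bigcup_j E j) `|` (B1 `|` B2)))).
  by apply: le_measure => //; apply/mem_set => //; exact: measurableU.
have : (P ((\bigcup_j E j) `|` (B1 `|` B2)) <= P (\bigcup_j E j) + P (B1 `|` B2))%E.
  exact: measureU2.
by rewrite [X in (_ <= _ + X)%E]PB adde0.
Qed.

End suprema.

Theorem proposition2p3 (d : measure_display) (T : measurableType d)
  (R : realType) (P : probability T R) (c : R) (Z C : R -> T -> R)
  (nuZ nuC : {finite_measure set R -> \bar R})
  (c_gt0 : 0 < c)
  (subZ : subordinator P Z) (subC : subordinator P C)
  (ZC_indep : independent_processes P Z C)
  (driftZ : without_drift Z) (driftC : without_drift C)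
  (levyZ : is_levy_measure P Z nuZ) (levyC : is_levy_measure P C nuC)
  (muZ_fin : ('E_P[Z 1%R] < +oo)%E) (muC_fin : ('E_P[C 1%R] < +oo)%E)
  (* Z is not the zero process: for Z = 0 both suprema below vanish almost
     surely, so their distributions coincide. *)
  (nuZ_neq0 : nuZ setT <> 0%E)
  (muZ_lt_c : ('E_P[Z 1%R] < c%:E)%E)
  (c_lt_mu : (c%:E < 'E_P[Z 1%R] + 'E_P[C 1%R])%E) :
  let Y : R -> T -> R := fun t w => - c * t + Z t w in
  let X : R -> T -> R := fun t w => - c * t + Z t w + C t w in
  let sigma : T -> \bar R := first_new_sup_jump X C in
  let supY : T -> \bar R :=
    fun w => ereal_sup [set (Y t w)%:E | t in [set t : R | 0 <= t]] in
  let supX : T -> \bar R := fun w =>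
    ereal_sup [set (X t w)%:E | t in [set t : R | 0 <= t /\ (t%:E < sigma w)%E]] in
  different_distributions P supY supX.
Proof.
move=> Y X sigma supY supX.
have mY : measurable_fun setT supY by exact: measurable_supY subZ.
have mX : measurable_fun setT supX by exact: measurable_supX subZ subC.
split=> // same.
have EZ : ('E_P[Z 1%R] = (mean P (Z 1))%:E)%E.
  by rewrite unlock meanE//; exact: subordinator_L1 subZ muZ_fin _ ler01 (lexx _).
have EC : ('E_P[C 1%R] = (mean P (C 1))%:E)%E.
  by rewrite unlock meanE//; exact: subordinator_L1 subC muC_fin _ ler01 (lexx _).
rewrite EZ lte_fin in muZ_lt_c; rewrite EZ EC -EFinD lte_fin in c_lt_mu.
have pY := prob_supY_le0 c_gt0 subZ subC ZC_indep driftZ levyZ muZ_fin muZ_lt_c.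
have [eta eta0 pX] := prob_supX_gt0 c_gt0 subZ subC ZC_indep driftZ driftC
  levyZ levyC muZ_fin muC_fin nuZ_neq0 c_lt_mu.
have mXle : measurable [set w | (supX w <= 0)%E] by exact: measurable_set_le0.
have pXC : prob P [set w | (0 < supX w)%E] = 1 - prob P [set w | (supX w <= 0)%E].
  rewrite -probC//; congr prob; apply/seteqP; split=> w /=; rewrite ltNge => /negP//.
(* Equality of the laws is used only on the half-line []-oo, 0]]. *)
have E : prob P [set w | (supY w <= 0)%E] = prob P [set w | (supX w <= 0)%E].
  have le0E (S : T -> \bar R) : [set w | (S w <= 0)%E] = S @^-1` `]-oo, 0%E].
    by apply/seteqP; split=> w /=; rewrite in_itv.
  by rewrite /prob !le0E same//; exact: emeasurable_itv.
move: pX; rewrite -/(supX) [prob P _]pXC mulrBr mulr1 -E => pX.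
by move: pY pX eta0; rewrite -/supY; move: (c * _) => u; lra.
Qed.
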